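(* Let $(X_{j,n})_{1\le j\le n,\,n\ge 1}$ be a triangular array of random variables with values in $\mathbb{R}\setminus\{0\}$ such that for each $n\ge 1$ the sequence $(X_{j,n})_{1\le j\le n}$ is strictly stationary. Suppose that the array satisfies (AN), (AD-1) with sequences $(r_n)_n$, $(k_n)_n$, and (AC) with the same sequence $(r_n)_n$ as in (AD-1) (these conditions and the number $m_0$ are defined in the context). Let $N$ be an infinitely divisible point process on $\mathbb{R}\setminus\{0\}$ with canonical measure $\lambda$, let $D$ be the set of fixed atoms of $N$, and let $D'=\{x>0:\ x\in D \text{ or } -x\in D\}$. For $1\le m\le n$ let $N_{m,n}=\sum_{j=1}^{m}\delta_{X_{j,n}}$ and $M_{m,n}=\max_{1\le j\le m}|X_{j,n}|$, and let $N_n=N_{n,n}$. Then the following statements are equivalent: (i) $N_n\stackrel{d}{\to}N$ as $n\to\infty$; (ii) $\lambda(M_0^c)=0$, and the following two conditions hold: (a') for any $x>0$ with $x\notin D'$, $$\lim_{m\to m_0}\limsup_{n\to\infty}\big|\,n[P(M_{m,n}>x)-P(M_{m-1,n}>x)]-\lambda(M_x)\,\big|=0;$$ (b') for any $x>0$ with $x\notin D'$ and any set $M\in\mathcal{J}_{x,\lambda}$, $$\lim_{m\to m_0}\limsup_{n\to\infty}\big|\,n[P(N_{m,n}\in M,\ M_{m,n}>x)-P(N_{m-1,n}\in M,\ M_{m-1,n}>x)]-\lambda(M\cap M_x)\,\big|=0.$$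
   Context: Space. $E=[-\infty,\infty]\setminus\{0\}$ (a locally compact Hausdorff space with countable basis), $\mathcal{B}$ is the class of relatively compact Borel subsets of $E$, and $C_K^+(E)$ is the class of continuous functions $f:E\to[0,\infty)$ with compact support. For $x>0$, $[-x,x]^c:=[-\infty,-x)\cup(x,\infty]\in\mathcal{B}$. $M_p(E)$ is the set of Radon measures on $E$ with values in $\mathbb{Z}_+=\{0,1,2,\dots\}$ on $\mathcal{B}$, with the topology of vague convergence and its Borel $\sigma$-field; $o$ is the null measure; $\mu(f)=\int_E f\,d\mu$. Point processes. A point process is a measurable map $N:\Omega\to M_p(E)$, where $(\Omega,\mathcal{K},P)$ is a probability space. All point processes here have their points in $\mathbb{R}\setminus\{0\}$, viewed as a subset of $E$; so a point process on $\mathbb{R}\setminus\{0\}$ is regarded as a point process on $E$ with $N(\{-\infty,\infty\})=0$ a.s. Convergence $\stackrel{d}{\to}$ is convergence in distribution of random elements of $M_p(E)$. A point process $N$ is infinitely divisible if for every $k\ge1$ there are i.i.d. point processes $(N_{i,k})_{1\le i\le k}$ with $N\stackrel{d}{=}\sum_{i=1}^k N_{i,k}$. Its canonical measure is the measure $\lambda$ on $M_p(E)\setminus\{o\}$ (with $\lambda(\{\mu:\mu(B)>0\})<\infty$ for all $B\in\mathcal{B}$) such that $E(e^{-N(f)})=\exp\{-\int_{M_p(E)\setminus\{o\}}(1-e^{-\mu(f)})\lambda(d\mu)\}$ for all $f\in C_K^+(E)$. A point $x$ is a fixed atom of $N$ if $P(N\{x\}>0)>0$. Sets of measures. $M_0=\{\mu\in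 M_p(\mathbb{R}\setminus\{0\}):\ \mu\ne o,\ \exists\,x\in(0,\infty)\text{ with }\mu([-x,x]^c)=0\}$ (viewed inside $M_p(E)$), $M_0^c$ is its complement in $M_p(E)\setminus\{o\}$, and for $x>0$, $M_x=\{\mu\in M_0:\ \mu([-x,x]^c)>0\}$. For $x>0$, $\mathcal{B}_{x,\lambda}=\{B\in\mathcal{B}:\ \lambda(\{\mu\in M_x:\mu(\partial B)>0\})=0\}$, and $\mathcal{J}_{x,\lambda}$ is the class of sets $M=\bigcap_{i=1}^d\{\mu\in M_p(E):\mu(B_i)\ge k_i\}$ with $d\ge1$, $B_i\in\mathcal{B}_{x,\lambda}$ and integers $k_i\ge1$. Conditions on the array. (AN): $\limsup_{n\to\infty}nP(|X_{1,n}|>\varepsilon)<\infty$ for all $\varepsilon>0$. (AD-1): there exists $(r_n)_n\subset\mathbb{N}$ with $r_n\to\infty$ and $k_n=[n/r_n]\to\infty$ such that $\lim_{n\to\infty}\big|E(e^{-\sum_{j=1}^{n}f(X_{j,n})})-\{E(e^{-\sum_{j=1}^{r_n}f(X_{j,n})})\}^{k_n}\big|=0$ for all $f\in C_K^+(E)$. (AC): there exists $(r_n)_n\subset\mathbb{N}$ with $r_n\to\infty$ such that $\lim_{m\to m_0}\limsup_{n\to\infty}n\sum_{j=m+1}^{r_n}P(|X_{1,n}|>\varepsilon,|X_{j,n}|>\varepsilon)=0$ for all $\varepsilon>0$, where $m_0:=\inf\{m\in\mathbb{Z}_+:\ \lim_{n\to\infty}n\sum_{j=m+1}^{r_n}P(|X_{1,n}|>\varepsilon,|X_{j,n}|>\varepsilon)=0\text{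 for all }\varepsilon>0\}$. Conventions: $\inf\emptyset=\infty$; $\lim_{m\to m_0}\phi(m)=\phi(m_0)$ if $m_0<\infty$; for $m\le 0$, $N_{m,n}=o$ and $M_{m,n}=0$. *)

(* Defs.v *)
From HB Require Import structures.
From mathcomp Require Import all_boot all_order all_algebra.
From mathcomp Require Import all_classical all_reals all_analysis.

Set Implicit Arguments.
Unset Strict Implicit.
Unset Printing Implicit Defensive.

Import Order.TTheory GRing.Theory Num.Theory.
Import numFieldNormedType.Exports.

Local Open Scope classical_set_scope.
Local Open Scope ring_scope.

Record E (R : realType) := MkE {
  E_val :> \bar R ;
  E_neq0 : E_val != 0%E }.

Section E_structures.
Variable R : realType.

HB.instance Definition _ := [isSub for @E_val R].
HB.instance Definition _ := [Choice of E R by <:].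

Fact oneE_neq0 : (1%:E : \bar R) != 0%E.
Proof. by rewrite eqe oner_neq0. Qed.

HB.instance Definition _ :=
  isPointed.Build (E R) (MkE oneE_neq0).

HB.instance Definition _ :=
  Topological.copy (E R) (initial_topology (@E_val R)).

HB.instance Definition _ :=
  Measurable.copy (E R) (g_sigma_algebraType (@open (E R))).

End E_structures.

Section sets_and_functions_on_E.
Variable R : realType.

(* [toE 0] is a junk value. *)
Definition toE (x : R) : E R := insubd (point : E R) x%:E.

Definition rcborel : set (set (E R)) :=
  [set B : set (E R) | measurable B /\ compact (closure B)].

Definition boundary (B : set (E R)) : set (E R) := closure B `\` interior B.

Definition outside (x : R) : set (E R) :=
  [set e : E R | (e < (- x)%:E :> \bar R)%E \/ (x%:E < e :> \bar R)%E].

Definition infpts : set (E R) := [set e : E R | e = -oo%E :> \bar R \/ e = +oo%E :> \bar R].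

Record CKplus := MkCKplus {
  CKfun :> E R -> R ;
  CK_ge0 : forall e, 0 <= CKfun e ;
  CK_continuous : continuous CKfun ;
  CK_compact_support : compact (closure [set e | CKfun e != 0]) }.

End sets_and_functions_on_E.

HB.instance Definition _ (R : realType) := gen_eqMixin (CKplus R).
HB.instance Definition _ (R : realType) := gen_choiceMixin (CKplus R).

Arguments rcborel {R}.
Arguments infpts R : clear implicits.

(* As E is locally compact with a countable base, a Borel measure finite on the
   relatively compact Borel sets is Radon. A measure of the library is a function
   on all subsets, constrained on measurable sets only; [Mp_default] fixes its
   values elsewhere, so that equality in [Mp R] is equality of measures. *)

Record Mp (R : realType) := MkMp {
  Mp_measure :> {measure set (E R) -> \bar R} ;
  Mp_nat : forall B, rcborel B -> exists k : nat, Mp_measure B = k%:R%:E ;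
  Mp_default : forall A, ~ measurable A -> Mp_measure A = 0%E }.

Section Mp_structures.
Variable R : realType.

HB.instance Definition _ := gen_eqMixin (Mp R).
HB.instance Definition _ := gen_choiceMixin (Mp R).

Lemma Mp_eqP (mu nu : Mp R) : (forall A, mu A = nu A) -> mu = nu.
Proof.
case: mu nu => [mu mun mud] [nu nun nud] /= munu.
have munuE : mu = nu by apply: eq_measure; apply/funext.
by move: mun mud; rewrite munuE => mun mud; congr MkMp; exact: Prop_irrelevance.
Qed.

Definition borel_part (mu : {measure set (E R) -> \bar R}) (A : set (E R)) :
  \bar R := if `[< measurable A >] then mu A else 0%E.

Lemma borel_partE mu A : measurable A -> borel_part mu A = mu A.
Proof. by move=> mA; rewrite /borel_part asboolT. Qed.

Section borel_part_measure.
Variable mu : {measure set (E R) -> \bar R}.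

Let borel_part0 : borel_part mu set0 = 0%E.
Proof. by rewrite borel_partE. Qed.

Let borel_part_ge0 A : (0 <= borel_part mu A)%E.
Proof. by rewrite /borel_part; case: ifP. Qed.

Let borel_part_sigma_additive : semi_sigma_additive (borel_part mu).
Proof.
move=> F mF tF mUF; rewrite borel_partE//.
under eq_fun do under eq_bigr do rewrite borel_partE//.
exact: measure_semi_sigma_additive.
Qed.

HB.instance Definition _ := isMeasure.Build _ _ _ (borel_part mu)
  borel_part0 borel_part_ge0 borel_part_sigma_additive.
End borel_part_measure.

Definition Mp_mzero : {measure set (E R) -> \bar R} := mzero.

Definition Mp_zero : Mp R.
Proof.
by refine (@MkMp R Mp_mzero _ _) => [B _|//]; exists 0.
Defined.

Definition Mp_add (mu nu : Mp R) : Mp R.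
Proof.
refine (@MkMp R (measure_add mu nu) _ _) => [B rB|A mA].
- have [k muB] := Mp_nat mu rB; have [l nuB] := Mp_nat nu rB.
  by exists (k + l)%N; rewrite [LHS]measure_addE natrD EFinD -muB -nuB.
- by rewrite [LHS]measure_addE !Mp_default// adde0.
Defined.

Lemma Mp_addE mu nu A : Mp_add mu nu A = (mu A + nu A)%E.
Proof. exact: measure_addE. Qed.

Definition Mp_dirac (e : E R) : Mp R.
Proof.
refine (@MkMp R (borel_part \d_e) _ _) => [B [mB _]|A mA].
- by exists (e \in B); rewrite [LHS]borel_partE// [LHS]diracE.
- by rewrite /= /borel_part asboolF.
Defined.

Fact Mp_addA : associative Mp_add.
Proof. by move=> x y z; apply: Mp_eqP => A; rewrite !Mp_addE addeA. Qed.

Fact Mp_addC : commutative Mp_add.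
Proof. by move=> x y; apply: Mp_eqP => A; rewrite !Mp_addE addeC. Qed.

Fact Mp_add0 : left_id Mp_zero Mp_add.
Proof. by move=> x; apply: Mp_eqP => A; rewrite Mp_addE add0e. Qed.

(* [0 : Mp R] is the null measure o. *)
HB.instance Definition _ := GRing.isNmodule.Build (Mp R) Mp_addA Mp_addC Mp_add0.

HB.instance Definition _ := isPointed.Build (Mp R) 0.

Definition Mp_int (mu : Mp R) (f : CKplus R) : R := \int[mu]_e f e.

(* The vague topology: the coarsest one making every mu |-> mu(f) continuous. *)
HB.instance Definition _ := Topological.copy (Mp R)
  (initial_topology (Mp_int : Mp R -> prod_topology (fun _ : CKplus R => R))).

HB.instance Definition _ :=
  Measurable.copy (Mp R) (g_sigma_algebraType (@open (Mp R))).

End Mp_structures.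

Section random_elements.
Variable R : realType.

(* The laws, hence the underlying probability spaces, may vary with n. *)
Definition cvg_in_distribution (T : topologicalType)
    (d : nat -> measure_display) (Omega : forall n, measurableType (d n))
    (P : forall n, probability (Omega n) R) (Z_ : forall n, Omega n -> T)
    (d0 : measure_display) (Omega0 : measurableType d0)
    (P0 : probability Omega0 R) (Z : Omega0 -> T) : Prop :=
  forall phi : T -> R, continuous phi -> (exists C : R, forall t, `|phi t| <= C) ->
    ('E_(P n)[phi \o Z_ n] @[n --> \oo] --> 'E_P0[phi \o Z])%E.

Definition eq_in_distribution (d' : measure_display) (T : measurableType d')
    (d1 d2 : measure_display)
    (Omega1 : measurableType d1) (P1 : probability Omega1 R) (Z1 : Omega1 -> T)
    (Omega2 : measurableType d2) (P2 : probability Omega2 R) (Z2 : Omega2 -> T)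
    : Prop :=
  forall A : set T, measurable A -> P1 (Z1 @^-1` A) = P2 (Z2 @^-1` A).

Definition mutually_independent (d' : measure_display) (T : measurableType d')
    (d : measure_display) (Omega : measurableType d) (P : probability Omega R)
    (k : nat) (Z : 'I_k -> Omega -> T) : Prop :=
  forall (J : {set 'I_k}) (A : 'I_k -> set T), (forall i, measurable (A i)) ->
    P (\bigcap_(i in [set` J]) Z i @^-1` A i) =
      (\prod_(i in J) P (Z i @^-1` A i))%E.

End random_elements.

Section point_processes.
Variables (R : realType) (d : measure_display) (Omega : measurableType d).
Variables (P : probability Omega R) (N : {RV P >-> Mp R}).

Definition on_real_line : Prop := {ae P, forall w, N w (infpts R) = 0%E}.

Definition infinitely_divisible : Prop :=
  forall k : nat, (0 < k)%N ->
    exists (d' : measure_display) (Omega' : measurableType d')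
      (P' : probability Omega' R) (Nk : 'I_k -> {RV P' >-> Mp R}),
      [/\ mutually_independent P' (fun i => Nk i : Omega' -> Mp R),
          forall i j, eq_in_distribution P' (Nk i) P' (Nk j) &
          eq_in_distribution P N P' (fun w => \sum_(i < k) Nk i w)].

(* A measure on M_p(E) \ {o} is seen as a measure on M_p(E) null at o. *)
Definition canonical_measure (lambda : {measure set (Mp R) -> \bar R}) : Prop :=
  [/\ lambda [set 0] = 0%E,
      forall B, rcborel B -> (lambda [set mu : Mp R | (0 < mu B)%E] < +oo)%E &
      forall f : CKplus R,
        'E_P[fun w => expR (- Mp_int (N w) f)]%E =
        expeR (- \int[lambda]_(mu in ~` [set 0%R])
                   (1 - expR (- Mp_int mu f))%R%:E)%E].

Definition fixed_atom (x : R) : Prop :=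
  x != 0 /\ (0 < P [set w | (0 < N w [set toE x])%E])%E.

Definition fixed_atom_modulus (x : R) : Prop :=
  0 < x /\ (fixed_atom x \/ fixed_atom (- x)).

End point_processes.

Section sets_of_measures.
Variable R : realType.

(* mu belongs to M_p(R \ {0}) iff it does not charge -oo and +oo. *)
Definition M0 : set (Mp R) :=
  [set mu : Mp R | [/\ mu (infpts R) = 0%E, mu != 0 &
                exists2 x, 0 < x & mu (outside x) = 0%E]].

Definition M0c : set (Mp R) := (~` [set 0]) `\` M0.

Definition Mx (x : R) : set (Mp R) :=
  [set mu : Mp R | M0 mu /\ (0 < mu (outside x))%E].

Variable lambda : {measure set (Mp R) -> \bar R}.

Definition Bxl (x : R) : set (set (E R)) :=
  [set B | rcborel B /\ lambda [set mu : Mp R | Mx x mu /\ (0 < mu (boundary B))%E] = 0%E].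

Definition Jxl (x : R) : set (set (Mp R)) :=
  [set M | exists (d : nat) (B : 'I_d -> set (E R)) (k : 'I_d -> nat),
     [/\ (0 < d)%N, forall i, Bxl x (B i), forall i, (0 < k i)%N &
         M = \bigcap_(i in [set: 'I_d]) [set mu : Mp R | ((k i)%:R%:E <= mu (B i))%E]]].

End sets_of_measures.
Arguments M0 R : clear implicits.
Arguments M0c R : clear implicits.

Section arrays.
Variables (R : realType) (d : nat -> measure_display).
Variables (Omega : forall n, measurableType (d n)).
Variables (P : forall n, probability (Omega n) R).
(* [X n j] is X_{j,n}; only the entries with 1 <= j <= n matter. *)
Variable X : forall n, nat -> {RV (P n) >-> R}.

Definition nonzero_array : Prop :=
  forall n j, (1 <= j <= n)%N -> forall w, X n j w != 0.

Definition stationary_rows : Prop :=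
  forall n m h : nat, (h + m <= n)%N ->
    eq_in_distribution
      (P n) (fun w => [tuple X n i.+1 w | i < m])
      (P n) (fun w => [tuple X n (h + i.+1) w | i < m]).

(* With m = 0, [Nmn] is o and [Mmn] is 0; since 0.-1 = 0, the index m.-1 also
   respects the convention that these are o and 0 at the index -1. *)
Definition Nmn (m n : nat) (w : Omega n) : Mp R :=
  \sum_(1 <= j < m.+1) Mp_dirac (toE (X n j w)).

Definition Mmn (m n : nat) (w : Omega n) : R :=
  \big[Num.max/0]_(1 <= j < m.+1) `|X n j w|.

Definition cond_AN : Prop :=
  forall eps : R, 0 < eps ->
    (limn_esup (fun n => n%:R%:E * P n [set w | (eps < `|X n 1 w|)%R]) < +oo)%E.

Definition cond_AD1 (r : nat -> nat) : Prop :=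
  [/\ forall n, (0 < n)%N -> (0 < r n)%N,
      r n @[n --> \oo] --> \oo,
      (n %/ r n)%N @[n --> \oo] --> \oo &
      forall f : CKplus R,
        (`| 'E_(P n)[fun w => expR (- \sum_(1 <= j < n.+1) f (toE (X n j w)))]
            - 'E_(P n)[fun w => expR (- \sum_(1 <= j < (r n).+1) f (toE (X n j w)))]
              ^+ (n %/ r n) | @[n --> \oo] --> 0)%E].

Definition cluster_tail (r : nat -> nat) (eps : R) (m n : nat) : \bar R :=
  (n%:R%:E * \sum_(m.+1 <= j < (r n).+1)
               P n [set w | (eps < `|X n 1 w|)%R /\ (eps < `|X n j w|)%R])%E.

Definition m0 (r : nat -> nat) : \bar R :=
  ereal_inf [set m%:R%:E | m in [set m : nat | forall eps : R, 0 < eps ->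
    cluster_tail r eps m n @[n --> \oo] --> 0%E]].

(* The limit as m -> m0, which is the value at m0 when m0 is finite; the infimum
   [m0] above, if finite, is attained at a natural number. *)
Definition lim_to_m0 (m0 : \bar R) (phi : nat -> \bar R) (l : \bar R) : Prop :=
  (m0 = +oo%E -> phi m @[m --> \oo] --> l) /\
  (m0 <> +oo%E -> exists2 m : nat, m%:R%:E = m0 & phi m = l).

Definition cond_AC (r : nat -> nat) : Prop :=
  [/\ forall n, (0 < n)%N -> (0 < r n)%N,
      r n @[n --> \oo] --> \oo &
      forall eps : R, 0 < eps ->
        lim_to_m0 (m0 r) (fun m => limn_esup (cluster_tail r eps m)) 0%E].

End arrays.

(* Main.v *)
(** Let [al_n] be [k_n] times the law of the point process of one block of
    length [r_n]. By (AD-1) the Laplace functional of [N_n] is asymptotically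
    [(1 - al_n(1 - e^(-mu(f))) / k_n)^k_n], so that (i) means that
    [al_n(1 - e^(-mu(f)))] tends to [lambda(1 - e^(-mu(f)))] for every [f] in [C_K^+].
    Indeed Laplace functionals determine convergence in distribution: the vague
    topology has a countable base, so a bounded continuous function is, up to a
    constant, a countable supremum of elements of the uniform closure of the algebra
    spanned by the [e^(-mu(f))]; applying this to [phi] and [- phi] avoids tightness.

    This convergence is equivalent to that of [al_n(J)] for the finite intersections
    [J] of sets [mu(B) >= k] with null boundary, one of them being [mu([-x, x]^c) >= 1].
    In one direction [J] is squeezed between smooth thresholds of inner and outer
    approximations of the sets [B]; in the other, [f] is replaced by a staircase on its
    level sets, (AN) bounding the first moments.

    Finally, [al_n(J)] telescopes over the end points of a block. By stationarity all
    increments but the first [m] equal [P(N_m in J) - P(N_(m-1) in J)], up to the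
    probability that two exceedances are at least [m] apart in the block, which
    (AC) controls. *)

Require Import Defs.
From HB Require Import structures.
From mathcomp Require Import all_boot all_order all_algebra.
From mathcomp Require Import all_classical all_reals all_analysis.
From mathcomp Require Import measurable_realfun.
From mathcomp Require Import ring lra zify.

Set Implicit Arguments.
Unset Strict Implicit.
Unset Printing Implicit Defensive.

Import Order.TTheory GRing.Theory Num.Theory.
Import numFieldNormedType.Exports.

Local Open Scope classical_set_scope.
Local Open Scope ring_scope.

(** * The compactified punctured line *)

(** The obstacle is the null measure. The mass [k_n] of [al_n] tends to infinity and [lambda] may be
    infinite, so only integrands vanishing on the measures that miss some set bounded away from 0
    can be controlled. Hence the condition [locfin]: the measures hitting a relatively compact set
    have finite mass. Hence also the role of [1 - e^(-mu(f))], which vanishes when [mu] misses the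
    support of [f]. It serves as a weight: [(1 - e^(-mu(f))) e^(-mu(g))] is a difference of two
    functions of the same kind, so the convergence of their integrals extends to
    [(1 - e^(-mu(f))) F] for every [F] in the closed algebra.

    All cuts must be generic. Among disjoint subsets of a relatively compact set only countably many
    are hit with positive mass. For the spheres [|y| = x] this leaves enough radii outside [D'], and
    for the level sets of [f] enough levels with null boundary.

    Counts are integers: a continuous threshold of [mu(f)] can therefore restrict to an exact
    indicator on the values of [mu(B)], and a mass below 1 is null. *)

Section chart.
Variable R : realType.
Implicit Types (e : E R) (U : set (E R)).

(** Identifies [E] with [-1, 1] minus 0. The distance of extended reals is the distance of their
    contractions, so topological questions on [E] become inequalities between reals. *)
Definition chart e : R := contract (e : \bar R).

Lemma chart_nbhsP e U :
  nbhs e U <-> exists2 eps : R, 0 < eps & forall y, `|chart e - chart y| < eps -> U y.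
Proof.
have -> : nbhs e U <-> @nbhs_ball R (initial_topology (@E_val R)) e U.
  refine (@nbhs_ballP R (initial_topology (@E_val R)) e U).
by split=> -[eps /= eps0 h]; exists eps.
Qed.

Lemma chart_cont : continuous chart.
Proof.
move=> e U /nbhs_ballP[eps /= eps0 h]; apply/chart_nbhsP.
by exists eps => // y ye; exact: h.
Qed.

Lemma chart_neq0 e : chart e != 0.
Proof. by rewrite contract_eq0 E_neq0. Qed.

Lemma chart_le1 e : `|chart e| <= 1.
Proof. exact: contract_le1. Qed.

Lemma chart_onto (y : R) : y != 0 -> `|y| <= 1 -> exists e, chart e = y.
Proof.
move=> y0 y1; have ey0 : expand y != 0%E.
  by rewrite -contract_eq0 expandK// inE.
by exists (MkE ey0); rewrite /chart /= expandK// inE.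
Qed.

Lemma open_chartP U : open U <-> forall e, U e ->
  exists2 eps : R, 0 < eps & forall y, `|chart e - chart y| < eps -> U y.
Proof.
rewrite openE; split=> h e /h; first by move/chart_nbhsP.
by move=> ?; apply/chart_nbhsP.
Qed.

(** A compact exhaustion of [E] as [eta] decreases to 0. Relative compactness is used below only as
    inclusion in some [far eta]. *)
Definition far (eta : R) : set (E R) := [set e | eta <= `|chart e|].

Lemma closed_far eta : closed (far eta).
Proof.
rewrite -openC; apply/open_chartP => e /= /negP; rewrite -ltNge => he.
exists (eta - `|chart e|) => [|y ye /=]; first by rewrite subr_gt0.
apply/negP; rewrite -ltNge.
have : `|chart y| <= `|chart e| + `|chart e - chart y|.
  by rewrite -[X in `|X| <= _](subKr (chart e)) ler_normB.
lra.
Qed.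

(** The set is the image of two compact intervals under an inverse of the chart, which is continuous
    there. *)
Lemma compact_far eta : 0 < eta -> compact (far eta).
Proof.
move=> eta0.
pose A : set R := [set y | -1 <= y <= - eta] `|` [set y | eta <= y <= 1].
have AP y : A y <-> eta <= `|y| <= 1.
  rewrite /A /= ; split.
    by move=> [/andP[? ?]|/andP[? ?]]; [rewrite ler0_norm|rewrite ger0_norm]; lra.
  have [y0|y0] := lerP 0 y.
    by rewrite ger0_norm//; right.
  by rewrite ltr0_norm// => /andP[? ?]; left; apply/andP; split; lra.
have [g gK] : exists g : R -> E R, forall y, A y -> chart (g y) = y.
  pose Q y e := A y -> chart e = y.
  suff /choice[g gK] : forall y, exists e, Q y e by exists g.
  move=> y; have [Ay|] := pselect (A y); last by exists point.
  move/AP: Ay => /andP[ya yb].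
  have [|e ey] := @chart_onto y _ yb; first by rewrite -normr_gt0; lra.
  by exists e.
have -> : far eta = g @` A.
  apply/seteqP; split=> [e /= he|e [y Ay <-]]; last first.
    by rewrite /far /= gK//; move/AP: Ay => /andP[].
  have Ae : A (chart e) by apply/AP; rewrite he chart_le1.
  exists (chart e) => //.
  have /(congr1 (@expand R)) := gK _ Ae.
  by rewrite /chart !contractK => /val_inj.
have cg : {within A, continuous g}.
  apply/subspace_continuousP => y Ay U /chart_nbhsP[eps eps0 hU].
  apply/nbhs_ballP; exists eps => // z /= yz Az; apply: hU.
  by rewrite !gK.
apply: (continuous_compact cg).
apply: compactU.
  rewrite (_ : [set _ | _] = `[-1, -eta]%classic); first exact: segment_compact.
  by apply/seteqP; split=> y /=; rewrite in_itv.
rewrite (_ : [set _ | _] = `[eta, 1]%classic); first exact: segment_compact.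
by apply/seteqP; split=> y /=; rewrite in_itv.
Qed.

(** Charts never vanish, so the nested open sets where the modulus of the chart exceeds [n.+1%:R^-1]
    cover [E], and a finite subcover reduces to its largest member. *)
Lemma compact_sub_far (K : set (E R)) : compact K ->
  exists2 eta : R, 0 < eta & K `<=` far eta.
Proof.
rewrite compact_cover => /(_ nat [set: nat] (fun n => [set e | n.+1%:R^-1 < `|chart e|])).
case.
- move=> n _; apply/open_chartP => e /= he.
  exists (`|chart e| - n.+1%:R^-1) => [|y ye]; first by rewrite subr_gt0.
  have : `|chart e| <= `|chart y| + `|chart e - chart y|.
    by rewrite -[X in `|X| <= _](subrK (chart y)) addrC ler_normD.
  by move: (n.+1%:R^-1) he ye => a he ye /=; lra.
- move=> e _; have : 0 < `|chart e| by rewrite normr_gt0 chart_neq0.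
  by move=> /ltr_add_invr[k]; rewrite add0r; exists k.
- move=> D _ KD; exists (\max_(i <- finmap.enum_fset D) i).+1%:R^-1 => // e /KD[n /= nD he].
  apply: le_trans (ltW he); rewrite lef_pV2 ?posrE// ler_nat ltnS.
  exact: (@leq_bigmax_seq _ _ xpredT id).
Qed.

Lemma rcborel_far (B : set (E R)) : rcborel B ->
  exists2 eta : R, 0 < eta & B `<=` far eta.
Proof.
move=> [_ /compact_sub_far[eta eta0 h]]; exists eta => //.
exact: subset_trans (@subset_closure _ B) h.
Qed.

Lemma far_rcborel eta (B : set (E R)) : 0 < eta -> measurable B ->
  B `<=` far eta -> rcborel B.
Proof.
move=> eta0 mB Bf; split=> //; apply: subclosed_compact (compact_far eta0) _.
  exact: closed_closure.
by rewrite closureE => e; apply; split => //; exact: closed_far.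
Qed.

End chart.

(** * Dominated convergence on a set of finite measure *)

Section finitely_supported_integrands.
Context d (T : measurableType d) (R : realType) (mu : {measure set T -> \bar R}).

Lemma measurable_gt_fun (f : T -> R) :
  (forall a, measurable [set x | a < f x]) -> measurable_fun setT f.
Proof.
move=> h; apply: (measurability (@RGenOInfty.G R)).
  exact: RGenOInfty.measurableE.
move=> _ [_ [a ->]] <-; rewrite setTI.
rewrite (_ : _ @^-1` _ = [set x | a < f x]); first exact: h.
by apply/seteqP; split=> x /=; rewrite in_itv/= andbT.
Qed.

(** With [mu A] finite, this is a domination that remains integrable even if [mu] has infinite total
    mass. *)
Definition carried (A : set T) (C : R) (f : T -> R) :=
  measurable_fun setT f /\ forall x, `|f x| <= C * \1_A x.

Lemma cvg_carried A C (f_ : nat -> T -> R) (f : T -> R) : (forall n, carried A C (f_ n)) ->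
  (forall x, f_ n x @[n --> \oo] --> f x) -> carried A C f.
Proof.
move=> fA fcvg; split.
  apply: (@measurable_fun_cvg _ _ _ _ f_) => // n.
  by have [] := fA n.
move=> x; rewrite leNgt; apply/negP => lt.
have [n _ /(_ n (leqnn _))] := cvgr_gt _ (cvg_norm (fcvg x)) _ lt.
by rewrite ltNge; have [_ ->] := fA n.
Qed.

Variables (A : set T) (mA : measurable A) (A_fin : (mu A < +oo)%E).

Lemma indic_integrable : mu.-integrable setT (EFin \o (\1_A : T -> R)).
Proof.
apply/integrableP; split; first exact/measurable_EFinP.
under eq_integral do rewrite /= ger0_norm//.
by rewrite integral_indic// setIT.
Qed.

Lemma carried_integrable C f : carried A C f -> mu.-integrable setT (EFin \o f).
Proof.
move=> [mf fA]; apply: (@le_integrable _ _ _ _ _ _ _ (fun x => C%:E * (\1_A x)%:E)%E) => //.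
- exact/measurable_EFinP.
- move=> x _ /=; rewrite lee_fin; apply: le_trans (fA x) _.
  exact: ler_norm.
- by apply: integrableZl => //; exact: indic_integrable.
Qed.

Lemma carried_cvg C (f_ : nat -> T -> R) (f : T -> R) : (forall n, carried A C (f_ n)) ->
  (forall x, f_ n x @[n --> \oo] --> f x) ->
  \int[mu]_x f_ n x @[n --> \oo] --> \int[mu]_x f x.
Proof.
move=> fA fcvg.
have [mf fC] := cvg_carried fA fcvg.
have if_ n := carried_integrable (fA n).
apply: fine_cvg; rewrite fineK; last first.
  exact/integrable_fin_num/(@carried_integrable C).
apply: (@dominated_cvg _ _ _ _ _ _ _ _ (fun x => C%:E * (\1_A x)%:E)%E) => //.
- by move=> n; have [/measurable_EFinP] := fA n.
- by move=> x _; apply: cvg_EFin; [exact: nearW|exact: fcvg].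
- by apply: integrableZl => //; exact: indic_integrable.
- by move=> n x _; rewrite lee_fin; have [_] := fA n.
Qed.

Lemma Rintegral_indic (B : set T) : measurable B ->
  \int[mu]_x \1_B x = fine (mu B).
Proof.
by move=> mB; rewrite /Rintegral integral_indic// setIT.
Qed.

End finitely_supported_integrands.

Section real_continuous.
Variables (R : realType) (T : topologicalType).
Implicit Types f g : T -> R.

Lemma cont_add f g : continuous f -> continuous g -> continuous (fun x => f x + g x).
Proof. by move=> cf cg x; apply: cvgD; [exact: cf|exact: cg]. Qed.

Lemma cont_mul f g : continuous f -> continuous g -> continuous (fun x => f x * g x).
Proof. by move=> cf cg x; apply: cvgM; [exact: cf|exact: cg]. Qed.

Lemma cont_max f g : continuous f -> continuous g ->
  continuous (fun x => Num.max (f x) (g x)).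
Proof. by move=> cf cg x; apply: continuous_max; [exact: cf|exact: cg]. Qed.

Lemma cont_min f g : continuous f -> continuous g ->
  continuous (fun x => Num.min (f x) (g x)).
Proof. by move=> cf cg x; apply: continuous_min; [exact: cf|exact: cg]. Qed.

Lemma cont_norm f : continuous f -> continuous (fun x => `|f x|).
Proof. by move=> cf x; apply: cvg_norm; exact: cf. Qed.

Lemma cont_cst (c : R) : continuous ((fun=> c) : T -> R).
Proof. by move=> x; exact: cvg_cst. Qed.

Lemma cont_comp f (h : R -> R) : continuous h -> continuous f ->
  continuous (fun x => h (f x)).
Proof. by move=> ch cf x; apply: continuous_comp; [exact: cf|exact: ch]. Qed.

Lemma cont_opp f : continuous f -> continuous (fun x => - f x).
Proof. by move=> cf x; apply: cvgN; exact: cf. Qed.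

Lemma cont_open_gt f a : continuous f -> open [set x | a < f x].
Proof.
move=> /continuousP cf; rewrite (_ : [set _ | _] = f @^-1` [set y | a < y])//.
by apply: cf; exact: open_gt.
Qed.

End real_continuous.

Lemma continuous_expRN (R : realType) : continuous (fun x : R => expR (- x)).
Proof. by apply: (@cont_comp _ _ (@GRing.opp R)); [exact: continuous_expR|exact: opp_continuous]. Qed.

Section CK_operations.
Variable R : realType.
Implicit Types (f g : CKplus R) (B : set (E R)).

Lemma open_measurable_E B : open B -> measurable B.
Proof. exact: sub_sigma_algebra. Qed.

Lemma closed_measurable_E B : closed B -> measurable B.
Proof.
move=> cB; rewrite -(setCK B); apply: measurableC.
by apply: (@open_measurable_E (~` B)); exact: closed_openC.
Qed.

Lemma continuous_measurable_E (f : E R -> R) : continuous f -> measurable_fun setT f.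
Proof.
move=> cf; apply: measurable_gt_fun => a.
by apply: (@open_measurable_E [set e | a < f e]); exact: cont_open_gt cf.
Qed.

Lemma measurable_far (eta : R) : measurable (far eta).
Proof. by apply: closed_measurable_E; exact: closed_far. Qed.

Lemma rcborel_far_set (eta : R) : 0 < eta -> rcborel (far eta).
Proof. by move=> e0; apply: (far_rcborel e0) => //; exact: measurable_far. Qed.

Lemma measurable_CK f : measurable_fun setT f.
Proof. by apply: continuous_measurable_E; exact: CK_continuous. Qed.

Lemma CK_far f : exists2 eta : R, 0 < eta & forall e, f e != 0 -> far eta e.
Proof.
have [eta eta0 h] := compact_sub_far (@CK_compact_support R f).
by exists eta => // e fe; apply/h/subset_closure.
Qed.

Lemma CK_bounded f : exists2 C : R, 0 <= C & forall e, f e <= C.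
Proof.
have [eta eta0 h] := CK_far f.
have cf : {within far eta, continuous f}.
  by apply: continuous_subspaceT; exact: CK_continuous.
have := compact_bounded (continuous_compact cf (compact_far eta0)).
move=> [M [_ /(_ (M + 1))]]; rewrite ltrDl ltr01 => /(_ isT) hM.
exists (Num.max 0 (M + 1)) => [|e]; first by rewrite le_max lexx.
have [/eqP ->|/h fe] := boolP (f e == 0); first by rewrite le_max lexx.
have fM : `|f e| <= M + 1 by apply: hM; exists e.
by rewrite le_max (le_trans (ler_norm _) fM) orbT.
Qed.

Lemma CK_carried f : exists2 eta : R, 0 < eta &
  exists2 C, 0 <= C & carried (far eta) C f.
Proof.
have [eta eta0 h] := CK_far f; have [C C0 fC] := CK_bounded f.
exists eta => //; exists C => //; split; first exact: measurable_CK.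
move=> e; rewrite ger0_norm ?CK_ge0// indicE.
have [->|/h fe] := eqVneq (f e) 0; first by rewrite mulr_ge0.
by rewrite mem_set// mulr1.
Qed.

Lemma far_compact_support (eta : R) (f : E R -> R) : 0 < eta ->
  (forall e, f e != 0 -> far eta e) -> compact (closure [set e | f e != 0]).
Proof.
move=> eta0 h; apply: subclosed_compact (compact_far eta0) _.
  exact: closed_closure.
by rewrite closureE => e; apply; split => //; exact: closed_far.
Qed.

Lemma op_compact_support (op : R -> R -> R) f g : op 0 0 = 0 ->
  compact (closure [set e | op (f e) (g e) != 0]).
Proof.
move=> op0; have [e1 e10 h1] := CK_far f; have [e2 e20 h2] := CK_far g.
apply: (@far_compact_support (Num.min e1 e2)); first by rewrite lt_min e10.
move=> e fg; rewrite /far /= ge_min; have [f0|/h1 ->//] := eqVneq (f e) 0.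
have [g0|/h2] := eqVneq (g e) 0; last by rewrite /far/= => ->; rewrite orbT.
by move: fg; rewrite f0 g0 op0 eqxx.
Qed.

Definition CKadd f g : CKplus R.
Proof.
refine (@MkCKplus R (fun e => f e + g e) _ _ _).
- by move=> e; rewrite addr_ge0// CK_ge0.
- by apply: cont_add; exact: CK_continuous.
- by apply: (op_compact_support (op := +%R)); rewrite addr0.
Defined.

Definition CKmax f g : CKplus R.
Proof.
refine (@MkCKplus R (fun e => Num.max (f e) (g e)) _ _ _).
- by move=> e; rewrite le_max CK_ge0.
- by apply: cont_max; exact: CK_continuous.
- by apply: (op_compact_support (op := Num.max)); rewrite maxxx.
Defined.

Definition CKmul (h : E R -> R) (hc : continuous h) (h0 : forall e, 0 <= h e) f :
  CKplus R.
Proof.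
refine (@MkCKplus R (fun e => h e * f e) _ _ _).
- by move=> e; rewrite mulr_ge0// CK_ge0.
- by apply: cont_mul => //; exact: CK_continuous.
- have [e1 e10 h1] := CK_far f.
  apply: (@far_compact_support e1) => // e; rewrite mulf_eq0 negb_or => /andP[_].
  exact: h1.
Defined.

Let cutoff_fun (eta : R) (e : E R) : R := Num.min 1 (Num.max 0 (2 / eta * `|chart e| - 1)).

Let cutoff_fun_support eta e : 0 < eta -> cutoff_fun eta e != 0 -> far (eta / 2) e.
Proof.
move=> eta0; apply: contraR; rewrite /cutoff_fun /far /= -ltNge => he.
rewrite max_l ?(min_r ler01)// subr_le0.
by rewrite mulrAC ler_pdivrMr// mul1r; lra.
Qed.

Definition cutoff (eta : R) (eta0 : 0 < eta) : CKplus R.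
Proof.
refine (@MkCKplus R (cutoff_fun eta) _ _ _).
- by move=> e; rewrite le_min ler01 le_max lexx.
- apply: cont_min; first exact: cont_cst.
  apply: cont_max; first exact: cont_cst.
  apply: cont_add; last exact: cont_cst.
  apply: cont_mul; first exact: cont_cst.
  by apply: cont_norm; exact: chart_cont.
- apply: (@far_compact_support (eta / 2)); first by rewrite divr_gt0.
  by move=> e; exact: cutoff_fun_support.
Defined.

Lemma cutoff_far eta (eta0 : 0 < eta) e : far eta e -> cutoff eta0 e = 1.
Proof.
rewrite /far /= => he; rewrite /cutoff_fun min_l// le_max; apply/orP; right.
rewrite lerBrDr mulrAC ler_pdivlMr//; lra.
Qed.

Lemma cutoff_le1 eta (eta0 : 0 < eta) e : cutoff eta0 e <= 1.
Proof. by rewrite /= ge_min lexx. Qed.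

Lemma cutoff_far2 eta (eta0 : 0 < eta) e : cutoff eta0 e != 0 -> far (eta / 2) e.
Proof. exact: cutoff_fun_support. Qed.

Definition CK0 : CKplus R := CKmul (@cont_cst R (E R) 0) (fun=> lexx 0) (cutoff ltr01).

Lemma CK0E e : CK0 e = 0. Proof. by rewrite /= mul0r. Qed.

Definition CKscale (c : R) (c0 : 0 <= c) f : CKplus R :=
  CKmul (@cont_cst R (E R) c) (fun=> c0) f.

End CK_operations.

Section Mp_integrals.
Variable R : realType.
Implicit Types (mu nu : Mp R) (f g : CKplus R).

Lemma Mp_fin mu B : rcborel B -> (mu B < +oo)%E.
Proof. by move=> /(Mp_nat mu)[k ->]; rewrite ltry. Qed.

Lemma Mp_far_fin mu (eta : R) : 0 < eta -> (mu (far eta) < +oo)%E.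
Proof. by move=> eta0; apply/Mp_fin/rcborel_far_set. Qed.

Lemma CK_integrable mu f : mu.-integrable setT (EFin \o f).
Proof.
have [eta eta0 [C C0 cf]] := CK_carried f.
by apply: (carried_integrable _ _ cf); [exact: measurable_far|exact: Mp_far_fin].
Qed.

Lemma Mp_int_ge0 mu f : 0 <= Mp_int mu f.
Proof. by apply: Rintegral_ge0 => e _; exact: CK_ge0. Qed.

Lemma Mp_int_add mu f g : Mp_int mu (CKadd f g) = Mp_int mu f + Mp_int mu g.
Proof. by rewrite /Mp_int RintegralD//; exact: CK_integrable. Qed.

Lemma Mp_int_le mu f g : (forall e, f e <= g e) -> Mp_int mu f <= Mp_int mu g.
Proof. by move=> fg; apply: le_Rintegral => //; exact: CK_integrable. Qed.

Lemma Mp_int_CK0 mu : Mp_int mu (CK0 R) = 0.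
Proof.
rewrite /Mp_int (@eq_Rintegral _ _ _ mu _ (fun=> 0)); last by move=> e _; rewrite CK0E.
by rewrite Rintegral_cst// mul0r.
Qed.

Lemma Mp_int_EFin mu f : (Mp_int mu f)%:E = (\int[mu]_e (f e)%:E)%E.
Proof. by rewrite fineK//; apply: integrable_fin_num => //; exact: CK_integrable. Qed.

Lemma Mp_int_zero f : Mp_int (0 : Mp R) f = 0.
Proof. by rewrite /Mp_int /Rintegral integral_measure_zero. Qed.

Lemma Mp_int_plus mu nu f : Mp_int (mu + nu) f = Mp_int mu f + Mp_int nu f.
Proof.
apply: EFin_inj; rewrite EFinD !Mp_int_EFin -integral_measure_add//;
  exact: CK_integrable.
Qed.

Lemma Mp_int_sum I (r : seq I) (F : I -> Mp R) f :
  Mp_int (\sum_(i <- r) F i) f = \sum_(i <- r) Mp_int (F i) f.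
Proof.
elim: r => [|i r ih]; first by rewrite !big_nil Mp_int_zero.
by rewrite !big_cons Mp_int_plus ih.
Qed.

Lemma Mp_diracE (e : E R) B : measurable B -> Mp_dirac e B = (e \in B)%:R%:E.
Proof. by move=> mB; rewrite /Mp_dirac /= borel_partE// diracE. Qed.

Lemma Mp_int_dirac (e : E R) f : Mp_int (Mp_dirac e) f = f e.
Proof.
apply: EFin_inj; rewrite Mp_int_EFin.
rewrite (eq_measure_integral (\d_e)); last by move=> A mA _; rewrite /= borel_partE.
rewrite integral_dirac//; last by apply/measurable_EFinP; exact: measurable_CK.
by rewrite diracT mul1e.
Qed.

Lemma Mp_plusE mu nu B : (mu + nu) B = (mu B + nu B)%E.
Proof. exact: Mp_addE. Qed.

Lemma Mp_sumE I (r : seq I) (F : I -> Mp R) B :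
  (\sum_(i <- r) F i) B = (\sum_(i <- r) F i B)%E.
Proof.
elim: r => [|i r ih]; first by rewrite !big_nil.
by rewrite !big_cons Mp_plusE ih.
Qed.

Lemma Mp_far_cvg (eta : R) (eta0 : 0 < eta) mu C (f_ : nat -> E R -> R) (f : E R -> R) :
  (forall n, carried (far eta) C (f_ n)) ->
  (forall e, f_ n e @[n --> \oo] --> f e) ->
  \int[mu]_e f_ n e @[n --> \oo] --> \int[mu]_e f e.
Proof.
by apply: carried_cvg; [exact: measurable_far|exact: Mp_far_fin].
Qed.

End Mp_integrals.

(** * Lower semicontinuous functions as countable suprema *)

Section countable_suprema.
Variables (R : realType) (T : Type) (I : countType) (b : I -> T -> R).
Hypotheses (b_le1 : forall i x, b i x <= 1).
Implicit Types (j : rat * I) (s : seq (rat * I)) (g : T -> R).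

(** The absolute value turns every rational into an admissible nonnegative coefficient, so the
    indices form the countable type [rat * I]. *)
Definition scaled j x : R := `|ratr j.1| * b j.2 x.

Fixpoint supseq s x : R :=
  if s is j :: s' then Num.max (scaled j x) (supseq s' x) else 0.

(** Decodes the integers below [k] and keeps the scaled functions lying below [g] everywhere; the
    maximum over this list is nondecreasing in [k]. *)
Definition minorants g (k : nat) : seq (rat * I) :=
  [seq j <- pmap unpickle (iota 0 k) | `[< forall x, scaled j x <= g x >]].

Lemma supseq_ge0 s x : 0 <= supseq s x.
Proof. by elim: s => //= j s ih; rewrite le_max ih orbT. Qed.

Let supseq_ub s j x : j \in s -> scaled j x <= supseq s x.
Proof.
elim: s => // k s ih; rewrite inE => /predU1P[->|/ih h] /=; rewrite le_max ?lexx//.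
by rewrite h orbT.
Qed.

Let mem_minorants g k j : (pickle j < k)%N -> (forall x, scaled j x <= g x) ->
  j \in minorants g k.
Proof.
move=> jk h; rewrite mem_filter; apply/andP; split; first exact/asboolP.
rewrite mem_pmap; apply/mapP; exists (pickle j); last by rewrite pickleK.
by rewrite mem_iota.
Qed.

Lemma supseq_minorants_le g k x : (forall x, 0 <= g x) -> supseq (minorants g k) x <= g x.
Proof.
move=> g0; have : {in minorants g k, forall j, scaled j x <= g x}.
  by move=> j; rewrite mem_filter => /andP[/asboolP + _]; exact.
elim: (minorants g k) => [//|j s ih] h; rewrite /= ge_max h ?mem_head//=.
by apply: ih => i si; apply: h; rewrite inE si orbT.
Qed.

(** For a positive rational [q] just below [g x], take [b i] equal to 1 at [x] and vanishing off the
    set where [g > q]: then [q * b i] stays below [g] and equals [q] at [x]. The last hypothesis is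
    lower semicontinuity expressed through the family [b]; the lemma is applied on [E] with bumps
    and on [Mp R] with [testprod]. *)
Lemma supseq_minorants_cvg g x : (forall x, 0 <= g x) ->
  (forall q : rat, ratr q < g x ->
    exists2 i, b i x = 1 & forall y, b i y != 0 -> ratr q < g y) ->
  supseq (minorants g k) x @[k --> \oo] --> g x.
Proof.
move=> g0 hb; apply/cvgrPdist_lt => eps eps0.
have [ge0|gepos] := eqVneq (g x) 0.
  near=> k; rewrite ge0 sub0r normrN ger0_norm ?supseq_ge0//.
  by rewrite (le_lt_trans (supseq_minorants_le k x g0))// ge0.
have {}gepos : 0 < g x by rewrite lt_neqAle eq_sym gepos g0.
have /rat_in_itvoo[q] : Num.max 0 (g x - eps) < g x.
  by rewrite gt_max gepos/= ltrBlDr ltrDl.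
rewrite in_itv/= gt_max => /andP[/andP[q0 qe] qg].
have [i ix hi] := hb q qg.
have jg y : scaled (q, i) y <= g y.
  rewrite /scaled/= gtr0_norm//.
  have [->|/hi /= /ltW] := eqVneq (b i y) 0; first by rewrite mulr0.
  by apply: le_trans; rewrite ler_piMr// ltW.
exists (pickle (q, i)).+1 => // k /= hk.
have : ratr q <= supseq (minorants g k) x.
  apply: le_trans (supseq_ub x (mem_minorants hk jg)).
  by rewrite /scaled/= ix mulr1 ler_norm.
have := supseq_minorants_le k x g0.
by move=> h1 h2; rewrite ger0_norm ?subr_ge0//; lra.
Unshelve. all: by end_near. Qed.

End countable_suprema.

Section bumps.
Variable R : realType.
Implicit Types (U F : set (E R)) (i : rat * nat) (j : rat * (rat * nat)).

(** A tent in the chart around the rational [i.1]: it equals 1 within distance [1 / i.2] and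
    vanishes beyond [2 / i.2]. *)
Definition bump_fun i (e : E R) : R :=
  Num.min 1 (Num.max 0 (2 - i.2%:R * `|chart e - ratr i.1|)).

Lemma bump_fun_continuous i : continuous (bump_fun i).
Proof.
apply: cont_min; first exact: cont_cst.
apply: cont_max; first exact: cont_cst.
apply: cont_add; first exact: cont_cst.
apply: cont_opp.
apply: cont_mul; first exact: cont_cst.
apply: cont_norm; apply: cont_add; last exact: cont_cst.
exact: chart_cont.
Qed.

Lemma bump_fun_ge0 i e : 0 <= bump_fun i e.
Proof. by rewrite /bump_fun le_min ler01 le_max lexx. Qed.

Lemma bump_fun_le1 i e : bump_fun i e <= 1.
Proof. by rewrite /bump_fun ge_min lexx. Qed.

Lemma bump_fun_neq0 i e : bump_fun i e != 0 -> i.2%:R * `|chart e - ratr i.1| < 2.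
Proof.
apply: contraR; rewrite -leNgt => h; rewrite /bump_fun max_l ?min_r//.
by rewrite subr_le0.
Qed.

(** The hypothesis says that the radius [2 / i.2] of the tent is at most half the distance from its
    centre to 0. *)
Lemma bump_support (i : rat * nat) : (4 <= i.2%:R * `|ratr i.1 : R|) ->
  compact (closure [set e | bump_fun i e != 0]).
Proof.
move=> h.
have p0 : 0 < `|ratr i.1 : R|.
  by rewrite normr_gt0; apply/eqP => p0; move: h; rewrite p0 normr0 mulr0; lra.
apply: (@far_compact_support _ (`|ratr i.1 : R| / 2)); first by rewrite divr_gt0.
move=> e /bump_fun_neq0 h2; rewrite /far /=.
have : `|ratr i.1 : R| <= `|chart e| + `|chart e - ratr i.1|.
  by rewrite -[X in `|X| <= _](subKr (chart e)) ler_normB.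
have m0 : (0 : R) <= i.2%:R by [].
move: (`|chart e|) (`|chart e - ratr i.1|) (`|ratr i.1|) (i.2%:R) h h2 m0 p0 => a b p m.
move=> h h2 m0 p0 pab.
have mp : 0 < m by rewrite lt_neqAle m0 andbT; apply/eqP => m1; move: h; rewrite -m1; lra.
rewrite -(ler_pM2l mp); nra.
Qed.

(** Indices whose tent comes too close to 0 give the zero function, which keeps the family indexed
    by all of [rat * nat]. *)
Definition bump i : CKplus R :=
  match pselect (4 <= i.2%:R * `|ratr i.1 : R|) with
  | left h => MkCKplus (bump_fun_ge0 i) (bump_fun_continuous (i := i)) (bump_support h)
  | right _ => CK0 R
  end.

Lemma bump_le1 i e : bump i e <= 1.
Proof.
by rewrite /bump; case: pselect => h; [exact: bump_fun_le1|rewrite CK0E].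
Qed.

Lemma bumpE i e : 4 <= i.2%:R * `|ratr i.1 : R| -> bump i e = bump_fun i e.
Proof. by rewrite /bump; case: pselect. Qed.

Lemma exists_bump U e : open U -> U e ->
  exists2 i, bump i e = 1 & forall y, bump i y != 0 -> U y.
Proof.
move=> /open_chartP oU /oU[eps eps0 hU].
have c0 : 0 < `|chart e| by rewrite normr_gt0 chart_neq0.
(* With [a] the inverse of the slope and the centre within [a] of [chart e], the support stays
   within [3 * a] of [chart e] and the modulus of the centre exceeds [7 * a]. So [8 * a < eps] and
   [8 * a < |chart e|] suffice, the admissibility of the tent requiring only [4 * a]. *)
have : 0 < Num.min eps `|chart e| / 8 by rewrite divr_gt0// lt_min eps0.
move=> /ltr_add_invr[k]; rewrite add0r => hk.
have [a aE] : exists a : R, a = k.+1%:R^-1 by exists k.+1%:R^-1.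
have m0 : 0 < a by rewrite aE invr_gt0.
have am : a^-1 = k.+1%:R by rewrite aE invrK.
rewrite -aE in hk.
have /rat_in_itvoo[p] : chart e - a < chart e + a by lra.
rewrite in_itv/= => /andP[p1 p2].
have ep : `|chart e - ratr p| < a by rewrite ltr_norml; apply/andP; split; lra.
have {}hk : a * 8 < Num.min eps `|chart e| by rewrite -ltr_pdivlMr.
move: hk; rewrite lt_min => /andP[hk1 hk2].
have pn : `|chart e| <= `|ratr p| + `|chart e - ratr p|.
  by rewrite -[X in `|X| <= _](subrK (ratr p)) addrC ler_normD.
have h4 : 4 <= k.+1%:R * `|ratr p : R|.
  rewrite -am mulrC -ler_pdivrMr ?invr_gt0// invrK; lra.
exists (p, k.+1); first rewrite bumpE//.
  rewrite /bump_fun/= min_l// le_max; apply/orP; right.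
  rewrite lerBrDr -lerBrDl (_ : 2 - 1 = 1 :> R); last by lra.
  by rewrite -am mulrC -ler_pdivlMr ?invr_gt0// invrK mul1r ltW.
move=> y; rewrite bumpE// => /bump_fun_neq0 /=.
rewrite -am mulrC -ltr_pdivlMr ?invr_gt0// invrK => hy; apply: hU.
apply: le_lt_trans (_ : `|chart e - ratr p| + `|chart y - ratr p| < _).
  rewrite (distrC (chart y)) (le_trans _ (ler_normD _ _))// .
  by rewrite addrA subrK.
lra.
Qed.

Definition sbump j : CKplus R := CKscale (normr_ge0 (ratr j.1 : R)) (bump j.2).

(** The lists range over a countable type, so these functions form a countable subset of C_K^+ that
    approximates every element of C_K^+ from below. *)
Fixpoint CKsup (s : seq (rat * (rat * nat))) : CKplus R :=
  if s is j :: s' then CKmax (sbump j) (CKsup s') else CK0 R.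

Definition approx (g : E R -> R) k := CKsup (minorants bump g k).

Let approxE g k : approx g k = supseq bump (minorants bump g k) :> (E R -> R).
Proof.
apply/funext => e; rewrite /approx.
by elim: (minorants _ _ _) => [|j s /= ->]; rewrite ?CK0E.
Qed.

Lemma approx_le g k e : (forall e, 0 <= g e) -> approx g k e <= g e.
Proof. by rewrite approxE; exact: supseq_minorants_le. Qed.

Lemma approx_cvg g e : (forall e, 0 <= g e) -> (forall a, open [set e | a < g e]) ->
  approx g k e @[k --> \oo] --> g e.
Proof.
move=> g0 og; under eq_fun do rewrite approxE.
apply: (@supseq_minorants_cvg R (E R) _ (fun i => bump i : E R -> R) bump_le1 g e g0) => q qg.
exact: (exists_bump (og _) qg).
Qed.

Lemma open_indic_gt U a : open U -> open [set e | a < \1_U e :> R].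
Proof.
move=> oU; have [a0|a0] := ltP a 0.
  rewrite (_ : [set _ | _] = setT); first exact: openT.
  by apply/seteqP; split=> // e _ /=; rewrite (lt_le_trans a0).
have [a1|a1] := ltP a 1.
  rewrite (_ : [set _ | _] = U)//; apply/seteqP; split=> e /=; rewrite indicE.
    by have [/set_mem|] := boolP (e \in U) => //; rewrite ltNge a0.
  by move=> Ue; rewrite mem_set.
rewrite (_ : [set _ | _] = set0); first exact: open0.
apply/seteqP; split=> // e /=; rewrite indicE.
by case: (e \in U) => /=; rewrite ltNge ?a1 ?a0.
Qed.

Definition inner U k : CKplus R := approx \1_U k.

Lemma inner_le U k e : inner U k e <= \1_U e.
Proof. by apply: approx_le => y; rewrite indicE. Qed.

Lemma inner_cvg U e : open U -> inner U k e @[k --> \oo] --> (\1_U e : R).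
Proof.
move=> oU; apply: approx_cvg => [y|a]; first by rewrite indicE.
exact: open_indic_gt.
Qed.

Lemma outer_subproof1 F k : continuous (fun e : E R => 1 - inner (~` F) k e).
Proof.
apply: cont_add; first exact: cont_cst.
apply: cont_opp.
exact: CK_continuous.
Qed.

Lemma outer_subproof2 F k (e : E R) : 0 <= 1 - inner (~` F) k e.
Proof.
by rewrite subr_ge0 (le_trans (inner_le _ _ _))// indicE; case: (_ \in _).
Qed.

(** One minus the inner approximation of the complement has no compact support; the cutoff restores
    it without changing the values on [far eta], where [F] lies. *)
Definition outer (eta : R) (eta0 : 0 < eta) F k : CKplus R :=
  CKmul (outer_subproof1 (F := F) (k := k)) (outer_subproof2 F k) (cutoff eta0).

Lemma outer_ge eta (eta0 : 0 < eta) F k e : F `<=` far eta ->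
  \1_F e <= outer eta0 F k e.
Proof.
move=> Ff; rewrite indicE; have [/set_mem Fe|] := boolP (e \in F); last by rewrite CK_ge0.
have -> : outer eta0 F k e = (1 - inner (~` F) k e) * cutoff eta0 e by [].
rewrite cutoff_far ?mulr1; last exact: Ff.
rewrite lerBrDl -lerBrDr subrr (le_trans (inner_le _ _ _))// indicE memNset//.
Qed.

Lemma outer_le eta (eta0 : 0 < eta) F k e : outer eta0 F k e <= cutoff eta0 e.
Proof.
have -> : outer eta0 F k e = (1 - inner (~` F) k e) * cutoff eta0 e by [].
by rewrite ler_piMl ?CK_ge0// gerBl CK_ge0.
Qed.

Lemma outer_cvg eta (eta0 : 0 < eta) F e : closed F -> F `<=` far eta ->
  outer eta0 F k e @[k --> \oo] --> (\1_F e : R).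
Proof.
move=> cF Ff.
have -> : \1_F e = (1 - \1_(~` F) e) * cutoff eta0 e :> R.
  rewrite !indicE in_setC; have [/set_mem Fe|] := boolP (e \in F).
    by rewrite subr0 mul1r cutoff_far//; exact: Ff.
  by rewrite subrr mul0r.
apply: cvgM; last exact: cvg_cst.
apply: cvgB; first exact: cvg_cst.
by apply: inner_cvg; exact: closed_openC.
Qed.

End bumps.

(** * The space of point measures *)

Section Mp_evaluation.
Variable R : realType.
Implicit Types (mu nu : Mp R) (f g : CKplus R) (B : set (E R)).

Lemma open_measurable_Mp (A : set (Mp R)) : open A -> measurable A.
Proof. exact: sub_sigma_algebra. Qed.

Lemma continuous_measurable_Mp (F : Mp R -> R) : continuous F -> measurable_fun setT F.
Proof.
move=> cF; apply: measurable_gt_fun => a.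
by apply: (@open_measurable_Mp [set e | a < F e]); exact: cont_open_gt cF.
Qed.

Lemma Mp_int_continuous f : continuous (fun mu : Mp R => Mp_int mu f).
Proof.
move=> mu; apply: (@continuous_comp _ _ _
  (Mp_int (R := R) : Mp R -> prod_topology (fun _ : CKplus R => R)) (fun h => h f)).
  exact: initial_continuous.
exact: (@proj_continuous _ (fun _ : CKplus R => R) f).
Qed.

Lemma measurable_Mp_int f : measurable_fun setT (fun mu : Mp R => Mp_int mu f).
Proof. by apply: continuous_measurable_Mp; exact: Mp_int_continuous. Qed.

Definition mass mu B : R := fine (mu B).

Lemma mass_EFin mu B : rcborel B -> (mass mu B)%:E = mu B.
Proof. by move=> /(Mp_nat mu)[k Bk]; rewrite /mass Bk. Qed.

Lemma mass_nat mu B : rcborel B -> exists k : nat, mass mu B = k%:R.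
Proof. by move=> /(Mp_nat mu)[k Bk]; exists k; rewrite /mass Bk. Qed.

Lemma mass_Rintegral mu B : measurable B -> mass mu B = \int[mu]_e \1_B e.
Proof. by move=> mB; rewrite Rintegral_indic. Qed.

Lemma inner_carried U (eta : R) k : U `<=` far eta -> carried (far eta) 1 (inner U k).
Proof.
move=> Uf; split=> [|e]; first exact: measurable_CK.
rewrite ger0_norm ?CK_ge0// mul1r (le_trans (inner_le _ _ _))// !indicE.
by rewrite ler_nat; case: (boolP (e \in U)) => // /set_mem /Uf fe; rewrite mem_set.
Qed.

Lemma outer_carried F (eta : R) (eta0 : 0 < eta) k :
  carried (far (eta / 2)) 1 (outer eta0 F k).
Proof.
split=> [|e]; first exact: measurable_CK.
rewrite ger0_norm ?CK_ge0// mul1r (le_trans (outer_le _ _ _ _))// indicE.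
have [->//|/cutoff_far2 fe] := eqVneq (cutoff eta0 e) 0.
by rewrite mem_set// cutoff_le1.
Qed.

Lemma Mp_int_inner_cvg mu U (eta : R) : 0 < eta -> open U -> U `<=` far eta ->
  Mp_int mu (inner U k) @[k --> \oo] --> mass mu U.
Proof.
move=> eta0 oU Uf; rewrite mass_Rintegral; last exact: open_measurable_E.
have h1 k := inner_carried k Uf.
have h2 (e : E R) : inner U k e @[k --> \oo] --> (\1_U e : R) by exact: inner_cvg.
have h3 := Mp_far_cvg eta0 (mu := mu) (f := \1_U) h1 h2.
exact: h3.
Qed.

Lemma Mp_int_outer_cvg mu F (eta : R) (eta0 : 0 < eta) : closed F -> F `<=` far eta ->
  Mp_int mu (outer eta0 F k) @[k --> \oo] --> mass mu F.
Proof.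
move=> cF Ff; rewrite mass_Rintegral; last exact: closed_measurable_E.
have eta20 : 0 < eta / 2 by rewrite divr_gt0.
have h1 k := outer_carried F eta0 k.
have h2 (e : E R) : outer eta0 F k e @[k --> \oo] --> (\1_F e : R).
  exact: outer_cvg.
exact: (Mp_far_cvg eta20 (mu := mu) (f := \1_F) h1 h2).
Qed.

Let ofar (eta : R) : set (E R) := [set e | eta < `|chart e|].

Let open_ofar eta : open (ofar eta).
Proof.
apply: (@cont_open_gt _ _ (fun e => `|chart e|)); apply: cont_norm; exact: chart_cont.
Qed.

Let ofar_far eta : ofar eta `<=` far eta.
Proof. by move=> e /ltW. Qed.

Let rc_ofar eta B : 0 < eta -> measurable B -> rcborel (B `&` ofar eta).
Proof.
move=> eta0 mB; apply: (far_rcborel eta0).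
  by apply: measurableI => //; apply: open_measurable_E; exact: open_ofar.
by move=> e [_ /ofar_far].
Qed.

(** A monotone class argument from the open sets, for which the mass is a limit of the continuous
    functions [Mp_int mu (inner _ k)]. All sets are cut by one relatively compact open set
    containing [B], since the class must contain the whole space and its masses must be finite for
    differences to make sense. *)
Lemma measurable_mass B : rcborel B -> measurable_fun setT (fun mu : Mp R => mass mu B).
Proof.
move=> rB; have [eta eta0 Bf] := rcborel_far rB.
have e20 : 0 < eta / 2 by rewrite divr_gt0.
pose H : set (set (E R)) := [set A | measurable A /\
  measurable_fun setT (fun mu : Mp R => mass mu (A `&` ofar (eta / 2)))].
suff HB : H B.
  case: HB => _; rewrite (_ : B `&` _ = B)//.
  by apply/setIidPl => e /Bf; rewrite /far /ofar /=; lra.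
have [mB _] := rB; move: B mB {rB Bf}.
apply: (@lambda_system_subset _ (@open (E R)) _ setT) => //.
- by move=> A B oA oB; exact: openI.
- split => //.
  + split; first exact: measurableT.
    rewrite setTI; apply: (@measurable_fun_cvg _ _ _ _
      (fun k (mu : Mp R) => Mp_int mu (inner (ofar (eta / 2)) k))) => [k|mu _].
      exact: measurable_Mp_int.
    exact: (@Mp_int_inner_cvg mu (ofar (eta / 2)) _ e20 (open_ofar _) (@ofar_far _)).
  + move=> A C CA [mA hA] [mC hC]; split; first exact: measurableD.
    rewrite (_ : (fun mu => _) = (fun mu : Mp R =>
      mass mu (A `&` ofar (eta / 2)) - mass mu (C `&` ofar (eta / 2)))).
      exact: measurable_funB.
    apply/funext => mu; apply: EFin_inj; rewrite EFinB !mass_EFin; last 3 first.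
    * exact: rc_ofar.
    * exact: rc_ofar.
    * by apply: rc_ofar => //; exact: measurableD.
    have -> : (A `\` C) `&` ofar (eta / 2) =
        (A `&` ofar (eta / 2)) `\` (C `&` ofar (eta / 2)).
      apply/seteqP; split => e /=; first by move=> [[Ae nC] ?]; split => // -[].
      by move=> [[Ae oe] h]; split => //; split => // Ce; apply: h.
    have [mAo _] := rc_ofar e20 mA; have [mCo _] := rc_ofar e20 mC.
    rewrite measureD//; last by apply: Mp_fin; exact: rc_ofar.
    by rewrite (setIidr (_ : C `&` _ `<=` A `&` _))//; exact: setSI.
  + move=> F ndF HF; split.
      by apply: bigcup_measurable => k _; have [] := HF k.
    have mF k : measurable (F k `&` ofar (eta / 2)).
      by have [] := rc_ofar e20 (HF k).1.
    apply: (@measurable_fun_cvg _ _ _ _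
      (fun k (mu : Mp R) => mass mu (F k `&` ofar (eta / 2)))) => [k|mu _].
      by have [] := HF k.
    apply: fine_cvg; rewrite mass_EFin; last first.
      by apply: rc_ofar => //; apply: bigcup_measurable => k _; have [] := HF k.
    rewrite setI_bigcupl; apply: nondecreasing_cvg_mu => //.
      by apply: bigcup_measurable => k _.
    by move=> k l kl; apply/subsetPset; apply: setSI; exact/subsetPset/ndF.
- move=> A oA; split; first exact: open_measurable_E.
  apply: (@measurable_fun_cvg _ _ _ _
    (fun k (mu : Mp R) => Mp_int mu (inner (A `&` ofar (eta / 2)) k))) => [k|mu _].
    exact: measurable_Mp_int.
  have oAo : open (A `&` ofar (eta / 2)) by apply: openI => //; exact: open_ofar.
  have Af : A `&` ofar (eta / 2) `<=` far (eta / 2) by move=> e [_ /ofar_far].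
  exact: (@Mp_int_inner_cvg mu _ _ e20 oAo Af).
Qed.

End Mp_evaluation.

(** * Laplace functionals and convergence in distribution *)

Lemma cvg_approx (R : realType) (u : nat -> R) (l : R) :
  (forall eps : R, 0 < eps -> exists v : nat -> R, exists2 m : R, v n @[n --> \oo] --> m &
     (\forall n \near \oo, `|u n - v n| <= eps) /\ `|l - m| <= eps) ->
  u n @[n --> \oo] --> l.
Proof.
move=> h; apply/cvgrPdist_lt => eps eps0.
have e0 : 0 < eps / 4 by rewrite divr_gt0.
have [v [m vm [uv lm]]] := h _ e0.
move/cvgrPdist_lt in vm; have {}vm := vm _ e0.
near=> n.
have h1 : `|u n - v n| <= eps / 4 by near: n.
have h2 : `|m - v n| < eps / 4 by near: n.
have -> : l - u n = (l - m) + (m - v n) - (u n - v n) by lra.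
apply: le_lt_trans (ler_normB _ _) _; apply: le_lt_trans (lerD (ler_normD _ _) (lexx _)) _.
lra.
Unshelve. all: by end_near. Qed.

Section absolute_value_polynomials.
Variable R : realFieldType.

(** The classical iteration whose polynomials in [t] increase to the absolute value of [t] on
    [-1, 1]. *)
Fixpoint absapp (n : nat) (t : R) : R :=
  if n is m.+1 then absapp m t + (t ^+ 2 - absapp m t ^+ 2) / 2 else 0.

(** The error [d = a - p] becomes [d * (1 - (a + p) / 2)], at most [d - d^2 / 2] because
    [a + p >= d]. This bound increases with [d] on [0, 1], and at [d = 2 / b] it equals
    [2 * (b - 1) / b^2], which is at most [2 / (b + 1)]. *)
Let sqrt_step (a p b : R) : 0 <= p -> p <= a -> a <= 1 -> 2 <= b -> a - p <= 2 / b ->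
  [/\ 0 <= p + (a ^+ 2 - p ^+ 2) / 2, p + (a ^+ 2 - p ^+ 2) / 2 <= a &
      a - (p + (a ^+ 2 - p ^+ 2) / 2) <= 2 / (b + 1)].
Proof.
move=> p0 pa a1 b2 pb; split; [nra|nra|].
have b0 : 0 < b by lra.
have b10 : 0 < b + 1 by lra.
move: pb; set y := 2 / b => pb; have yb : y * b = 2 by rewrite /y mulfVK// gt_eqF.
rewrite ler_pdivlMr//.
have y0 : 0 < y by rewrite /y divr_gt0.
have h1 : a - (p + (a ^+ 2 - p ^+ 2) / 2) <= (a - p) - (a - p) ^+ 2 / 2 by nra.
have y1 : y <= 1 by nra.
have h2 : (a - p) - (a - p) ^+ 2 / 2 <= y - y ^+ 2 / 2 by nra.
have h3 : (y - y ^+ 2 / 2) * (b + 1) <= 2 by nra.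
by apply: le_trans h3; rewrite ler_pM2r//; lra.
Qed.

Lemma absapp_bound n (t : R) : `|t| <= 1 ->
  [/\ 0 <= absapp n t, absapp n t <= `|t| & `|t| - absapp n t <= 2 / n.+2%:R].
Proof.
move=> t1; elim: n => [|n [p0 pt pn]] /=.
  by split => //; rewrite subr0 divff.
rewrite -real_normK ?num_real// -[n.+3%:R]natr1.
by apply: sqrt_step => //; rewrite ler_nat.
Qed.

End absolute_value_polynomials.

Section laplace_closure.
Variable R : realType.
Implicit Types (mu : Mp R) (f g : CKplus R) (F G : Mp R -> R).

Definition vf f mu : R := expR (- Mp_int mu f).

Lemma vf_add f g mu : vf (CKadd f g) mu = vf f mu * vf g mu.
Proof. by rewrite /vf Mp_int_add opprD expRD. Qed.

Lemma vf0 mu : vf (CK0 R) mu = 1.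
Proof. by rewrite /vf Mp_int_CK0 oppr0 expR0. Qed.

Lemma vf_ge0 f mu : 0 <= vf f mu. Proof. exact: expR_ge0. Qed.

Lemma vf_le1 f mu : vf f mu <= 1.
Proof. by rewrite /vf -expR0 ler_expR oppr_le0 Mp_int_ge0. Qed.

Lemma norm_vf_le1 f mu : `|vf f mu| <= 1.
Proof. by rewrite ger0_norm ?vf_ge0// vf_le1. Qed.

Lemma measurable_vf f : measurable_fun setT (vf f).
Proof.
apply: measurableT_comp; first exact: measurable_expR.
apply: measurable_funN; exact: measurable_Mp_int.
Qed.

Definition expsum (s : seq (R * CKplus R)) mu := \sum_(x <- s) x.1 * vf x.2 mu.

(* As [vf f * vf g = vf (f + g)], this is a uniformly closed algebra. *)
Definition expcl F := forall eps : R, 0 < eps ->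
  exists s, forall mu, `|F mu - expsum s mu| <= eps.

Lemma expcl_expsum s : expcl (expsum s).
Proof. by move=> eps eps0; exists s => mu; rewrite subrr normr0 ltW. Qed.

Lemma expsum_cat s t mu : expsum (s ++ t) mu = expsum s mu + expsum t mu.
Proof. by rewrite /expsum big_cat. Qed.

Lemma expsum_mul s t mu :
  expsum [seq (x.1 * y.1, CKadd x.2 y.2) | x <- s, y <- t] mu = expsum s mu * expsum t mu.
Proof.
rewrite /expsum big_allpairs_dep/= mulr_suml; apply: eq_bigr => x _.
by rewrite mulr_sumr; apply: eq_bigr => y _ /=; rewrite vf_add mulrACA.
Qed.

Lemma expcl_uniform F : (forall eps, 0 < eps ->
  exists2 G, expcl G & forall mu, `|F mu - G mu| <= eps) -> expcl F.
Proof.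
move=> h eps eps0; have e0 : 0 < eps / 2 by rewrite divr_gt0.
have [G /(_ _ e0)[s sG] FG] := h _ e0; exists s => mu.
have -> : F mu - expsum s mu = (F mu - G mu) + (G mu - expsum s mu) by lra.
rewrite (le_trans (ler_normD _ _))// (le_trans (lerD (FG mu) (sG mu)))//; lra.
Qed.

Lemma expcl_ext F G : F =1 G -> expcl F -> expcl G.
Proof. by move=> /funext ->. Qed.

Lemma expcl_vf f : expcl (vf f).
Proof.
apply: (@expcl_ext (expsum [:: (1, f)])); last exact: expcl_expsum.
by move=> mu; rewrite /expsum big_seq1 mul1r.
Qed.

Lemma expcl_cst c : expcl (fun=> c).
Proof.
apply: (@expcl_ext (expsum [:: (c, CK0 R)])); last exact: expcl_expsum.
by move=> mu; rewrite /expsum big_seq1 vf0 mulr1.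
Qed.

Lemma expcl_add F G : expcl F -> expcl G -> expcl (fun mu => F mu + G mu).
Proof.
move=> hF hG eps eps0; have e0 : 0 < eps / 2 by rewrite divr_gt0.
have [s sF] := hF _ e0; have [t tG] := hG _ e0; exists (s ++ t) => mu.
rewrite expsum_cat.
have -> : F mu + G mu - (expsum s mu + expsum t mu) =
  (F mu - expsum s mu) + (G mu - expsum t mu) by lra.
rewrite (le_trans (ler_normD _ _))// (le_trans (lerD (sF mu) (tG mu)))//; lra.
Qed.

Lemma expsum_bounded s : exists2 C, 0 < C & forall mu, `|expsum s mu| <= C.
Proof.
exists (1 + \sum_(x <- s) `|x.1|).
  by rewrite ltr_pwDl// sumr_ge0.
move=> mu; rewrite (le_trans (ler_norm_sum _ _ _))// -[leLHS]add0r lerD//.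
apply: ler_sum => x _; rewrite normrM ler_piMr//.
exact: norm_vf_le1.
Qed.

Lemma expcl_bounded F : expcl F -> exists2 C, 0 < C & forall mu, `|F mu| <= C.
Proof.
move=> /(_ _ ltr01)[s sF]; have [C C0 sC] := expsum_bounded s.
exists (1 + C) => [|mu]; first by rewrite addr_gt0.
have -> : F mu = (F mu - expsum s mu) + expsum s mu by rewrite subrK.
by rewrite (le_trans (ler_normD _ _))// lerD.
Qed.

Lemma expcl_mul F G : expcl F -> expcl G -> expcl (fun mu => F mu * G mu).
Proof.
move=> hF hG; apply: expcl_uniform => eps eps0.
have [C C0 FC] := expcl_bounded hF.
have e1 : 0 < eps / 2 / C by rewrite !divr_gt0.
(* [t] comes first: its bound [D] determines the accuracy required of [s]. *)
have [t tG] := hG _ e1.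
have [D D0 tD] := expsum_bounded t.
have e2 : 0 < eps / 2 / D by rewrite !divr_gt0.
have [s sF] := hF _ e2.
exists (expsum [seq (x.1 * y.1, CKadd x.2 y.2) | x <- s, y <- t]).
  exact: expcl_expsum.
move=> mu; rewrite expsum_mul.
have -> : F mu * G mu - expsum s mu * expsum t mu =
  F mu * (G mu - expsum t mu) + (F mu - expsum s mu) * expsum t mu by ring.
rewrite (le_trans (ler_normD _ _))// !normrM.
apply: (@le_trans _ _ (C * (eps / 2 / C) + (eps / 2 / D) * D)).
  by apply: lerD; apply: ler_pM.
by rewrite mulrCA divff ?gt_eqF// mulr1 divfK ?gt_eqF//; lra.
Qed.

Lemma expcl_scale c F : expcl F -> expcl (fun mu => c * F mu).
Proof. by move=> hF; apply: expcl_mul => //; exact: expcl_cst. Qed.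

(** The Stone-Weierstrass step. A bounded [F], scaled into [-1, 1], has polynomial images [absapp]
    converging uniformly to its absolute value; the lattice operations follow. *)
Lemma expcl_norm F : expcl F -> expcl (fun mu => `|F mu|).
Proof.
move=> hF; have [C C0 FC] := expcl_bounded hF.
have hn n : expcl (fun mu => absapp n (C^-1 * F mu)).
  elim: n => [|n ih] /=; first exact: expcl_cst.
  apply: expcl_add => //.
  apply: (@expcl_ext (fun mu => 2^-1 * ((C^-1 * F mu) * (C^-1 * F mu) +
     (-1) * (absapp n (C^-1 * F mu) * absapp n (C^-1 * F mu))))).
    by move=> mu; rewrite !expr2 mulN1r mulrC.
  apply/expcl_scale/expcl_add.
    by apply: expcl_mul; exact: expcl_scale.
  by apply/expcl_scale/expcl_mul.
apply: expcl_uniform => eps eps0.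
have /ltr_add_invr[k] : 0 < eps / C / 2 by rewrite !divr_gt0.
rewrite add0r => hk.
exists (fun mu => C * absapp k (C^-1 * F mu)); first exact: expcl_scale.
move=> mu.
have t1 : `|C^-1 * F mu| <= 1.
  by rewrite normrM gtr0_norm ?invr_gt0// ler_pdivrMl// mulr1.
have [p0 pt pk] := absapp_bound k t1.
have -> : `|F mu| = C * `|C^-1 * F mu|.
  by rewrite normrM gtr0_norm ?invr_gt0// mulVKf// gt_eqF.
rewrite -mulrBr normrM gtr0_norm// ger0_norm ?subr_ge0//.
rewrite -ler_pdivlMl// (le_trans pk)//.
apply: (@le_trans _ _ (2 * k.+1%:R^-1)).
  by rewrite ler_pM2l// lef_pV2 ?posrE// ler_nat.
by rewrite mulrC -ler_pdivlMr// ltW// [C^-1 * _]mulrC.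
Qed.

Lemma expcl_max F G : expcl F -> expcl G -> expcl (fun mu => Num.max (F mu) (G mu)).
Proof.
move=> hF hG.
apply: (@expcl_ext (fun mu => 2^-1 * (F mu + G mu + `|F mu + (-1) * G mu|))).
  move=> mu; rewrite mulN1r maxr_absE; lra.
apply/expcl_scale/expcl_add; first exact: expcl_add.
by apply/expcl_norm/expcl_add => //; exact: expcl_scale.
Qed.

Lemma expcl_min F G : expcl F -> expcl G -> expcl (fun mu => Num.min (F mu) (G mu)).
Proof.
move=> hF hG.
apply: (@expcl_ext (fun mu => 2^-1 * (F mu + G mu + (-1) * `|F mu + (-1) * G mu|))).
  move=> mu; rewrite !mulN1r minr_absE; lra.
apply/expcl_scale/expcl_add; first exact: expcl_add.
by apply/expcl_scale/expcl_norm/expcl_add => //; exact: expcl_scale.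
Qed.

Lemma measurable_expsum s : measurable_fun setT (expsum s).
Proof.
rewrite /expsum; elim: s => [|x s ih].
  under eq_fun do rewrite big_nil.
  exact: measurable_cst.
under eq_fun do rewrite big_cons.
by apply: measurable_funD => //; apply: measurable_funM => //; exact: measurable_vf.
Qed.

Lemma measurable_expcl F : expcl F -> measurable_fun setT F.
Proof.
move=> hF.
have /choice[s sF] : forall n : nat, exists s, forall mu, `|F mu - expsum s mu| <= n.+1%:R^-1.
  by move=> n; apply: hF; rewrite invr_gt0.
apply: (@measurable_fun_cvg _ _ _ _ (fun n => expsum (s n))) => [n|mu _].
  exact: measurable_expsum.
apply/cvgrPdist_lt => eps /ltr_add_invr[k]; rewrite add0r => hk.
exists k => // n /= kn; apply: le_lt_trans (sF n mu) (le_lt_trans _ hk).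
by rewrite lef_pV2 ?posrE// ler_nat ltnS.
Qed.

End laplace_closure.

Section weighted_convergence.
Variable R : realType.
Implicit Types (mu : Mp R) (f g : CKplus R) (F G W : Mp R -> R).
Implicit Types (al : {measure set (Mp R) -> \bar R}).

Lemma weighted_integrable al W F : al.-integrable setT (EFin \o W) ->
  expcl F -> al.-integrable setT (EFin \o (fun mu => W mu * F mu)).
Proof.
move=> iW hF; have [C C0 FC] := expcl_bounded hF.
have mW : measurable_fun setT W.
  by apply/measurable_EFinP; exact: measurable_int iW.
apply: (@le_integrable _ _ _ _ _ _ _ (fun mu => C%:E * (EFin \o W) mu)%E) => //.
- by apply/measurable_EFinP; apply: measurable_funM => //; exact: measurable_expcl.
- by move=> mu _ /=; rewrite lee_fin !normrM mulrC ler_pM// (le_trans (FC mu))// ler_norm.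
- exact: integrableZl.
Qed.

Lemma weighted_approx al W F G (c : R) : al.-integrable setT (EFin \o W) ->
  (forall mu, 0 <= W mu) -> expcl F -> expcl G ->
  (forall mu, `|F mu - G mu| <= c) ->
  `|\int[al]_mu (W mu * F mu) - \int[al]_mu (W mu * G mu)| <= c * \int[al]_mu W mu.
Proof.
move=> iW W0 hF hG FG.
have iF := weighted_integrable iW hF; have iG := weighted_integrable iW hG.
have iN := weighted_integrable iW (expcl_norm (expcl_add hF (expcl_scale (-1) hG))).
rewrite -RintegralB//.
apply: le_trans (le_normr_Rintegral _ _) _ => //.
  exact: (integrableB _ iF iG).
rewrite -RintegralZl//; apply: le_Rintegral => //.
- apply: eq_integrable iN => // mu _ /=; congr EFin.
  by rewrite mulN1r -mulrBr normrM (ger0_norm (W0 mu)).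
- exact: (@integrableZl _ _ _ _ _ _ c _ iW).
- by move=> mu _; rewrite -mulrBr normrM (ger0_norm (W0 mu)) mulrC ler_wpM2r.
Qed.

Lemma Rintegral_expsum al W s : al.-integrable setT (EFin \o W) ->
  \int[al]_mu (W mu * expsum s mu) = \sum_(x <- s) x.1 * \int[al]_mu (W mu * vf x.2 mu).
Proof.
move=> iW; elim: s => [|x s ih].
  rewrite big_nil (@eq_Rintegral _ _ _ al _ (fun=> 0)); last first.
    by move=> mu _; rewrite /expsum big_nil mulr0.
  by rewrite Rintegral_cst// mul0r.
have ix := weighted_integrable iW (expcl_vf x.2).
rewrite big_cons -ih -RintegralZl// -RintegralD//.
- by apply: eq_Rintegral => mu _; rewrite /expsum big_cons mulrDr mulrCA.
- exact: (@integrableZl _ _ _ _ _ _ x.1 _ ix).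
- by apply: weighted_integrable => //; exact: expcl_expsum.
Qed.

(** A uniform error in [F] costs that error times the integral of [W], and the case [g = 0] of the
    hypothesis bounds these integrals eventually. It is applied with [W = 1] to probability laws and
    with [W = 1 - vf f] to measures of unbounded total mass. *)
Lemma expcl_weighted_cvg (al_ : nat -> {measure set (Mp R) -> \bar R}) al W :
  (forall n, (al_ n).-integrable setT (EFin \o W)) -> al.-integrable setT (EFin \o W) ->
  (forall mu, 0 <= W mu) ->
  (forall g, \int[al_ n]_mu (W mu * vf g mu) @[n --> \oo] --> \int[al]_mu (W mu * vf g mu)) ->
  forall F, expcl F ->
  \int[al_ n]_mu (W mu * F mu) @[n --> \oo] --> \int[al]_mu (W mu * F mu).
Proof.
move=> iW_ iW W0 hg F hF.
have WE (be : {measure set (Mp R) -> \bar R}) :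
    \int[be]_mu (W mu * vf (CK0 R) mu) = \int[be]_mu W mu.
  by apply: eq_Rintegral => mu _; rewrite vf0 mulr1.
have := hg (CK0 R); rewrite WE; under eq_fun do rewrite WE.
move=> Wcvg.
have I0 : 0 <= \int[al]_mu W mu by apply: Rintegral_ge0.
set I := \int[al]_mu W mu in Wcvg I0.
have I1 : 0 < I + 1 by rewrite ltr_wpDl.
apply: cvg_approx => eps eps0.
have e0 : 0 < eps / (I + 1) by rewrite divr_gt0.
have [s sF] := hF _ e0.
exists (fun n => \int[al_ n]_mu (W mu * expsum s mu)), (\int[al]_mu (W mu * expsum s mu)).
  rewrite Rintegral_expsum//.
  rewrite (_ : (fun n => _) = (fun n => \sum_(x <- s) x.1 * \int[al_ n]_mu (W mu * vf x.2 mu))).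
    elim: s {sF} => [|x s ih].
      by under eq_fun do rewrite big_nil; rewrite big_nil; exact: cvg_cst.
    rewrite big_cons; under eq_fun do rewrite big_cons.
    by apply: cvgD => //; apply: cvgM; [exact: cvg_cst|exact: hg].
  by apply/funext => n; rewrite Rintegral_expsum.
have bnd (be : {measure set (Mp R) -> \bar R}) : be.-integrable setT (EFin \o W) ->
    \int[be]_mu W mu <= I + 1 ->
    `|\int[be]_mu (W mu * F mu) - \int[be]_mu (W mu * expsum s mu)| <= eps.
  move=> ib bI.
  apply: le_trans (weighted_approx ib W0 hF (expcl_expsum s) sF) _.
  by rewrite mulrAC ler_pdivrMr// ler_pM2l.
split; last by apply: bnd => //; rewrite lerDl.
near=> n; apply: bnd => //.
near: n; apply: (cvgr_le I) => //; rewrite ltrDl//.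
Unshelve. all: by end_near. Qed.

End weighted_convergence.

(** * A countable base of the vague topology *)

Section vague_neighbourhoods.
Variable R : realType.
Implicit Types (mu nu : Mp R) (f g : CKplus R) (U : set (Mp R)).

(** The universal property of an initial topology. It is stated for an arbitrary filter in order to
    apply to [test_nbhs], which is to be shown to contain the open neighbourhoods. *)
Lemma vague_filter (FF : set_system (Mp R)) mu : Filter FF ->
  (forall f, Mp_int nu f @[nu --> FF] --> Mp_int mu f) ->
  forall U, open U -> U mu -> FF U.
Proof.
move=> FFF hf U [V oV <-] Vmu.
have : (Mp_int (R := R) : Mp R -> prod_topology (fun _ : CKplus R => R)) @ FF
    --> (Mp_int mu : prod_topology (fun _ : CKplus R => R)).
  apply/cvg_sup => f W.
  have /= -> := @nbhsE (initial_topology (fun h : prod_topology (fun _ : CKplus R => R) => h f)).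
  case=> B [[C oC <-] Cmu] /filterS; apply; apply: hf.
  exact: open_nbhs_nbhs.
by apply; exact: open_nbhs_nbhs.
Qed.

Definition clamp01 (x : R) : R := Num.min 1 (Num.max 0 x).

Lemma clamp01_ge0 x : 0 <= clamp01 x.
Proof. by rewrite /clamp01 le_min ler01 le_max lexx. Qed.

Lemma clamp01_le1 x : clamp01 x <= 1.
Proof. by rewrite /clamp01 ge_min lexx. Qed.

Lemma clamp01_eq1 x : 1 <= x -> clamp01 x = 1.
Proof. by move=> x1; rewrite /clamp01 min_l// le_max x1 orbT. Qed.

Lemma clamp01_eq0 x : x <= 0 -> clamp01 x = 0.
Proof. by move=> x1; rewrite /clamp01 max_l// min_r. Qed.

Lemma clamp01_gt0 x : clamp01 x != 0 -> 0 < x.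
Proof. by apply: contraR; rewrite -leNgt => /clamp01_eq0 ->. Qed.

Lemma expcl_clamp01 (F : Mp R -> R) : expcl F -> expcl (fun mu => clamp01 (F mu)).
Proof.
by move=> hF; apply: expcl_min; [exact: expcl_cst|apply: expcl_max => //; exact: expcl_cst].
Qed.

Fact invS_gt0 (m : nat) : 0 < (m.+1%:R : R)^-1.
Proof. by rewrite invr_gt0. Qed.

(** A countable family in which every element of C_K^+ has a majorant; it provides the upper bounds
    that [CKsup] cannot give. *)
Definition cutoff_mul (jm : nat * nat) : CKplus R :=
  CKscale (ler0n R jm.1) (cutoff (invS_gt0 jm.2)).

Local Notation test_index := ((seq (rat * (rat * nat)) + nat * nat) * rat * nat)%type.

(* A continuous approximation of the indicator of [mu(b) > q] or of [mu(b) < q];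
   the finite minima of these functions generate the vague topology. *)
Definition testfun (t : test_index) mu : R :=
  match t.1.1 with
  | inl l => clamp01 (t.2%:R * (expR (- ratr t.1.2) - vf (CKsup R l) mu))
  | inr jm => clamp01 (t.2%:R * (vf (cutoff_mul jm) mu - expR (- ratr t.1.2)))
  end.

Fixpoint testprod (L : seq test_index) mu : R :=
  if L is t :: L' then Num.min (testfun t mu) (testprod L' mu) else 1.

Lemma testfun_ge0 t mu : 0 <= testfun t mu.
Proof. by rewrite /testfun; case: t.1.1 => ?; exact: clamp01_ge0. Qed.

Lemma testfun_le1 t mu : testfun t mu <= 1.
Proof. by rewrite /testfun; case: t.1.1 => ?; exact: clamp01_le1. Qed.

Lemma expcl_testfun t : expcl (testfun t).
Proof.
rewrite /testfun; case: t.1.1 => b; apply: expcl_clamp01; apply: expcl_scale.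
  apply: (@expcl_ext _ (fun mu => expR (- ratr t.1.2) + (-1) * vf (CKsup R b) mu)).
    by move=> mu; rewrite mulN1r.
  by apply: expcl_add; [exact: expcl_cst|apply: expcl_scale; exact: expcl_vf].
by apply: expcl_add; [exact: expcl_vf|exact: expcl_cst].
Qed.

Lemma testprod_ge0 L mu : 0 <= testprod L mu.
Proof. by elim: L => //= t L ih; rewrite le_min testfun_ge0. Qed.

Lemma testprod_le1 L mu : testprod L mu <= 1.
Proof. by elim: L => //= t L ih; rewrite ge_min testfun_le1. Qed.

Lemma expcl_testprod L : expcl (testprod L).
Proof.
elim: L => [|t L ih] /=; first exact: expcl_cst.
by apply: expcl_min => //; exact: expcl_testfun.
Qed.

Lemma testprod_cat L L' mu :
  testprod (L ++ L') mu = Num.min (testprod L mu) (testprod L' mu).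
Proof.
elim: L => [|t L ih] /=; last by rewrite ih minA.
by rewrite min_r// testprod_le1.
Qed.

(** The candidate neighbourhood filter of [mu]: its basic sets are the supports of functions
    [testprod L], of which there are only countably many. *)
Definition test_nbhs mu : set_system (Mp R) :=
  [set U | exists2 L, testprod L mu = 1 & forall nu, testprod L nu != 0 -> U nu].

Lemma test_nbhs_filter mu : Filter (test_nbhs mu).
Proof.
constructor.
- by exists [::].
- move=> U V [L L1 LU] [L' L'1 LV]; exists (L ++ L').
    by rewrite testprod_cat L1 L'1 minxx.
  move=> nu; rewrite testprod_cat => h; split.
    by apply: LU; apply: contra_neq h => ->; rewrite min_l ?testprod_ge0.
  by apply: LV; apply: contra_neq h => ->; rewrite min_r ?testprod_ge0.
- by move=> U V UV [L L1 LU]; exists L => // nu /LU /UV.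
Qed.

Lemma exists_slope (d : R) : 0 < d -> exists k : nat, 1 <= k%:R * d.
Proof.
move=> /ltr_add_invr[k]; rewrite add0r => hk; exists k.+1.
by rewrite mulrC -ler_pdivrMr// mul1r ltW.
Qed.

Lemma test_nbhs_gt l q mu : ratr q < Mp_int mu (CKsup R l) ->
  test_nbhs mu [set nu | ratr q < Mp_int nu (CKsup R l)].
Proof.
move=> h; have [k hk] : exists k : nat,
    1 <= k%:R * (expR (- ratr q : R) - vf (CKsup R l) mu).
  by apply: exists_slope; rewrite subr_gt0 /vf ltr_expR ltrN2.
exists [:: (inl l, q, k)] => [|nu] /=.
  by rewrite /testfun/= clamp01_eq1// minxx.
rewrite min_l ?testfun_le1// => /clamp01_gt0 /=.
rewrite pmulr_rgt0; first by rewrite subr_gt0 /vf ltr_expR ltrN2.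
rewrite ltr0n lt0n; apply/eqP => k0; move: hk; rewrite k0 mul0r.
by rewrite ler10.
Qed.

Lemma test_nbhs_lt jm q mu : Mp_int mu (cutoff_mul jm) < ratr q ->
  test_nbhs mu [set nu | Mp_int nu (cutoff_mul jm) < ratr q].
Proof.
move=> h; have [k hk] : exists k : nat,
    1 <= k%:R * (vf (cutoff_mul jm) mu - expR (- ratr q : R)).
  by apply: exists_slope; rewrite subr_gt0 /vf ltr_expR ltrN2.
exists [:: (inr jm, q, k)] => [|nu] /=.
  by rewrite /testfun/= clamp01_eq1// minxx.
rewrite min_l ?testfun_le1// => /clamp01_gt0 /=.
rewrite pmulr_rgt0; first by rewrite subr_gt0 /vf ltr_expR ltrN2.
rewrite ltr0n lt0n; apply/eqP => k0; move: hk; rewrite k0 mul0r.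
by rewrite ler10.
Qed.

Lemma Mp_int_approx_cvg mu f : Mp_int mu (approx f k) @[k --> \oo] --> Mp_int mu f.
Proof.
have [eta eta0 [C C0 [mf cf]]] := CK_carried f.
have h1 k : carried (far eta) C (approx f k).
  split; first exact: measurable_CK.
  move=> e; apply: le_trans (cf e); rewrite !ger0_norm ?CK_ge0//.
  by apply: approx_le => y; exact: CK_ge0.
have h2 (e : E R) : approx f k e @[k --> \oo] --> (f e : R).
  apply: approx_cvg => [y|a]; first exact: CK_ge0.
  by apply: cont_open_gt; exact: CK_continuous.
exact: (Mp_far_cvg eta0 (mu := mu) (f := f) h1 h2).
Qed.

(** Some [approx f k <= f] of the countable family already has integral above a rational larger than
    [a], and a lower bound on it is a lower bound on [f]. *)
Lemma test_nbhs_lower f mu (a : R) : a < Mp_int mu f ->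
  test_nbhs mu [set nu | a < Mp_int nu f].
Proof.
move=> af; have FF := test_nbhs_filter mu.
have [k _ /(_ k (leqnn _)) /=] := cvgr_gt _ (@Mp_int_approx_cvg mu f) _ af.
move=> /rat_in_itvoo[q]; rewrite in_itv/= => /andP[aq qk].
apply: filterS (test_nbhs_gt qk) => nu /= hq.
apply: lt_le_trans (lt_trans aq hq) _; apply: Mp_int_le => e.
by apply: approx_le => y; exact: CK_ge0.
Qed.

(** Approximation from below yields no upper bound. So [f] is written [K - h] with a majorant [K]
    from the countable family and [h] in C_K^+: an upper bound for [K] and a lower bound for [h],
    each using half of the available gap, bound [f]. *)
Lemma test_nbhs_upper f mu (a : R) : Mp_int mu f < a ->
  test_nbhs mu [set nu | Mp_int nu f < a].
Proof.
move=> af; have FF := test_nbhs_filter mu.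
have [eta eta0 hf] := CK_far f; have [C C0 fC] := CK_bounded f.
have [m] := ltr_add_invr eta0; rewrite add0r => meta.
pose j := (Num.truncn C).+1.
have Cj : C < j%:R by exact: truncnS_gt.
pose K := cutoff_mul (j, m).
have fK e : f e <= K e.
  have [->|/hf fe] := eqVneq (f e) 0; first exact: CK_ge0.
  have -> : K e = j%:R * cutoff (invS_gt0 m) e by [].
  rewrite cutoff_far; last by rewrite /far /=; exact: le_trans (ltW meta) fe.
  by rewrite mulr1 (le_trans (fC e))// ltW.
have [h hE] : exists h : CKplus R, forall e, h e = K e - f e.
  have hc : continuous (fun e => K e - f e).
    apply: cont_add; first exact: CK_continuous.
    by apply: cont_opp; exact: CK_continuous.
  have h0 e : 0 <= K e - f e by rewrite subr_ge0.
  have [e1 e10 Ke] := CK_far K.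
  suff hs : compact (closure [set e | K e - f e != 0]) by exists (MkCKplus h0 hc hs).
  apply: (far_compact_support e10) => e; apply: contraNT => /negP nf.
  have K0 : K e = 0 by apply/eqP; apply: contrapT => /negP /Ke.
  have f0 : f e = 0 by apply: le_anti; rewrite CK_ge0 -K0 fK.
  by rewrite K0 f0 subrr.
have KE nu : Mp_int nu K = Mp_int nu h + Mp_int nu f.
  rewrite -Mp_int_add; apply: eq_Rintegral => e _.
  by rewrite [CKfun (CKadd _ _) _]/= hE subrK.
have d0 : 0 < (a - Mp_int mu f) / 2 by rewrite divr_gt0// subr_gt0.
have /rat_in_itvoo[q] : Mp_int mu K < Mp_int mu K + (a - Mp_int mu f) / 2.
  by rewrite ltrDl.
rewrite in_itv/= => /andP[Kq qK].
have hlow : Mp_int mu h - (a - Mp_int mu f) / 2 < Mp_int mu h by rewrite gtrBl.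
apply: filterS (filterI (test_nbhs_lt Kq) (test_nbhs_lower hlow)) => nu [/= h1 h2].
by have := KE nu; have := KE mu; rewrite -/K in h1; lra.
Qed.

Lemma exists_test U mu : open U -> U mu ->
  exists2 L, testprod L mu = 1 & forall nu, testprod L nu != 0 -> U nu.
Proof.
have FF := test_nbhs_filter mu.
apply: (@vague_filter (test_nbhs mu) mu) => // f.
apply/cvgrPdist_lt => eps eps0.
have h1 : Mp_int mu f - eps < Mp_int mu f by rewrite gtrBl.
have h2 : Mp_int mu f < Mp_int mu f + eps by rewrite ltrDl.
apply: filterS (filterI (test_nbhs_lower h1) (test_nbhs_upper h2)) => nu [/= n1 n2].
by rewrite ltr_norml; apply/andP; split; lra.
Qed.

End vague_neighbourhoods.

Section laplace_portmanteau.
Variable R : realType.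
Implicit Types (mu nu : Mp R) (phi : Mp R -> R).

Let testsup := supseq (@testprod R).

Lemma expcl_testsup s : expcl (testsup s).
Proof.
rewrite /testsup; elim: s => [|j s ih] /=; first exact: expcl_cst.
by apply: expcl_max => //; apply: expcl_scale; exact: expcl_testprod.
Qed.

Lemma measurable_testsup s : measurable_fun setT (testsup s).
Proof. by apply: measurable_expcl; exact: expcl_testsup. Qed.

Let lower_approx phi k := testsup (minorants (@testprod R) phi k).

Lemma lower_approx_le phi k mu : (forall mu, 0 <= phi mu) -> lower_approx phi k mu <= phi mu.
Proof. exact: supseq_minorants_le. Qed.

Lemma lower_approx_cvg phi mu : (forall mu, 0 <= phi mu) -> continuous phi ->
  lower_approx phi k mu @[k --> \oo] --> phi mu.
Proof.
move=> g0 cphi.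
apply: (@supseq_minorants_cvg R (Mp R) _ (@testprod R) (@testprod_le1 R) phi mu g0) => q qg.
by apply: exists_test => //; exact: cont_open_gt.
Qed.

Lemma Mp_probability_setT (P : probability (Mp R) R) :
  (P : {measure set (Mp R) -> \bar R}) [set: Mp R] = 1%E.
Proof. exact: probability_setT. Qed.

Lemma bounded_integrable (P : probability (Mp R) R) phi C : measurable_fun setT phi ->
  (forall mu, `|phi mu| <= C) -> P.-integrable setT (EFin \o phi).
Proof.
move=> mphi hC; apply: (@carried_integrable _ _ _ _ setT _ _ C) => //.
  by rewrite Mp_probability_setT ltry.
by split=> // mu; rewrite indicT mulr1.
Qed.

Lemma vf_integrable (P : probability (Mp R) R) f : P.-integrable setT (EFin \o vf f).
Proof. by apply: (@bounded_integrable P (vf f) 1); [exact: measurable_vf|exact: norm_vf_le1]. Qed.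

Variables (P_ : nat -> probability (Mp R) R) (P : probability (Mp R) R).
Hypothesis laplace_cvg : forall g,
  \int[P_ n]_mu vf g mu @[n --> \oo] --> \int[P]_mu vf g mu.

Lemma expcl_cvg F : expcl F -> \int[P_ n]_mu F mu @[n --> \oo] --> \int[P]_mu F mu.
Proof.
move=> hF; have i1 (Q : probability (Mp R) R) : Q.-integrable setT (EFin \o (fun=> 1 : R)).
  exact: finite_measure_integrable_cst.
have h01 (mu : Mp R) : (0 : R) <= (fun=> 1) mu by [].
have E (Q : probability (Mp R) R) (G : Mp R -> R) : \int[Q]_mu (1 * G mu) = \int[Q]_mu G mu.
  by apply: eq_Rintegral => mu _; rewrite mul1r.
have h2 g : \int[P_ n]_mu (1 * vf g mu) @[n --> \oo] --> \int[P]_mu (1 * vf g mu).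
  by rewrite E; under eq_fun do rewrite E; exact: laplace_cvg.
have := @expcl_weighted_cvg R P_ P (fun=> 1) (fun n => i1 (P_ n)) (i1 P) h01 h2 F hF.
by rewrite E; under eq_fun do rewrite E.
Qed.

(** A function [lower_approx phi k] lies below [phi] and in [expcl], where convergence is known, and
    for large [k] its integral under the limit law is close to that of [phi]. *)
Lemma laplace_lower phi C eps : (forall mu, 0 <= phi mu <= C) -> continuous phi -> 0 < eps ->
  \forall n \near \oo, \int[P]_mu phi mu - eps < \int[P_ n]_mu phi mu.
Proof.
move=> hphi cphi eps0.
have g0 mu : 0 <= phi mu by have /andP[] := hphi mu.
have mphi : measurable_fun setT phi by exact: continuous_measurable_Mp.
have iphi (Q : probability (Mp R) R) : Q.-integrable setT (EFin \o phi).
  apply: (@bounded_integrable Q phi C) => // mu.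
  by rewrite ger0_norm//; have /andP[] := hphi mu.
have ilow (Q : probability (Mp R) R) k : Q.-integrable setT (EFin \o lower_approx phi k).
  have [D _ hD] := expcl_bounded (expcl_testsup (minorants (@testprod R) phi k)).
  by apply: (@bounded_integrable Q _ D) => //; exact: measurable_testsup.
have lowcvg : \int[P]_mu lower_approx phi k mu @[k --> \oo] --> \int[P]_mu phi mu.
  apply: (@carried_cvg _ _ _ P setT _ _ C) => //.
  - by rewrite Mp_probability_setT ltry.
  - move=> k; split; first by exact: measurable_testsup.
    move=> mu; rewrite indicT mulr1 ger0_norm ?supseq_ge0//.
    by rewrite (le_trans (lower_approx_le _ _ g0))//; have /andP[] := hphi mu.
  - by move=> mu; exact: lower_approx_cvg.
have lt1 : \int[P]_mu phi mu - eps < \int[P]_mu phi mu by rewrite gtrBl.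
have [k _ /(_ k (leqnn _)) /= hk] := cvgr_gt _ lowcvg _ lt1.
apply: filterS (cvgr_gt _ (expcl_cvg (expcl_testsup (minorants (@testprod R) phi k))) _ hk).
move=> n /lt_le_trans; apply; apply: le_Rintegral => //; [exact: ilow|exact: iphi|].
by move=> mu _; exact: lower_approx_le.
Qed.

Lemma laplace_cvg_bounded phi : continuous phi -> (exists C : R, forall mu, `|phi mu| <= C) ->
  \int[P_ n]_mu phi mu @[n --> \oo] --> \int[P]_mu phi mu.
Proof.
move=> cphi [C hC].
have mphi : measurable_fun setT phi by exact: continuous_measurable_Mp.
have iphi (Q : probability (Mp R) R) : Q.-integrable setT (EFin \o phi).
  exact: (@bounded_integrable Q phi C).
have iC (Q : probability (Mp R) R) : Q.-integrable setT (EFin \o (fun=> C : R)).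
  exact: finite_measure_integrable_cst.
have RC (Q : probability (Mp R) R) : \int[Q]_mu (fun=> C) mu = C.
  by rewrite Rintegral_cst// Mp_probability_setT mulr1.
have h1 mu : 0 <= C + phi mu <= C + C.
  have := hC mu; rewrite ler_norml => /andP[? ?]; apply/andP; split; lra.
have h2 mu : 0 <= C - phi mu <= C + C.
  have := hC mu; rewrite ler_norml => /andP[? ?]; apply/andP; split; lra.
have c1 : continuous (fun mu => C + phi mu) by apply: cont_add => //; exact: cont_cst.
have c2 : continuous (fun mu => C - phi mu).
  apply: cont_add; first exact: cont_cst.
  exact: cont_opp.
have E1 (Q : probability (Mp R) R) : \int[Q]_mu (C + phi mu) = C + \int[Q]_mu phi mu.
  by rewrite RintegralD//; [congr (_ + _); exact: RC|exact: iC|exact: iphi].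
have E2 (Q : probability (Mp R) R) : \int[Q]_mu (C - phi mu) = C - \int[Q]_mu phi mu.
  by rewrite RintegralB//; [congr (_ - _); exact: RC|exact: iC|exact: iphi].
apply/cvgrPdist_lt => eps eps0.
apply: filterS (filterI (laplace_lower h1 c1 eps0) (laplace_lower h2 c2 eps0)).
move=> n [/=]; rewrite !E1 !E2 => l1 l2.
by rewrite ltr_norml; apply/andP; split; lra.
Qed.

End laplace_portmanteau.

(** * Sets of measures given by counts *)

Section hitting_sets.
Variable R : realType.
Implicit Types (mu : Mp R) (B : set (E R)) (s : seq (set (E R) * nat)).

Definition atleast B (k : nat) : set (Mp R) := [set mu | (k%:R%:E <= mu B)%E].

Definition hit B : set (Mp R) := [set mu | (0 < mu B)%E].

Lemma atleastE B k mu : rcborel B -> atleast B k mu <-> k%:R <= mass mu B.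
Proof. by move=> rB; rewrite /atleast /= -(mass_EFin mu rB) lee_fin. Qed.

Lemma hitE B mu : rcborel B -> hit B mu <-> 0 < mass mu B.
Proof. by move=> rB; rewrite /hit /= -(mass_EFin mu rB) lte_fin. Qed.

Lemma not_hit_mass B mu : rcborel B -> ~ hit B mu -> mass mu B = 0.
Proof.
move=> rB nh; apply/eqP; rewrite eq_le fine_ge0// andbT leNgt; apply/negP => h.
by apply: nh; apply/hitE.
Qed.

Lemma hit_atleast B : rcborel B -> hit B = atleast B 1.
Proof.
move=> rB; apply/seteqP; split=> mu.
  move/(hitE _ rB) => h; apply/(atleastE _ _ rB); move: h.
  by have [k ->] := mass_nat mu rB; rewrite ltr0n ler_nat.
move/(atleastE _ _ rB) => h; apply/(hitE _ rB); exact: lt_le_trans h.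
Qed.

Lemma measurable_atleast B k : rcborel B -> measurable (atleast B k).
Proof.
move=> rB; rewrite (_ : atleast B k = (fun mu => mass mu B) @^-1` [set y | k%:R <= y]).
  rewrite -[X in measurable X]setTI; apply: measurable_mass => //.
  rewrite (_ : [set _ | _] = `[k%:R, +oo[%classic)//.
  by apply/seteqP; split=> y /=; rewrite in_itv/= andbT.
by apply/seteqP; split=> mu /=; move/(atleastE _ _ rB).
Qed.

Lemma measurable_hit B : rcborel B -> measurable (hit B).
Proof. by move=> rB; rewrite hit_atleast//; exact: measurable_atleast. Qed.

Lemma hitS B B' : measurable B -> measurable B' -> B `<=` B' -> hit B `<=` hit B'.
Proof.
by move=> mB mB' BB' mu /lt_le_trans; apply; apply: le_measure => //; rewrite inE.
Qed.

(** Finite intersections are coded by lists for the sake of induction. The empty list gives the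
    whole space, so clause (a') becomes an instance of the same statement as (b'). *)
Fixpoint Jset s : set (Mp R) :=
  if s is x :: s' then atleast x.1 x.2 `&` Jset s' else setT.

(** One [eta] serves the whole list, so that all approximations of its sets live in a common compact
    set. *)
Fixpoint Jwf (eta : R) s : Prop :=
  if s is x :: s' then [/\ measurable x.1, x.1 `<=` far eta, (0 < x.2)%N & Jwf eta s']
  else True.

Lemma measurable_Jset eta s : 0 < eta -> Jwf eta s -> measurable (Jset s).
Proof.
move=> eta0; elim: s => [|x s ih] /=; first by move=> _; exact: measurableT.
move=> [mB Bf k0 /ih mJ]; apply: measurableI => //.
by apply: measurable_atleast; exact: (far_rcborel eta0).
Qed.

Definition locfin (al : {measure set (Mp R) -> \bar R}) :=
  forall B, rcborel B -> (al (hit B) < +oo)%E.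

(** If [mu] does not charge a set [far eta] containing the support of [f], then [mu(f) = 0] and the
    integrand vanishes. It thus lives on a set of finite mass for every [locfin] measure. *)
Lemma one_sub_vf_carried f : exists2 eta : R, 0 < eta &
  carried (hit (far eta)) 1 (fun mu => 1 - vf f mu).
Proof.
have [eta eta0 [C C0 [mf cf]]] := CK_carried f; exists eta => //.
split.
  by apply: measurable_funB; [exact: measurable_cst|exact: measurable_vf].
move=> mu; rewrite ger0_norm ?subr_ge0 ?vf_le1// mul1r indicE.
have [|/negP h] := boolP (mu \in _); first by rewrite gerBl vf_ge0.
have m0 : mass mu (far eta) = 0.
  by apply: not_hit_mass; [exact: rcborel_far_set|move=> h0; apply: h; rewrite inE].
rewrite subr_le0 /vf; suff -> : Mp_int mu f = 0 by rewrite oppr0 expR0.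
apply/eqP; rewrite eq_le Mp_int_ge0 andbT.
apply: (@le_trans _ _ (C * mass mu (far eta))); last by rewrite m0 mulr0.
rewrite mass_Rintegral; last exact: measurable_far.
have mfar : measurable (far eta) by exact: measurable_far.
have ifar := indic_integrable mfar (Mp_far_fin mu eta0).
rewrite -RintegralZl//; apply: le_Rintegral => //.
- exact: CK_integrable.
- exact: (@integrableZl _ _ _ _ _ _ C _ ifar).
- by move=> e _; apply: le_trans (cf e); rewrite ler_norm.
Qed.

Lemma one_sub_vf_integrable al f : locfin al ->
  al.-integrable setT (EFin \o (fun mu => 1 - vf f mu)).
Proof.
move=> lal; have [eta eta0 h] := one_sub_vf_carried f.
apply: (carried_integrable _ _ h).
  by apply: measurable_hit; exact: rcborel_far_set.
by apply: lal; exact: rcborel_far_set.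
Qed.

End hitting_sets.

(** * From Laplace functionals to counts *)

Section laplace_to_hitting.
Variable R : realType.
Implicit Types (mu : Mp R) (B : set (E R)) (s : seq (set (E R) * nat)).
Variables (al_ : nat -> {measure set (Mp R) -> \bar R}) (al : {measure set (Mp R) -> \bar R}).
Hypotheses (lal_ : forall n, locfin (al_ n)) (lal : locfin al).
Hypothesis laplace_cvg : forall f,
  \int[al_ n]_mu (1 - vf f mu) @[n --> \oo] --> \int[al]_mu (1 - vf f mu).

(** Since [vf] is multiplicative, [(1 - vf f) * vf g] is the difference of [1 - vf (CKadd f g)] and
    [1 - vf g], whose integrals converge by hypothesis. *)
Lemma weighted_laplace_cvg f F : expcl F ->
  \int[al_ n]_mu ((1 - vf f mu) * F mu) @[n --> \oo] --> \int[al]_mu ((1 - vf f mu) * F mu).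
Proof.
apply: expcl_weighted_cvg => [n|||g].
- exact: one_sub_vf_integrable.
- exact: one_sub_vf_integrable.
- by move=> mu; rewrite subr_ge0 vf_le1.
have E (be : {measure set (Mp R) -> \bar R}) : locfin be ->
    \int[be]_mu ((1 - vf f mu) * vf g mu) =
    \int[be]_mu (1 - vf (CKadd f g) mu) - \int[be]_mu (1 - vf g mu).
  move=> lb; rewrite -RintegralB//; last 2 first.
    exact: one_sub_vf_integrable.
    exact: one_sub_vf_integrable.
  by apply: eq_Rintegral => mu _; rewrite vf_add; ring.
rewrite E//; under eq_fun do rewrite E//.
by apply: cvgB; exact: laplace_cvg.
Qed.

Lemma expcl_geometric f m : expcl (fun mu => \sum_(i < m) vf f mu ^+ i).
Proof.
have hX i : expcl (fun mu => vf f mu ^+ i).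
  elim: i => [|i ih]; first exact: expcl_cst.
  apply: (@expcl_ext _ (fun mu => vf f mu * vf f mu ^+ i)).
    by move=> mu; rewrite exprS.
  by apply: expcl_mul => //; exact: expcl_vf.
elim: m => [|m ih].
  apply: (@expcl_ext _ (fun=> 0)); last exact: expcl_cst.
  by move=> mu; rewrite big_ord0.
apply: (@expcl_ext _ (fun mu => \sum_(i < m) vf f mu ^+ i + vf f mu ^+ m)).
  by move=> mu; rewrite big_ord_recr.
exact: expcl_add.
Qed.

(* [F = F v^m + (1 - v) F (1 + v + ... + v^(m-1))] with [v = vf f], and [F v^m]
   is uniformly small relative to the integrable weight [1 - v]. *)
Lemma vanishing_cvg f F (de : R) : expcl F -> 0 < de -> de < 1 ->
  (forall mu, F mu != 0 -> vf f mu <= 1 - de) ->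
  \int[al_ n]_mu F mu @[n --> \oo] --> \int[al]_mu F mu.
Proof.
move=> hF de0 de1 hvan; have [C C0 FC] := expcl_bounded hF.
pose W mu := 1 - vf f mu.
have W0 mu : 0 <= W mu by rewrite subr_ge0 vf_le1.
(* Where [F] does not vanish, [vf f mu <= 1 - de]; this gives both the factor [(1 - de) ^+ m] and
   [1 <= W mu / de]. *)
have FW m mu : `|F mu| * vf f mu ^+ m <= C / de * (1 - de) ^+ m * W mu.
  have [->|/hvan h] := eqVneq (F mu) 0.
    rewrite normr0 mul0r mulr_ge0// mulr_ge0 ?exprn_ge0 ?divr_ge0 ?ltW//.
    by rewrite subr_gt0.
  rewrite mulrAC; apply: ler_pM => //; first by rewrite exprn_ge0 ?vf_ge0.
    apply: le_trans (FC mu) _; rewrite -mulrA.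
    have dW : 1 <= de^-1 * W mu by rewrite ler_pdivlMl// mulr1 /W; lra.
    by rewrite ler_peMr// ltW.
  by rewrite lerXn2r ?nnegrE ?vf_ge0//; lra.
pose I := \int[al]_mu W mu.
have Wcvg : \int[al_ n]_mu W mu @[n --> \oo] --> I by exact: laplace_cvg.
have I0 : 0 <= I by apply: Rintegral_ge0.
have I1 : 0 < I + 1 by rewrite ltr_wpDl.
apply: cvg_approx => eps eps0.
have [m hm] : exists m, C / de * (1 - de) ^+ m * (I + 1) <= eps.
  have q1 : `|1 - de| < 1 by rewrite ger0_norm; lra.
  have c0 : 0 < C / de * (I + 1) by rewrite mulr_gt0// divr_gt0.
  have e0 : 0 < eps / (C / de * (I + 1)) by rewrite divr_gt0.
  have /cvgrPdist_lt/(_ _ e0)[m _ /(_ m (leqnn _))] := cvg_expr q1.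
  rewrite /= sub0r normrN => /ltW hm; exists m.
  by rewrite mulrAC mulrC -ler_pdivlMr// (le_trans (ler_norm _) hm).
pose G mu := F mu * \sum_(i < m) vf f mu ^+ i.
have hG : expcl G by apply: expcl_mul => //; exact: expcl_geometric.
exists (fun n => \int[al_ n]_mu (W mu * G mu)), (\int[al]_mu (W mu * G mu)).
  exact: weighted_laplace_cvg.
have FG mu : F mu - W mu * G mu = F mu * vf f mu ^+ m.
  have := subrX1 (vf f mu) m; rewrite /G /W => h.
  transitivity (F mu + F mu * ((vf f mu - 1) * \sum_(i < m) vf f mu ^+ i)); first by ring.
  by rewrite -h; ring.
have FW0 mu : `|F mu| <= C / de * W mu by have := FW 0%N mu; rewrite expr0 !mulr1.
have bnd (be : {measure set (Mp R) -> \bar R}) : locfin be ->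
    \int[be]_mu W mu <= I + 1 ->
    `|\int[be]_mu F mu - \int[be]_mu (W mu * G mu)| <= eps.
  move=> lb bI; apply: le_trans hm.
  have iW : be.-integrable setT (EFin \o W) by exact: one_sub_vf_integrable.
  have iF : be.-integrable setT (EFin \o F).
    apply: (@le_integrable _ _ _ _ _ _ _ (fun mu => (C / de)%:E * (EFin \o W) mu)%E) => //.
    - by apply/measurable_EFinP; exact: measurable_expcl.
    - by move=> mu _ /=; rewrite lee_fin (le_trans (FW0 mu))// ler_norm.
    - exact: integrableZl.
  have iG := weighted_integrable iW hG.
  rewrite -RintegralB//.
  apply: le_trans (le_normr_Rintegral _ _) _ => //; first exact: (integrableB _ iF iG).
  apply: (@le_trans _ _ (\int[be]_mu (C / de * (1 - de) ^+ m * W mu))); last first.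
    rewrite RintegralZl//; apply: ler_wpM2l bI.
    by rewrite mulr_ge0 ?exprn_ge0 ?divr_ge0 ?ltW// subr_gt0.
  apply: le_Rintegral => //.
  - by have := integrable_abse (integrableB measurableT iF iG); apply: eq_integrable.
  - exact: (@integrableZl _ _ _ _ _ _ _ _ iW).
  - move=> mu _; rewrite FG normrM (le_trans _ (FW m mu))// ler_wpM2l//.
    by rewrite ger0_norm// exprn_ge0 ?vf_ge0.
split; last by apply: bnd => //; rewrite lerDl.
near=> n; apply: bnd => //.
by near: n; apply: (cvgr_le I) => //; rewrite ltrDl.
Unshelve. all: by end_near. Qed.

End laplace_to_hitting.

Lemma indic_subset (R : realType) T (A B : set T) x : A `<=` B -> \1_A x <= \1_B x :> R.
Proof.
move=> AB; rewrite !indicE ler_nat.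
by case: (boolP (x \in A)) => // /set_mem/AB/mem_set ->.
Qed.

Section smooth_thresholds.
Variable R : realType.
Implicit Types (mu : Mp R) (B : set (E R)) (s : seq (set (E R) * nat)).

(** Vanishes for [u <= k - 1/2] and equals 1 for [u >= k], hence is the indicator of [k <= u] on
    integers. It is piecewise affine in [expR (- u)] instead of [u], which places
    [threshold k (Mp_int mu f)] in [expcl]. *)
Definition threshold (k : nat) (u : R) : R :=
  clamp01 ((expR (2^-1 - k%:R) - expR (- u)) / (expR (2^-1 - k%:R) - expR (- k%:R))).

Let den_gt0 (k : nat) : 0 < expR (2^-1 - k%:R) - expR (- k%:R) :> R.
Proof. by rewrite subr_gt0 ltr_expR ltrDr invr_gt0. Qed.

Lemma le_clamp01 (a b : R) : a <= b -> clamp01 a <= clamp01 b.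
Proof.
by move=> ab; apply: le_min2 => //; exact: le_max2.
Qed.

Lemma threshold_le k (u v : R) : u <= v -> threshold k u <= threshold k v.
Proof.
move=> uv; apply: le_clamp01; rewrite ler_pM2r ?invr_gt0//.
by rewrite lerD2l lerN2 ler_expR lerN2.
Qed.

Lemma threshold_nat k (j : nat) : threshold k j%:R = (k <= j)%:R.
Proof.
have [kj|jk] := leqP k j.
  rewrite [threshold _ _]clamp01_eq1// ler_pdivlMr// mul1r lerD2l lerN2 ler_expR lerN2.
  by rewrite ler_nat.
rewrite [threshold _ _]clamp01_eq0//; apply: mulr_le0_ge0; last by rewrite invr_ge0 ltW.
rewrite subr_le0 ler_expR.
have : (j.+1%:R : R) <= k%:R by rewrite ler_nat.
by rewrite -natr1; move: (j%:R : R) (k%:R : R) => a b; lra.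
Qed.

Lemma threshold_continuous k : continuous (threshold k : R -> R).
Proof.
apply: cont_min; first exact: cont_cst.
apply: cont_max; first exact: cont_cst.
apply: cont_mul; last exact: cont_cst.
apply: cont_add; first exact: cont_cst.
by apply: cont_opp; exact: continuous_expRN.
Qed.

Definition thresholds (fn : set (E R) -> CKplus R) s mu : R :=
  \prod_(x <- s) threshold x.2 (Mp_int mu (fn x.1)).

Lemma threshold_ge0 k (u : R) : 0 <= threshold k u.
Proof. exact: clamp01_ge0. Qed.

Lemma threshold_le1 k (u : R) : threshold k u <= 1.
Proof. exact: clamp01_le1. Qed.

Lemma thresholds_ge0 fn s mu : 0 <= thresholds fn s mu.
Proof. by apply: prodr_ge0 => x _; exact: threshold_ge0. Qed.

Lemma expcl_thresholds fn s : expcl (thresholds fn s).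
Proof.
rewrite /thresholds; elim: s => [|x s ih].
  apply: (@expcl_ext _ (fun=> 1)); last exact: expcl_cst.
  by move=> mu; rewrite big_nil.
apply: (@expcl_ext _ (fun mu => threshold x.2 (Mp_int mu (fn x.1)) *
   \prod_(x <- s) threshold x.2 (Mp_int mu (fn x.1)))).
  by move=> mu; rewrite big_cons.
apply: expcl_mul => //; apply: expcl_clamp01.
set a := expR _; set c := a - _.
apply: (@expcl_ext _ (fun mu => c^-1 * (a + (-1) * vf (fn x.1) mu))).
  by move=> mu; rewrite mulN1r mulrC.
by apply/expcl_scale/expcl_add; [exact: expcl_cst|apply/expcl_scale/expcl_vf].
Qed.

Lemma indic_atleast B k mu : rcborel B ->
  \1_(atleast B k) mu = threshold k (mass mu B) :> R.
Proof.
move=> rB; have [j mj] := mass_nat mu rB.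
rewrite mj threshold_nat indicE; congr (_%:R); congr nat_of_bool.
apply/idP/idP => [/set_mem/(atleastE _ _ rB)|kj].
  by rewrite mj ler_nat.
by apply/mem_set/(atleastE _ _ rB); rewrite mj ler_nat.
Qed.

Lemma indic_Jset_cons x s mu :
  \1_(Jset (x :: s)) mu = \1_(atleast x.1 x.2) mu * \1_(Jset s) mu :> R.
Proof. by rewrite /= indicI. Qed.

Lemma thresholds_le_indic (eta : R) fn s mu : 0 < eta -> Jwf eta s ->
  (forall B, rcborel B -> Mp_int mu (fn B) <= mass mu B) ->
  thresholds fn s mu <= \1_(Jset s) mu.
Proof.
move=> eta0 + hfn; elim: s => [|x s ih] /=.
  by move=> _; rewrite /thresholds big_nil indicT.
move=> [mB Bf k0 /ih {}ih]; rewrite indic_Jset_cons /thresholds big_cons.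
have rB := far_rcborel eta0 mB Bf.
apply: ler_pM => //; [exact: threshold_ge0|exact: thresholds_ge0|].
by rewrite indic_atleast//; apply: threshold_le; exact: hfn.
Qed.

Lemma thresholds_ge_indic (eta : R) fn s mu : 0 < eta -> Jwf eta s ->
  (forall B, measurable B -> B `<=` far eta -> mass mu B <= Mp_int mu (fn B)) ->
  \1_(Jset s) mu <= thresholds fn s mu.
Proof.
move=> eta0 + hfn; elim: s => [|x s ih] /=.
  by move=> _; rewrite /thresholds big_nil indicT.
move=> [mB Bf k0 /ih {}ih]; rewrite indic_Jset_cons /thresholds big_cons.
have rB := far_rcborel eta0 mB Bf.
apply: ler_pM => //.
by rewrite indic_atleast//; apply: threshold_le; exact: hfn.
Qed.

Definition Jmap (h : set (E R) -> set (E R)) s := [seq (h x.1, x.2) | x <- s].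

Lemma thresholds_cvg (eta : R) (fn : nat -> set (E R) -> CKplus R)
    (h : set (E R) -> set (E R)) s mu : 0 < eta -> Jwf eta s -> Jwf eta (Jmap h s) ->
  (forall B, measurable B -> B `<=` far eta ->
    Mp_int mu (fn n B) @[n --> \oo] --> mass mu (h B)) ->
  thresholds (fn n) s mu @[n --> \oo] --> (\1_(Jset (Jmap h s)) mu : R).
Proof.
move=> eta0 + + hfn; rewrite /thresholds; elim: s => [|x s ih] /=.
  move=> _ _; under eq_fun do rewrite big_nil.
  by rewrite indicT; exact: cvg_cst.
move=> [mB Bf k0 /ih {}ih] [mhB hBf _ /ih {}ih].
under eq_fun do rewrite big_cons.
rewrite indicI; apply: cvgM => //.
rewrite indic_atleast; last exact: (far_rcborel eta0 mhB hBf).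
apply: (@cvg_comp _ _ _ (fun n => Mp_int mu (fn n x.1)) (threshold x.2)).
  exact: hfn.
exact: threshold_continuous.
Qed.

(** A nonzero value forces [u > k - 1/2 >= 1/2]. The right-hand side has the form [1 - de] required
    by [vanishing_cvg]. *)
Lemma threshold_support k (u : R) : (0 < k)%N -> threshold k u != 0 ->
  expR (- u) <= 1 - (1 - expR (- 2^-1)).
Proof.
move=> k0 /clamp01_gt0; rewrite pmulr_lgt0 ?invr_gt0// subr_gt0 => /ltW h.
rewrite opprB addrCA subrr addr0 (le_trans h)// ler_expR.
have : (1 : R) <= k%:R by rewrite ler1n.
by move: (k%:R : R) => a; lra.
Qed.

Lemma thresholds_carried (eta : R) (fn : set (E R) -> CKplus R) x s : 0 < eta -> (0 < x.2)%N ->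
  carried (far eta) 1 (fn x.1) -> carried (hit (far eta)) 1 (thresholds fn (x :: s)).
Proof.
move=> eta0 k0 cf; split; first by apply: measurable_expcl; exact: expcl_thresholds.
move=> mu; rewrite ger0_norm ?thresholds_ge0// mul1r indicE.
have [_|/negP h] := boolP (mu \in _).
  by apply: prodr_ile1 => y _; rewrite threshold_ge0 threshold_le1.
have m0 : mass mu (far eta) = 0.
  by apply: not_hit_mass; [exact: rcborel_far_set|move=> h0; apply: h; rewrite inE].
have fx0 : Mp_int mu (fn x.1) = 0.
  apply/eqP; rewrite eq_le Mp_int_ge0 andbT -m0 mass_Rintegral; last exact: measurable_far.
  have mfar : measurable (far eta) by exact: measurable_far.
  have ifar := indic_integrable mfar (Mp_far_fin mu eta0).
  apply: le_Rintegral => //; first exact: CK_integrable.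
  move=> e _; apply: le_trans (ler_norm _) _.
  by have [_ /(_ e)] := cf; rewrite mul1r.
rewrite /thresholds big_cons fx0 (threshold_nat x.2 0).
by rewrite leqNgt k0 mul0r.
Qed.

End smooth_thresholds.

Section hitting_convergence.
Variable R : realType.
Implicit Types (mu : Mp R) (B : set (E R)) (s : seq (set (E R) * nat)).

Lemma Jwf_interior (eta : R) s : Jwf eta s -> Jwf eta (Jmap (@interior (E R)) s).
Proof.
elim: s => //= x s ih [mB Bf k0 /ih h]; split => //.
  by apply: open_measurable_E; exact: open_interior.
exact: subset_trans (@interior_subset _ _) Bf.
Qed.

Lemma Jwf_closure (eta : R) s : Jwf eta s -> Jwf eta (Jmap (@closure (E R)) s).
Proof.
elim: s => //= x s ih [mB Bf k0 /ih h]; split => //.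
  by apply: closed_measurable_E; exact: closed_closure.
by rewrite closureE => e; apply; split => //; exact: closed_far.
Qed.

Lemma Jset_le (eta : R) h h' s : 0 < eta -> Jwf eta (Jmap h s) -> Jwf eta (Jmap h' s) ->
  (forall B, h B `<=` h' B) -> Jset (Jmap h s) `<=` Jset (Jmap h' s).
Proof.
move=> eta0 + + hh; elim: s => //= x s ih [m1 _ _ /ih {}ih] [m2 _ _ /ih {}ih] mu [h1 /ih h2].
split => //; apply: le_trans h1 _; apply: le_measure => //; by rewrite inE.
Qed.

Variables (al_ : nat -> {measure set (Mp R) -> \bar R}) (al : {measure set (Mp R) -> \bar R}).
Hypotheses (lal_ : forall n, locfin (al_ n)) (lal : locfin al).
Hypothesis laplace_cvg : forall f,
  \int[al_ n]_mu (1 - vf f mu) @[n --> \oo] --> \int[al]_mu (1 - vf f mu).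

Lemma thresholds_laplace_cvg fn x s : (0 < x.2)%N ->
  \int[al_ n]_mu thresholds fn (x :: s) mu @[n --> \oo] -->
  \int[al]_mu thresholds fn (x :: s) mu.
Proof.
move=> k0; apply: (@vanishing_cvg _ _ _ lal_ lal laplace_cvg (fn x.1) _ (1 - expR (- 2^-1))).
- exact: expcl_thresholds.
- by rewrite subr_gt0 -[ltRHS]expR0 ltr_expR oppr_lt0 invr_gt0.
- by rewrite gtrBl expR_gt0.
- move=> mu; rewrite /thresholds big_cons mulf_eq0 negb_or => /andP[h _].
  exact: threshold_support h.
Qed.

(** The null boundary is expressed as equality of the masses obtained from closures and from
    interiors, the two limits of the squeeze. The list has a head with positive count, so the event
    lies in a set of measures of finite mass. *)
Lemma Jset_cvg (eta : R) x s : 0 < eta -> Jwf eta (x :: s) ->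
  al (Jset (Jmap (@closure (E R)) (x :: s))) = al (Jset (Jmap (@interior (E R)) (x :: s))) ->
  fine (al_ n (Jset (x :: s))) @[n --> \oo] --> fine (al (Jset (x :: s))).
Proof.
move=> eta0 wf null; set t := x :: s in wf null *.
have e20 : 0 < eta / 2 by rewrite divr_gt0.
have k0 : (0 < x.2)%N by case: wf.
have Bf : x.1 `<=` far eta by case: wf.
have wfi := Jwf_interior wf; have wfc := Jwf_closure wf.
have far2 : far eta `<=` far (eta / 2) by move=> e; rewrite /far /=; lra.
have mhit : measurable (hit (far (eta / 2))) by apply: measurable_hit; exact: rcborel_far_set.
have mt : measurable (Jset t) by exact: measurable_Jset wf.
pose lo n B := inner B° n; pose up n B := outer eta0 (closure B) n.
have cl B : B `<=` far eta -> closure B `<=` far eta.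
  by move=> BF; rewrite closureE => e; apply; split => //; exact: closed_far.
have clo n : carried (hit (far (eta / 2))) 1 (thresholds (lo n) t).
  apply: thresholds_carried => //; apply: inner_carried.
  exact: subset_trans (subset_trans (@interior_subset _ _) Bf) far2.
have cup n : carried (hit (far (eta / 2))) 1 (thresholds (up n) t).
  by apply: thresholds_carried => //; exact: outer_carried.
have fin (be : {measure set (Mp R) -> \bar R}) : locfin be ->
    (be (hit (far (eta / 2))) < +oo)%E.
  by apply; exact: rcborel_far_set.
have ti u : t = u -> Jset t = Jset u by move=> ->.
have tid : t = Jmap id t by rewrite /Jmap -[LHS]map_id; apply: eq_map => -[].
have wfid : Jwf eta (Jmap id t) by rewrite -tid.
have sub_it : Jset (Jmap (@interior (E R)) t) `<=` Jset t.
  by rewrite [X in _ `<=` X](ti _ tid); apply: (Jset_le eta0) => // B; exact: interior_subset.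
have sub_tc : Jset t `<=` Jset (Jmap (@closure (E R)) t).
  by rewrite [X in X `<=` _](ti _ tid); apply: (Jset_le eta0) => // B; exact: subset_closure.
have Jhit : Jset t `<=` hit (far (eta / 2)).
  move=> mu [h _]; apply: (@hitS _ x.1) => //; [by case: wf|exact: measurable_far| |].
    exact: subset_trans Bf far2.
  by apply: lt_le_trans h; rewrite lte_fin ltr0n.
have mti : measurable (Jset (Jmap (@interior (E R)) t)) by exact: measurable_Jset wfi.
have mtc : measurable (Jset (Jmap (@closure (E R)) t)) by exact: measurable_Jset wfc.
have ali : al (Jset (Jmap (@interior (E R)) t)) = al (Jset t).
  by apply/eqP; rewrite eq_le -[X in _ && (_ <= X)%E]null !le_measure// inE.
have alc : al (Jset (Jmap (@closure (E R)) t)) = al (Jset t) by rewrite null.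
have lo_lim : \int[al]_mu thresholds (lo n) t mu @[n --> \oo] --> fine (al (Jset t)).
  rewrite -ali -Rintegral_indic//.
  apply: (carried_cvg mhit (fin _ lal) clo) => mu.
  apply: (thresholds_cvg eta0) => // B mB BF.
  have BoF : B° `<=` far eta by exact: subset_trans (@interior_subset _ _) BF.
  exact: (@Mp_int_inner_cvg _ mu _ _ eta0 (@open_interior _ B) BoF).
have up_lim : \int[al]_mu thresholds (up n) t mu @[n --> \oo] --> fine (al (Jset t)).
  rewrite -alc -Rintegral_indic//.
  apply: (carried_cvg mhit (fin _ lal) cup) => mu.
  apply: (thresholds_cvg eta0) => // B mB BF.
  exact: (@Mp_int_outer_cvg _ mu _ _ eta0 (@closed_closure _ B) (cl _ BF)).
have cind : carried (hit (far (eta / 2))) 1 (\1_(Jset t) : Mp R -> R).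
  split=> // mu; rewrite mul1r ger0_norm// ?indicE//.
  by rewrite ler_nat; case: (boolP (mu \in Jset t)) => // /set_mem/Jhit/mem_set ->.
have lo_le (be : {measure set (Mp R) -> \bar R}) n : locfin be ->
    \int[be]_mu thresholds (lo n) t mu <= fine (be (Jset t)).
  move=> lb; rewrite -Rintegral_indic//; apply: le_Rintegral => //.
  - exact: (carried_integrable mhit (fin _ lb) (clo n)).
  - exact: (carried_integrable mhit (fin _ lb) cind).
  move=> mu _; apply: thresholds_le_indic wf _ => // B rB.
  rewrite mass_Rintegral; last by case: rB.
  apply: le_Rintegral => //; first exact: CK_integrable.
    by apply: indic_integrable; [case: rB|exact: Mp_fin].
  move=> e _; apply: le_trans (inner_le _ _ _) _.
  by apply: indic_subset; exact: interior_subset.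
have up_ge (be : {measure set (Mp R) -> \bar R}) n : locfin be ->
    fine (be (Jset t)) <= \int[be]_mu thresholds (up n) t mu.
  move=> lb; rewrite -Rintegral_indic//; apply: le_Rintegral => //.
  - exact: (carried_integrable mhit (fin _ lb) cind).
  - exact: (carried_integrable mhit (fin _ lb) (cup n)).
  move=> mu _; apply: thresholds_ge_indic wf _ => // B mB BF.
  rewrite mass_Rintegral//; have rB := far_rcborel eta0 mB BF.
  apply: le_Rintegral => //; [|exact: CK_integrable|].
    by apply: indic_integrable => //; exact: Mp_fin.
  move=> e _; apply: le_trans (outer_ge eta0 n _ (cl _ BF)).
  by apply: indic_subset; exact: subset_closure.
set p := fine (al (Jset t)) in lo_lim up_lim *.
apply/cvgrPdist_lt => eps eps0.
have p1 : p - eps < p by rewrite gtrBl.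
have p2 : p < p + eps by rewrite ltrDl.
have [a _ /(_ a (leqnn _)) /= ha] := cvgr_gt _ lo_lim _ p1.
have [b _ /(_ b (leqnn _)) /= hb] := cvgr_lt _ up_lim _ p2.
have l1 := cvgr_gt _ (@thresholds_laplace_cvg (lo a) x s k0) _ ha.
have l2 := cvgr_lt _ (@thresholds_laplace_cvg (up b) x s k0) _ hb.
near=> n.
have n1 : p - eps < \int[al_ n]_mu thresholds (lo a) t mu by near: n; exact: l1.
have n2 : \int[al_ n]_mu thresholds (up b) t mu < p + eps by near: n; exact: l2.
rewrite ltr_distlC; apply/andP; split.
  exact: lt_le_trans n1 (lo_le _ a (lal_ n)).
exact: le_lt_trans (up_ge _ b (lal_ n)) n2.
Unshelve. all: by end_near. Qed.

End hitting_convergence.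

(** * Generic radii and levels *)

Section countably_many_atoms.
Variable R : realType.
Implicit Types (mu : Mp R) (B : set (E R)).

(** The masses are the terms of a convergent series. *)
Lemma Mp_mass_disjoint_cvg0 mu B (A : nat -> set (E R)) : rcborel B ->
  (forall i, measurable (A i)) -> (forall i, A i `<=` B) -> trivIset setT A ->
  mass mu (A i) @[i --> \oo] --> 0.
Proof.
move=> rB mA AB tA; have [eta eta0 Bf] := rcborel_far rB.
have rA C : measurable C -> C `<=` B -> rcborel C.
  by move=> mC CB; apply: (far_rcborel eta0) => //; exact: subset_trans Bf.
have mU : measurable (\bigcup_i A i) by exact: bigcupT_measurable.
have rU : rcborel (\bigcup_i A i) by apply: rA => // e [i _ /AB].
have := @measure_semi_sigma_additive _ _ _ mu A mA tA mU.
rewrite -(mass_EFin mu rU) => h.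
have {h} : series (fun i => mass mu (A i)) n @[n --> \oo] --> mass mu (\bigcup_i A i).
  have <- : fine \o (fun n => \sum_(0 <= i < n) mu (A i))%E = series (fun i => mass mu (A i)).
    apply/funext => n /=; rewrite /series /= -[RHS]/(fine (_%:E)) -sumEFin; congr fine.
    by apply: eq_bigr => i _; rewrite mass_EFin//; exact: rA.
  exact: fine_cvg h.
by move=> /cvgP /cvg_series_cvg_0.
Qed.

(** Otherwise infinitely many [A t] are hit with mass above some [k.+1%:R^-1]. Along a sequence of
    them each [mu] eventually has mass below 1, that is 0, so the indicators of [hit (A t)] tend to
    0 under the indicator of [hit B], and dominated convergence contradicts the lower bound. *)
Lemma hit_disjoint_countable (al : {measure set (Mp R) -> \bar R}) B (A : R -> set (E R)) :
  locfin al -> rcborel B -> (forall t, measurable (A t)) -> (forall t, A t `<=` B) ->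
  (forall t u, t != u -> A t `&` A u = set0) ->
  countable [set t | al (hit (A t)) != 0%E].
Proof.
move=> lal rB mA AB dA; have [eta eta0 Bf] := rcborel_far rB; have [mB _] := rB.
have rA t : rcborel (A t).
  by apply: (far_rcborel eta0) => //; exact: subset_trans Bf.
have fin t : (al (hit (A t)) < +oo)%E by exact: lal.
pose D k : set R := [set t | k.+1%:R^-1 < fine (al (hit (A t)))].
have -> : [set t | al (hit (A t)) != 0%E] = \bigcup_k D k.
  apply/seteqP; split=> t /=; last first.
    by move=> [k _]; rewrite /D /=; apply: contraTneq => ->; rewrite -leNgt /=.
  move=> h; have : 0 < fine (al (hit (A t))).
    by rewrite fine_gt0// fin andbT lt0e h measure_ge0.
  by move=> /ltr_add_invr[k]; rewrite add0r; exists k.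
apply: bigcup_countable => // k _; apply: finite_set_countable.
apply: contrapT => /infiniteP/pcard_leP[g].
have tg : trivIset setT (A \o g).
  apply/trivIsetP => i j _ _ ij; apply: dA; apply: contra ij => /eqP gij.
  by apply/eqP; apply: (@inj _ _ _ g) => //; rewrite inE.
have mhB : measurable (hit B) by exact: measurable_hit.
have cind i : carried (hit B) 1 (\1_(hit (A (g i))) : Mp R -> R).
  split; first by apply: measurable_indic; exact: measurable_hit.
  move=> mu; rewrite mul1r ger0_norm//; apply: indic_subset; exact: hitS.
have c0 (mu : Mp R) : (\1_(hit (A (g i))) mu : R) @[i --> \oo] --> (0 : R).
  have := Mp_mass_disjoint_cvg0 mu rB (fun i => mA (g i)) (fun i => AB (g i)) tg.
  move=> h; have h1 := cvgr_lt _ h _ ltr01.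
  apply/cvgrPdist_lt => eps eps0.
  near=> i; have : mass mu ((A \o g) i) < 1 by near: i; exact: h1.
  have [m /= mE] := mass_nat mu (rA (g i)).
  rewrite mE -[1]/(1%:R) ltr_nat ltnS leqn0 => /eqP m0.
  rewrite indicE memNset ?subrr ?normr0// => /(hitE _ (rA _)).
  by rewrite mE m0 ltxx.
have := carried_cvg mhB (lal _ rB) cind c0.
rewrite (_ : \int[al]_x 0 = 0); last by rewrite Rintegral_cst// mul0r.
move=> /cvgr_lt /(_ k.+1%:R^-1); rewrite invr_gt0 ltr0Sn => /(_ isT)[i _ /(_ i (leqnn _))] /=.
rewrite Rintegral_indic; last exact: measurable_hit.
have : D k (g i) by apply: (@funS _ _ _ _ g).
by rewrite /D /= => h1 h2; have := lt_trans h1 h2; rewrite ltxx.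
Unshelve. all: by end_near. Qed.

Lemma countable_itv_avoid (D : set R) (a b : R) : a < b -> countable D ->
  exists2 t, a < t < b & ~ D t.
Proof.
move=> ab cD; apply: contrapT => h.
have sub : `]a, b[%classic `<=` D.
  move=> t /=; rewrite in_itv/= => tab; apply: contrapT => nD; apply: h.
  by exists t.
have : countable (`]a, b[%classic : set R) by apply: sub_countable cD; exact: subset_card_le.
move=> /countable_lebesgue_measure0; rewrite lebesgue_measure_itv/= lte_fin ab.
by move=> /eqP; rewrite -EFinB eqe subr_eq0 => /eqP ba; move: ab; rewrite ba ltxx.
Qed.

End countably_many_atoms.

Lemma indicIE (R : realType) T (A B : set T) x : \1_(A `&` B) x = \1_A x * \1_B x :> R.
Proof. by rewrite indicI. Qed.

(** * From counts back to Laplace functionals *)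

Section staircase.
Variable R : realType.

(** The sum counts the levels [s], [s + de], ... lying below [y]. The offset [s] is left free so
    that the levels can avoid a countable set of bad values. *)
Lemma staircase_approx (de s y : R) (d : nat) : 0 < s < de -> 0 <= y -> y <= s + d%:R * de ->
  `|y - de * \sum_(i < d) ((s + i%:R * de < y)%R)%:R| <= de.
Proof.
move=> /andP[s0 sd] y0.
have de0 : 0 < de by lra.
pose S d : R := \sum_(i < d) ((s + i%:R * de < y)%R)%:R.
have Sr n : S n.+1 = S n + ((s + n%:R * de < y)%R)%:R by rewrite /S big_ord_recr.
have S0 n : 0 <= S n by apply: sumr_ge0.
have SN n : S n <= n%:R.
  elim: n => [|n ih]; first by rewrite /S big_ord0.
  by rewrite Sr -natr1 lerD// lern1 leq_b1.
have Sfull n : s + n%:R * de < y -> S n.+1 = n.+1%:R.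
  elim: n => [|n ih] h; first by rewrite Sr /S big_ord0 h add0r.
  rewrite Sr h ih ?natr1//; apply: le_lt_trans h.
  by rewrite lerD2l ler_pM2r// ler_nat.
have lower n : y <= s + n%:R * de -> y - s <= de * S n.
  elim: n => [|n ih]; first by rewrite mul0r addr0 /S big_ord0 mulr0 subr_le0.
  move=> h; have [yn|yn] := leP y (s + n%:R * de).
    by apply: le_trans (ih yn) _; rewrite Sr ler_pM2l// lerDl.
  by rewrite (Sfull _ yn) lerBlDl mulrC.
have upper n : de * S n <= Num.max 0 (y - s + de).
  elim: n => [|n ih]; first by rewrite /S big_ord0 mulr0 le_max lexx.
  rewrite Sr; case: ltP => yn; last by rewrite addr0.
  rewrite le_max; apply/orP; right.
  apply: (@le_trans _ _ (de * n%:R + de)).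
    by rewrite mulrDr mulr1 lerD2r ler_pM2l.
  by rewrite lerD2r mulrC; lra.
move=> /lower; have := upper d; rewrite -/(S d) ler_norml; move: (S d) => z.
by rewrite le_max => /orP[] h1 h2; apply/andP; split; lra.
Qed.

Lemma expRN_lip (a b : R) : 0 <= a -> 0 <= b ->
  `|expR (- a) - expR (- b)| <= Num.min 1 `|a - b|.
Proof.
wlog ab : a b / a <= b.
  move=> h a0 b0; have [|/ltW] := leP a b; first by move=> ?; exact: h.
  by move=> ba; rewrite distrC [`|a - b|]distrC; exact: h.
move=> a0 b0; have h : expR (- b) <= expR (- a) by rewrite ler_expR lerN2.
rewrite ger0_norm ?subr_ge0// distrC ger0_norm ?subr_ge0// le_min; apply/andP; split.
  have : expR (- a) <= 1 by rewrite -expR0 ler_expR oppr_le0.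
  by have := expR_ge0 (- b); lra.
have -> : - b = - a + (a - b) by lra.
rewrite expRD.
have h1 := expR_ge1Dx (a - b).
have h2 : expR (- a) <= 1 by rewrite -expR0 ler_expR oppr_le0.
have h3 := expR_ge0 (- a).
nra.
Qed.

End staircase.

Section hitting_to_laplace.
Variable R : realType.
Implicit Types (mu : Mp R) (B : set (E R)) (s : seq (set (E R) * nat)) (G : Mp R -> R).
Variables (al_ : nat -> {measure set (Mp R) -> \bar R}) (al : {measure set (Mp R) -> \bar R}).
Hypotheses (lal_ : forall n, locfin (al_ n)) (lal : locfin al).
Variables (B0 : set (E R)) (good : set (E R) -> Prop).
Hypotheses (rB0 : rcborel B0) (good_rc : forall B, good B -> rcborel B).

Fixpoint Jgood s : Prop :=
  if s is x :: s' then [/\ good x.1, (0 < x.2)%N & Jgood s'] else True.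

Hypothesis Jcvg : forall s, Jgood s ->
  fine (al_ n (hit B0 `&` Jset s)) @[n --> \oo] --> fine (al (hit B0 `&` Jset s)).

Lemma measurable_Jgood s : Jgood s -> measurable (Jset s).
Proof.
elim: s => [|x s ih] /=; first by move=> _; exact: measurableT.
by move=> [/good_rc gx _ /ih ?]; apply: measurableI => //; exact: measurable_atleast.
Qed.

Let hit_integrable (be : {measure set (Mp R) -> \bar R}) s G : locfin be -> Jgood s ->
  measurable_fun setT G -> (exists C : R, forall mu, `|G mu| <= C) ->
  be.-integrable setT (EFin \o (fun mu => \1_(hit B0 `&` Jset s) mu * G mu)).
Proof.
move=> lb gs mG [C GC].
apply: (@carried_integrable _ _ _ _ (hit B0) _ _ C); [exact: measurable_hit|exact: lb|].
split.
  apply: measurable_funM => //; apply: measurable_indic; apply: measurableI.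
    exact: measurable_hit.
  exact: measurable_Jgood.
move=> mu; rewrite normrM mulrC; apply: ler_pM => //; rewrite ger0_norm//.
by apply: indic_subset => ? [].
Qed.

(** Testing against every [Jset s] makes the class stable under multiplication by the indicator of
    [atleast B k] with [B] good: the pair [(B, k)] is added to [s]. *)
Definition hit_cvg G := [/\ measurable_fun setT G, exists C : R, forall mu, `|G mu| <= C &
  forall s, Jgood s -> \int[al_ n]_mu (\1_(hit B0 `&` Jset s) mu * G mu) @[n --> \oo] -->
    \int[al]_mu (\1_(hit B0 `&` Jset s) mu * G mu)].

Lemma hit_cvg1 : hit_cvg (fun=> 1).
Proof.
split; first exact: measurable_cst.
  by exists 1 => mu; rewrite normr1.
move=> s gs; have mJ : measurable (hit B0 `&` Jset s).
  by apply: measurableI; [exact: measurable_hit|exact: measurable_Jgood].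
have E (be : {measure set (Mp R) -> \bar R}) :
    \int[be]_mu (\1_(hit B0 `&` Jset s) mu * 1) = fine (be (hit B0 `&` Jset s)).
  by rewrite -Rintegral_indic//; apply: eq_Rintegral => mu _; rewrite mulr1.
by rewrite E; under eq_fun do rewrite E; exact: Jcvg.
Qed.

Lemma hit_cvg_add G H c : hit_cvg G -> hit_cvg H -> hit_cvg (fun mu => G mu + c * H mu).
Proof.
move=> [mG [C GC] hG] [mH [D HD] hH]; split.
- by apply: measurable_funD => //; apply: measurable_funM => //; exact: measurable_cst.
- exists (C + `|c| * D) => mu; rewrite (le_trans (ler_normD _ _))// normrM lerD//.
  by rewrite ler_wpM2l.
move=> s gs.
have E (be : {measure set (Mp R) -> \bar R}) : locfin be ->
    \int[be]_mu (\1_(hit B0 `&` Jset s) mu * (G mu + c * H mu)) =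
    \int[be]_mu (\1_(hit B0 `&` Jset s) mu * G mu) +
    c * \int[be]_mu (\1_(hit B0 `&` Jset s) mu * H mu).
  move=> lb; have iG := hit_integrable lb gs mG (ex_intro _ C GC).
  have iH := hit_integrable lb gs mH (ex_intro _ D HD).
  rewrite -RintegralZl// -RintegralD//; last exact: (@integrableZl _ _ _ _ _ _ c _ iH).
  by apply: eq_Rintegral => mu _; ring.
rewrite E//; under eq_fun do rewrite E//.
by apply: cvgD; [exact: hG|apply: cvgM; [exact: cvg_cst|exact: hH]].
Qed.

Lemma hit_cvg_atleast B k G : good B -> (0 < k)%N -> hit_cvg G ->
  hit_cvg (fun mu => \1_(atleast B k) mu * G mu).
Proof.
move=> gB k0 [mG [C GC] hG]; have mB : measurable (atleast B k).
  by apply: measurable_atleast; exact: good_rc.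
split; first by apply: measurable_funM => //; exact: measurable_indic.
  exists C => mu; rewrite normrM; apply: le_trans (GC mu).
  apply: ler_piMl => //; rewrite ger0_norm//.
move=> s gs; have := hG ((B, k) :: s); rewrite /= => /(_ (And3 gB k0 gs)).
have E (be : {measure set (Mp R) -> \bar R}) :
    \int[be]_mu (\1_(hit B0 `&` Jset s) mu * (\1_(atleast B k) mu * G mu)) =
    \int[be]_mu (\1_(hit B0 `&` (atleast B k `&` Jset s)) mu * G mu).
  by apply: eq_Rintegral => mu _; rewrite !indicIE; ring.
move=> h; rewrite E; under eq_fun do rewrite E.
exact: h.
Qed.

Lemma hit_cvg_uniform G : measurable_fun setT G -> (forall eps : R, 0 < eps ->
  exists2 H, hit_cvg H & forall mu, `|G mu - H mu| <= eps) -> hit_cvg G.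
Proof.
move=> mG h.
have bG : exists C : R, forall mu, `|G mu| <= C.
  have [H [_ [C HC] _] GH] := h _ ltr01; exists (1 + C) => mu.
  have -> : G mu = (G mu - H mu) + H mu by rewrite subrK.
  by rewrite (le_trans (ler_normD _ _))// lerD.
split=> // s gs; have mJ : measurable (hit B0 `&` Jset s).
  by apply: measurableI; [exact: measurable_hit|exact: measurable_Jgood].
set J := hit B0 `&` Jset s in mJ *.
have JB0 : J `<=` hit B0 by move=> ? [].
pose p := fine (al J); have p0 : 0 <= p by apply: fine_ge0.
have p1 : 0 < p + 1 by rewrite ltr_wpDl.
apply: cvg_approx => eps eps0.
have e0 : 0 < eps / (p + 1) by rewrite divr_gt0.
have [H [mH bH hH] GH] := h _ e0.
exists (fun n => \int[al_ n]_mu (\1_J mu * H mu)), (\int[al]_mu (\1_J mu * H mu)).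
  exact: hH.
have bnd (be : {measure set (Mp R) -> \bar R}) : locfin be -> fine (be J) <= p + 1 ->
    `|\int[be]_mu (\1_J mu * G mu) - \int[be]_mu (\1_J mu * H mu)| <= eps.
  move=> lb bJ; have iG := hit_integrable lb gs mG bG.
  have iH := hit_integrable lb gs mH bH.
  have finJ : (be J < +oo)%E.
    by apply: le_lt_trans (lb _ rB0); apply: le_measure; rewrite ?inE//; exact: measurable_hit.
  have iJ := indic_integrable mJ finJ.
  rewrite -RintegralB//.
  apply: le_trans (le_normr_Rintegral _ _) _ => //; first exact: (integrableB _ iG iH).
  apply: (@le_trans _ _ (\int[be]_mu (eps / (p + 1) * \1_J mu))).
    apply: le_Rintegral => //.
    - by have := integrable_abse (integrableB measurableT iG iH); apply: eq_integrable.
    - exact: (@integrableZl _ _ _ _ _ _ _ _ iJ).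
    - move=> mu _; rewrite -mulrBr normrM mulrC.
      by apply: ler_pM => //; rewrite ger0_norm.
  rewrite RintegralZl// Rintegral_indic//.
  by rewrite mulrAC ler_pdivrMr// ler_pM2l.
split; last by apply: bnd => //; rewrite lerDl.
have cJ := Jcvg gs; rewrite -/J -/p in cJ.
near=> n; apply: bnd => //.
by near: n; apply: (cvgr_le p) => //; rewrite ltrDl.
Unshelve. all: by end_near. Qed.

Lemma measurable_exp_mass (de : R) B : rcborel B ->
  measurable_fun setT (fun mu => expR (- (de * mass mu B))).
Proof.
move=> rB; apply: measurableT_comp; first exact: measurable_expR.
apply: measurable_funN; apply: measurable_funM; first exact: measurable_cst.
exact: measurable_mass.
Qed.

(* Abel summation: [exp(- de * min(m, c))] is an affine combination of the
   indicators of [j <= m] for [1 <= j <= c]. *)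
Lemma hit_cvg_exp (de : R) B G : 0 < de -> good B -> hit_cvg G ->
  hit_cvg (fun mu => expR (- (de * mass mu B)) * G mu).
Proof.
move=> de0 gB hG; have rB := good_rc gB; have [mG [C GC] _] := hG.
have htrunc c : hit_cvg (fun mu => expR (- (de * Num.min (mass mu B) c%:R)) * G mu).
  elim: c => [|c ih].
    move: hG; congr hit_cvg; apply/funext => mu.
    by rewrite min_r ?fine_ge0// mulr0 oppr0 expR0 mul1r.
  have := hit_cvg_add (expR (- (de * c.+1%:R)) - expR (- (de * c%:R))) ih
    (hit_cvg_atleast gB (ltn0Sn c) hG).
  congr hit_cvg; apply/funext => mu; rewrite mulrA -mulrDl; congr (_ * _).
  have [m mE] := mass_nat mu rB.
  rewrite indic_atleast// mE threshold_nat; have [cm|mc] := ltnP c m.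
    by rewrite !min_r ?ler_nat// 1?ltnW// mulr1 addrCA subrr addr0.
  by rewrite mulr0 addr0 !min_l// ler_nat// leqW.
apply: hit_cvg_uniform.
  by apply: measurable_funM => //; exact: measurable_exp_mass.
move=> eps eps0.
have C0 : 0 <= C by apply: le_trans (GC 0).
have C1 : 0 < C + 1 by rewrite ltr_wpDl.
have e0 : 0 < eps / (C + 1) by rewrite divr_gt0.
have [c hc] : exists c : nat, expR (- (de * c%:R)) <= eps / (C + 1).
  have [c hc] := exists_slope (mulr_gt0 de0 e0); exists c.
  set q := eps / (C + 1) in e0 hc *.
  have h1 : 1 + de * c%:R <= expR (de * c%:R) by exact: expR_ge1Dx.
  have h2 : expR (- (de * c%:R)) * expR (de * c%:R) = 1 by rewrite -expRD addNr expR0.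
  rewrite mulrCA mulrA in hc.
  rewrite -(ler_pM2r (expR_gt0 (de * c%:R))) h2.
  move: (de * c%:R) h1 hc => z h1 hc.
  have : q * (1 + z) <= q * expR z by rewrite ler_pM2l.
  by rewrite mulrDr mulr1 [q * z]mulrC; lra.
exists (fun mu => expR (- (de * Num.min (mass mu B) c%:R)) * G mu) => // mu.
rewrite -mulrBl normrM.
apply: (@le_trans _ _ (eps / (C + 1) * C)); last first.
  by rewrite mulrAC ler_pdivrMr// ler_pM2l// lerDl.
apply: ler_pM => //; apply: le_trans hc.
have [mc|cm] := leP (mass mu B) c%:R; first by rewrite subrr normr0 expR_ge0.
rewrite distrC ger0_norm.
  by rewrite gerBl expR_ge0.
by rewrite subr_ge0 ler_expR lerN2 ler_pM2l// ltW.
Qed.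

Lemma hit_cvg_exp_sum (de : R) (bs : nat -> set (E R)) d : 0 < de ->
  (forall i, good (bs i)) ->
  hit_cvg (fun mu => expR (- (de * \sum_(i < d) mass mu (bs i)))).
Proof.
move=> de0 gb; elim: d => [|d ih].
  have := hit_cvg1; congr hit_cvg; apply/funext => mu.
  by rewrite big_ord0 mulr0 oppr0 expR0.
have := hit_cvg_exp de0 (gb d) ih; congr hit_cvg; apply/funext => mu.
by rewrite big_ord_recr/= mulrDr opprD expRD mulrC.
Qed.

Variables (C : R).
Hypothesis moment : \forall n \near \oo, (\int[al_ n]_mu mu B0 <= C%:E)%E.

(** Off [B0] both [f] and the staircase vanish, so the pointwise error [de] is integrated over [B0]
    only. *)
Lemma Mp_int_staircase mu (f : CKplus R) (de t : R) d : 0 < t < de -> (forall e, f e != 0 -> B0 e) ->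
  (forall e, f e <= t + d%:R * de) ->
  `|Mp_int mu f - de * \sum_(i < d) mass mu [set e | t + i%:R * de < f e]| <= de * mass mu B0.
Proof.
move=> /andP[t0 tde] fB0 fd; have de0 : 0 < de by lra.
have [eta eta0 Bf] := rcborel_far rB0; have [mB0 _] := rB0.
have iB0 := indic_integrable mB0 (Mp_fin mu rB0).
pose bs i : set (E R) := [set e | t + i%:R * de < f e].
have mbs i : measurable (bs i).
  by apply: open_measurable_E; apply: cont_open_gt; exact: CK_continuous.
have bsB i : bs i `<=` B0.
  move=> e; rewrite /bs /= => h; apply: fB0; rewrite gt_eqF//; apply: le_lt_trans h.
  by rewrite addr_ge0 ?mulr_ge0// ltW.
have ibs i : mu.-integrable setT (EFin \o (\1_(bs i) : E R -> R)).
  apply: indic_integrable => //; apply: Mp_fin; apply: (far_rcborel eta0) => //.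
  exact: subset_trans Bf.
pose g n e : R := \sum_(i < n) \1_(bs i) e.
have ig n : mu.-integrable setT (EFin \o g n) /\
    \int[mu]_e g n e = \sum_(i < n) mass mu (bs i).
  elim: n => [|n [ih1 ih2]].
    have -> : g 0%N = fun=> 0 by apply/funext => e; rewrite /g big_ord0.
    by rewrite big_ord0 Rintegral_cst// mul0r; split => //; exact: integrable0.
  have -> : g n.+1 = fun e => g n e + \1_(bs n) e.
    by apply/funext => e; rewrite /g big_ord_recr.
  split; first exact: (integrableD _ ih1 (ibs n)).
  by rewrite RintegralD// ih2 big_ord_recr/= -mass_Rintegral.
have [ig1 ig2] := ig d.
have igd := @integrableZl _ _ _ mu _ measurableT de _ ig1.
rewrite -ig2 -RintegralZl// -RintegralB//; [|exact: CK_integrable].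
have iN := integrableB measurableT (CK_integrable mu f) igd.
apply: le_trans (le_normr_Rintegral _ _) _ => //.
rewrite mass_Rintegral// -RintegralZl//; apply: le_Rintegral => //.
- by have := integrable_abse iN; apply: eq_integrable.
- exact: (@integrableZl _ _ _ _ _ _ de _ iB0).
- move=> e _; have gE : g d e = \sum_(i < d) ((t + i%:R * de < f e)%R)%:R.
    apply: eq_bigr => i _; rewrite indicE; congr (_%:R); congr nat_of_bool.
    by apply/idP/idP => [/set_mem|/mem_set].
  have [Be|nBe] := pselect (B0 e).
    rewrite gE indicE mem_set// mulr1; apply: staircase_approx => //.
      by rewrite t0 tde.
    exact: CK_ge0.
  have fe0 : f e = 0 by apply/eqP; apply: contrapT => /negP /fB0.
  rewrite fe0 /g big1 ?mulr0 ?subr0 ?normr0 ?mulr_ge0 ?(ltW de0)// => i _.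
  by rewrite indicE memNset// => /bsB.
Qed.

(** Replacing [f] by its staircase changes [1 - vf f] by at most [min(1, de * mu(B0))]. Under
    [al_ n] this is small by the moment bound. Under [al], where no moment bound is assumed, it is
    small by dominated convergence on [hit B0] as [de] tends to 0. *)
Lemma hit_laplace_cvg (f : CKplus R) (D : set R) : (forall e, f e != 0 -> B0 e) -> countable D ->
  (forall t, 0 < t -> ~ D t -> good [set e | t < f e]) ->
  \int[al_ n]_mu (1 - vf f mu) @[n --> \oo] --> \int[al]_mu (1 - vf f mu).
Proof.
move=> fB0 cD gD; apply: cvg_approx => eps eps0.
have mhB : measurable (hit B0) by exact: measurable_hit.
have mass0 mu := @not_hit_mass R B0 mu rB0.
pose C' := Num.max C 0; have C'0 : 0 <= C' by rewrite le_max lexx orbT.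
(* The error bound for the step [de = j.+1%:R^-1]; the minimum with 1 makes it dominated by the
   indicator of [hit B0]. *)
pose h (j : nat) mu : R := Num.min 1 (j.+1%:R^-1 * mass mu B0).
have h0 j mu : 0 <= h j mu.
  by rewrite /h le_min ler01 mulr_ge0 ?invr_ge0 ?fine_ge0.
have ch j : carried (hit B0) 1 (h j).
  split.
    apply: measurable_minr; first exact: measurable_cst.
    by apply: measurable_funM; [exact: measurable_cst|exact: measurable_mass].
  move=> mu; rewrite ger0_norm// mul1r indicE.
  have [_|/negP nh] := boolP (mu \in _); first by rewrite /h ge_min lexx.
  rewrite /h mass0 ?mulr0 ?ge_min ?lexx ?orbT// => hm.
  by apply: nh; rewrite inE.
have hlim : \int[al]_mu h j mu @[j --> \oo] --> \int[al]_mu (0 : R).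
  apply: (carried_cvg mhB (lal rB0) ch) => mu.
  apply: (@squeeze_cvgr _ _ _ _ (fun=> 0) (fun j => harmonic j * mass mu B0)).
  - by near=> j; rewrite h0/= /h ge_min lexx orbT.
  - exact: cvg_cst.
  - rewrite -[X in _ --> X](mul0r (mass mu B0)); apply: cvgM; last exact: cvg_cst.
    exact: cvg_harmonic.
rewrite Rintegral_cst// mul0r in hlim.
have dlim : harmonic j * C' @[j --> \oo] --> (0 : R).
  rewrite -[X in _ --> X](mul0r C'); apply: cvgM; last exact: cvg_cst.
  exact: cvg_harmonic.
have [j [/= hj dj]] := filter_ex (filterI (cvgr_lt _ hlim _ eps0) (cvgr_lt _ dlim _ eps0)).
set de : R := j.+1%:R^-1; have de0 : 0 < de by rewrite invr_gt0.
rewrite /harmonic /= -/de in dj.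
have [Cf Cf0 fC] := CK_bounded f.
pose d := (Num.truncn (Cf / de)).+1.
have Cd : Cf < d%:R * de by rewrite -ltr_pdivrMr//; exact: truncnS_gt.
(* The offset must keep every level [t + i%:R * de] out of [D], that is, avoid countably many
   translates of a countable set. *)
have [t t0 tD] : exists2 t, 0 < t < de & ~ (\bigcup_i [set t | D (t + i%:R * de)]) t.
  apply: countable_itv_avoid => //; apply: bigcup_countable => // i _.
  have -> : [set t | D (t + i%:R * de)] = (fun t => t - i%:R * de) @` D.
    apply/seteqP; split => [u Du|_ [u Du <-]] /=; last by rewrite subrK.
    by exists (u + i%:R * de) => //; rewrite addrK.
  exact: sub_countable (card_image_le _ _) cD.
have /andP[t00 tde] := t0.
pose bs i : set (E R) := [set e | t + i%:R * de < f e].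
have gbs i : good (bs i).
  apply: gD; first by rewrite ltr_pwDl// mulr_ge0// ltW.
  by move=> Di; apply: tD; exists i.
pose V mu := expR (- (de * \sum_(i < d) mass mu (bs i))).
have hV : hit_cvg (fun mu => 1 + (-1) * V mu).
  by apply: hit_cvg_add; [exact: hit_cvg1|exact: hit_cvg_exp_sum].
have [mV bV cV] := hV.
exists (fun n => \int[al_ n]_mu (\1_(hit B0 `&` Jset [::]) mu * (1 + (-1) * V mu))).
exists (\int[al]_mu (\1_(hit B0 `&` Jset [::]) mu * (1 + (-1) * V mu))).
  exact: cV.
have pt mu : `|1 - vf f mu - \1_(hit B0 `&` Jset [::]) mu * (1 + (-1) * V mu)| <= h j mu.
  have st : `|Mp_int mu f - de * \sum_(i < d) mass mu (bs i)| <= de * mass mu B0.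
    apply: Mp_int_staircase => // e; apply: le_trans (fC e) _.
    by rewrite (le_trans (ltW Cd))// lerDr ltW.
  rewrite /= setIT indicE; have [_|/negP nh] := boolP (mu \in _).
    have -> : 1 - vf f mu - true%:R * (1 + (-1) * V mu) = - (vf f mu - V mu) by rewrite /=; ring.
    rewrite normrN; apply: le_trans (expRN_lip _ _) _.
    - exact: Mp_int_ge0.
    - by rewrite mulr_ge0 ?(ltW de0)// sumr_ge0// => i _; rewrite fine_ge0.
    - by apply: le_min2.
  have m0 : mass mu B0 = 0 by apply: mass0 => hm; apply: nh; rewrite inE.
  have f0 : Mp_int mu f = 0.
    apply/eqP; rewrite eq_le Mp_int_ge0 andbT.
    have : de * \sum_(i < d) mass mu (bs i) <= 0.
      rewrite mulr_ge0_le0 ?(ltW de0)// big1// => i _.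
      have [eta eta0 Bf] := rcborel_far rB0; have [mB0 _] := rB0.
      apply/eqP; rewrite eq_le fine_ge0// andbT -m0; apply: fine_le.
      + by rewrite ge0_fin_numE//; apply: Mp_fin; exact: good_rc.
      + by rewrite ge0_fin_numE//; exact: Mp_fin.
      + apply: le_measure; rewrite ?inE//; first by have [] := good_rc (gbs i).
        move=> e /= h1; apply: fB0; rewrite gt_eqF//; apply: le_lt_trans h1.
        by rewrite addr_ge0 ?mulr_ge0// ltW.
    move: st; rewrite m0 mulr0 normr_le0 subr_eq0 => /eqP ->.
    exact.
  by rewrite mul0r subr0 /vf f0 oppr0 expR0 subrr normr0.
have bnd (be : {measure set (Mp R) -> \bar R}) : locfin be ->
    \int[be]_mu h j mu <= eps ->
    `|\int[be]_mu (1 - vf f mu) -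
      \int[be]_mu (\1_(hit B0 `&` Jset [::]) mu * (1 + (-1) * V mu))| <= eps.
  move=> lb hle; apply: le_trans hle.
  have i1 := one_sub_vf_integrable f lb.
  have i2 := @hit_integrable be [::] (fun mu => 1 + (-1) * V mu) lb I mV bV.
  rewrite -RintegralB//; have iN := integrableB measurableT i1 i2.
  apply: le_trans (le_normr_Rintegral _ _) _ => //.
  apply: le_Rintegral => //.
  - by have := integrable_abse iN; apply: eq_integrable.
  - exact: (carried_integrable mhB (lb _ rB0) (ch j)).
split; last by apply: bnd => //; exact: ltW.
near=> n; apply: bnd => //.
have mn : (\int[al_ n]_mu mu B0 <= C%:E)%E by near: n; exact: moment.
have ihj := carried_integrable mhB (lal_ n rB0) (ch j).
apply: le_trans (ltW dj); rewrite -lee_fin [leLHS]fineK; last exact: integrable_fin_num.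
apply: (@le_trans _ _ (\int[al_ n]_mu (de%:E * mu B0))%E).
  apply: ge0_le_integral => //.
  - by move=> mu _; rewrite lee_fin h0.
  - by apply/measurable_EFinP; have [] := ch j.
  - rewrite (_ : (fun mu : Mp R => (de%:E * mu B0)%E) = EFin \o (fun mu => de * mass mu B0)).
      apply/measurable_EFinP; apply: measurable_funM; first exact: measurable_cst.
      exact: measurable_mass.
    by apply/funext => mu /=; rewrite EFinM mass_EFin.
  - by move=> mu _; rewrite -mass_EFin// -EFinM lee_fin /h ge_min lexx orbT.
rewrite ge0_integralZl//.
- rewrite EFinM; apply: lee_wpmul2l; first by rewrite lee_fin ltW.
  by apply: le_trans mn _; rewrite lee_fin le_max lexx.
- rewrite (_ : (fun mu : Mp R => mu B0) = EFin \o (fun mu => mass mu B0)).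
    by apply/measurable_EFinP; exact: measurable_mass.
  by apply/funext => mu /=; rewrite mass_EFin.
- by rewrite lee_fin ltW.
Unshelve. all: by end_near. Qed.

End hitting_to_laplace.

(** * Canonical measures *)

Section laws_of_point_processes.
Context (R : realType) (d : measure_display) (Omega : measurableType d)
  (P : probability Omega R).
Implicit Types (F : Mp R -> R) (N : {RV P >-> Mp R}).

Lemma expectation_Rintegral (X : Omega -> R) : measurable_fun setT X ->
  (exists C : R, forall w, `|X w| <= C) -> ('E_P[X])%E = (\int[P]_w X w)%:E.
Proof.
move=> mX [C XC]; rewrite unlock fineK//; apply: integrable_fin_num => //.
apply: (@carried_integrable _ _ _ P setT _ _ C) => //.
  by rewrite (le_lt_trans (probability_le1 _ _))// ltry.
by split=> // w; rewrite indicT mulr1.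
Qed.

Lemma Rintegral_law N F : measurable_fun setT F -> (exists C : R, forall mu, `|F mu| <= C) ->
  \int[distribution P N]_mu F mu = \int[P]_w F (N w).
Proof.
move=> mF [C FC]; rewrite /Rintegral integral_distribution//.
  exact/measurable_EFinP.
apply: (@carried_integrable _ _ _ P setT _ _ C (F \o N)) => //.
  by rewrite (le_lt_trans (probability_le1 _ _))// ltry.
split; last by move=> w; rewrite indicT mulr1; exact: FC.
exact: measurableT_comp.
Qed.

Lemma law_locfin N : locfin (distribution P N).
Proof.
move=> B rB; rewrite (le_lt_trans (probability_le1 _ _)) ?ltry//.
exact: measurable_hit.
Qed.

End laws_of_point_processes.

Lemma probability_one_sub_vf (R : realType) (Q : probability (Mp R) R) f :
  \int[Q]_mu (1 - vf f mu) = 1 - \int[Q]_mu vf f mu.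
Proof.
have iv := vf_integrable Q f.
have ic : Q.-integrable setT (EFin \o (fun=> 1 : R)).
  exact: finite_measure_integrable_cst.
rewrite RintegralB// Rintegral_cst//; congr (_ - _); rewrite mul1r.
exact: (congr1 fine (probability_setT Q)).
Qed.

Section canonical_measures.
Context (R : realType) (d : measure_display) (Omega : measurableType d)
  (P : probability Omega R) (N : {RV P >-> Mp R}) (lambda : {measure set (Mp R) -> \bar R}).
Hypothesis hlambda : canonical_measure N lambda.

Lemma canonical_locfin : locfin lambda.
Proof. by move=> B rB; have [_ + _] := hlambda; exact. Qed.

(** The integral over the nonzero measures extends to all of [Mp R], the integrand being 0 at the
    null measure. Its finiteness turns the extended exponential into the real one. *)
Lemma canonical_laplace f :
  \int[distribution P N]_mu vf f mu = expR (- \int[lambda]_mu (1 - vf f mu)).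
Proof.
have [_ _ /(_ f)] := hlambda.
have vb mu := norm_vf_le1 f mu.
rewrite expectation_Rintegral; last first.
- by exists 1 => w; exact: vb.
- by apply: (measurableT_comp (measurable_vf f)); exact: measurable_funPT.
rewrite -(@Rintegral_law _ _ _ P N (vf f)); [|exact: measurable_vf|by exists 1].
have -> : (\int[lambda]_(mu in ~` [set 0%R]) (1 - expR (- Mp_int mu f))%:E)%E =
    (\int[lambda]_mu (1 - vf f mu)%:E)%E.
  rewrite [LHS]integral_mkcond; apply: eq_integral => mu _.
  rewrite patchE; case: ifPn => // h.
  have -> : mu = 0 by apply: contrapT => mu0; move: h; rewrite mem_set.
  by rewrite /vf Mp_int_zero oppr0 expR0 subrr.
have i1 := one_sub_vf_integrable f canonical_locfin.
rewrite -[X in expeR (- X)%E]fineK; last exact: integrable_fin_num.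
by rewrite -EFinN /= => h; apply: EFin_inj.
Qed.

(* On both sides of the Laplace formula let [f] decrease to the indicator of [K]. *)
Lemma canonical_null K : closed K -> (exists2 eta : R, 0 < eta & K `<=` far eta) ->
  P [set w | (0 < N w K)%E] = 0%E -> lambda (hit K) = 0%E.
Proof.
move=> cK [eta eta0 Kf] PK.
have mK : measurable K by exact: closed_measurable_E.
have rK := far_rcborel eta0 mK Kf.
have mhK : measurable (hit K) by exact: measurable_hit.
pose u mu : R := 1 - expR (- mass mu K).
have u0 mu : 0 <= u mu by rewrite subr_ge0 -expR0 ler_expR oppr_le0 fine_ge0.
have uhit mu : u mu <= \1_(hit K) mu.
  rewrite indicE; have [_|/negP nh] := boolP (mu \in _).
    by rewrite /u gerBl expR_ge0.
  suff -> : u mu = 0 by [].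
  rewrite /u; have -> : mass mu K = 0.
    by apply: not_hit_mass => // h; apply: nh; rewrite inE.
  by rewrite oppr0 expR0 subrr.
have mu_ : measurable_fun setT u.
  apply: measurable_funB; first exact: measurable_cst.
  apply: measurableT_comp; first exact: measurable_expR.
  by apply: measurable_funN; exact: measurable_mass.
have cu : carried (hit K) 1 u by split=> // mu; rewrite mul1r ger0_norm.
have ucvg (be : {measure set (Mp R) -> \bar R}) : locfin be ->
    \int[be]_mu (1 - vf (outer eta0 K n) mu) @[n --> \oo] --> \int[be]_mu u mu.
  move=> lb; have e20 : 0 < eta / 2 by rewrite divr_gt0.
  apply: (@carried_cvg _ _ _ be (hit (far (eta / 2))) _ _ 1).
  - by apply: measurable_hit; exact: rcborel_far_set.
  - by apply: lb; exact: rcborel_far_set.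
  - move=> n; split.
      by apply: measurable_funB; [exact: measurable_cst|exact: measurable_vf].
    move=> mu; rewrite mul1r ger0_norm ?subr_ge0 ?vf_le1// indicE.
    have [_|/negP nh] := boolP (mu \in _); first by rewrite gerBl vf_ge0.
    rewrite subr_le0 /vf; suff -> : Mp_int mu (outer eta0 K n) = 0 by rewrite oppr0 expR0.
    apply/eqP; rewrite eq_le Mp_int_ge0 andbT.
    have m0 : mass mu (far (eta / 2)) = 0.
      by apply: not_hit_mass; [exact: rcborel_far_set|move=> h; apply: nh; rewrite inE].
    rewrite -m0 mass_Rintegral; last exact: measurable_far.
    apply: le_Rintegral => //; first exact: CK_integrable.
      by apply: indic_integrable; [exact: measurable_far|exact: Mp_far_fin].
    move=> e _; have [_ /(_ e)] := outer_carried K eta0 n.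
    by rewrite mul1r; apply: le_trans; exact: ler_norm.
  - move=> mu; apply: cvgB; first exact: cvg_cst.
    apply: (@cvg_comp _ _ _ (fun n => Mp_int mu (outer eta0 K n)) (fun x => expR (- x))).
      exact: Mp_int_outer_cvg.
    exact: continuous_expRN.
have law0 : \int[distribution P N]_mu u mu = 0.
  apply/eqP; rewrite eq_le Rintegral_ge0// andbT.
  have -> : 0 = fine (distribution P N (hit K)) :> R by rewrite /distribution /pushforward /= PK.
  rewrite -Rintegral_indic//; apply: le_Rintegral => //.
    exact: (carried_integrable mhK (@law_locfin _ _ _ P N K rK) cu).
  by apply: indic_integrable => //; exact: law_locfin.
have lam0 : expR (- \int[lambda]_mu u mu) = 1.
  have h1 : 1 - \int[distribution P N]_mu (1 - vf (outer eta0 K n) mu) @[n --> \oo] --> (1 : R).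
    rewrite -[X in _ --> X]subr0 -law0; apply: cvgB; first exact: cvg_cst.
    by apply: ucvg; exact: law_locfin.
  have h2 : expR (- \int[lambda]_mu (1 - vf (outer eta0 K n) mu)) @[n --> \oo] -->
      expR (- \int[lambda]_mu u mu).
    apply: (@cvg_comp _ _ _ (fun n => \int[lambda]_mu (1 - vf (outer eta0 K n) mu))
      (fun x => expR (- x))); first by apply: ucvg; exact: canonical_locfin.
    exact: continuous_expRN.
  suff E : (fun n => expR (- \int[lambda]_mu (1 - vf (outer eta0 K n) mu))) =
      (fun n => 1 - \int[distribution P N]_mu (1 - vf (outer eta0 K n) mu)).
    by rewrite -(cvg_lim (@Rhausdorff R) h2) E (cvg_lim (@Rhausdorff R) h1).
  apply/funext => n; rewrite -canonical_laplace.
  by rewrite probability_one_sub_vf opprB addrCA subrr addr0.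
have lu0 : \int[lambda]_mu u mu = 0.
  by apply/eqP; rewrite -oppr_eq0; apply/eqP/expR_inj; rewrite lam0 expR0.
(* On [hit K] the mass is an integer, hence at least 1, so [u] is at least [1 - expR (- 1)]
   there. *)
have c0 : 0 < 1 - expR (- 1) :> R by rewrite subr_gt0 -[ltRHS]expR0 ltr_expR oppr_lt0.
have ih := indic_integrable mhK (canonical_locfin rK).
have : (1 - expR (- 1)) * fine (lambda (hit K)) <= 0.
  rewrite -lu0 -Rintegral_indic// -RintegralZl//; apply: le_Rintegral => //.
  - exact: (@integrableZl _ _ _ _ _ _ _ _ ih).
  - exact: (carried_integrable mhK (canonical_locfin rK) cu).
  - move=> mu _; rewrite indicE; have [/set_mem/(hitE _ rK) h|_] := boolP (mu \in _).
      rewrite mulr1 /u lerD2l lerN2 ler_expR lerN2; move: h.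
      by have [k ->] := mass_nat mu rK; rewrite ltr0n ler1n.
    by rewrite mulr0.
rewrite pmulr_rle0// => h.
have h0 : fine (lambda (hit K)) = 0 by apply/eqP; rewrite eq_le h fine_ge0.
apply/eqP; rewrite -[X in X == _]fineK ?h0//.
by rewrite ge0_fin_numE//; exact: canonical_locfin.
Qed.

End canonical_measures.

(** * Stationary arrays and blocks *)

Section sums_of_diracs.
Variable R : realType.

Lemma toE_val (x : R) : x != 0 -> (toE x : \bar R) = x%:E.
Proof. by move=> x0; rewrite /toE val_insubd eqe x0. Qed.

(** The map is continuous off 0. The junk value at 0 adds at most that one point to the preimage of
    an open set, which is therefore split into an open part and a subset of [[set 0]]. *)
Lemma measurable_toE : measurable_fun setT (@toE R).
Proof.
apply: (measurability (@open (E R))) => //.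
move=> _ [U oU <-]; rewrite setTI.
pose V : set R := [set x | x != 0 /\ U (toE x)].
have oV : open V.
  rewrite openE => x [x0 Ux]; have [eps eps0 hU] := (open_chartP U).1 oU _ Ux.
  have cc : {for x, continuous (fun y : R => contract y%:E)}.
    rewrite /continuous_at /=; apply: cvgM; first exact: cvg_id.
    apply: cvgV; first by rewrite gt_eqF// ltr_pwDl.
    by apply: cvgD; [exact: cvg_cst|apply: cvg_norm; exact: cvg_id].
  have n0 : \forall y \near x, y != 0.
    by apply: open_nbhs_nbhs; split => //; exact: open_neq.
  move/cvgrPdist_lt/(_ _ eps0) : cc => cc; rewrite /interior.
  near=> y; have y0 : y != 0 by near: y.
  split => //; apply: hU; rewrite /chart !toE_val//.
  by near: y.
have -> : @toE R @^-1` U = V `|` ([set 0] `&` [set x | U (toE x)]).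
  apply/seteqP; split=> x /=.
    by have [->|x0] := eqVneq x 0; [right|left].
  by move=> [[]|[]].
apply: measurableU; first exact: open_measurable.
have [h|h] := pselect (U (toE 0)).
  rewrite (_ : _ `&` _ = [set 0])//; apply/seteqP; split=> x /=; first by case.
  by move=> ->.
rewrite (_ : _ `&` _ = set0)//; apply/seteqP; split=> x //= [-> ]; exact: h.
Unshelve. all: by end_near. Qed.

(** [measurable_expcl] cannot simply be composed with [g], whose measurability is what this lemma
    serves to establish. *)
Lemma measurable_expcl_comp d (T : measurableType d) (g : T -> Mp R) (F : Mp R -> R) :
  (forall f, measurable_fun setT (fun w => Mp_int (g w) f)) -> expcl F ->
  measurable_fun setT (F \o g).
Proof.
move=> mg hF.
have /choice[s sF] : forall n : nat, exists s, forall mu, `|F mu - expsum s mu| <= n.+1%:R^-1.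
  by move=> n; apply: hF; rewrite invr_gt0.
apply: (@measurable_fun_cvg _ _ _ _ (fun n => expsum (s n) \o g)) => [n|w _].
  elim: (s n) => [|x t ih].
    by rewrite /expsum /comp; under eq_fun do rewrite big_nil; exact: measurable_cst.
  rewrite /expsum /comp; under eq_fun do rewrite big_cons.
  apply: measurable_funD => //; apply: measurable_funM => //.
  have mN : measurable_fun setT (fun w => - Mp_int (g w) x.2) by exact: measurable_funN.
  exact: (measurableT_comp (@measurable_expR R) mN).
apply/cvgrPdist_lt => eps /ltr_add_invr[k]; rewrite add0r => hk.
exists k => // n /= kn; apply: le_lt_trans (sF n (g w)) (le_lt_trans _ hk).
by rewrite lef_pV2 ?posrE// ler_nat ltnS.
Qed.

(** The vague Borel sets are generated by the maps [Mp_int^~ f]: an open set is the union of the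
    supports of the [testprod L] that it contains, and [L] ranges over a countable type. *)
Lemma measurable_to_Mp d (T : measurableType d) (g : T -> Mp R) :
  (forall f, measurable_fun setT (fun w => Mp_int (g w) f)) -> measurable_fun setT g.
Proof.
move=> mg; apply: (measurability (@open (Mp R))) => //.
move=> _ [U oU <-]; rewrite setTI.
pose D := [set L | forall nu : Mp R, testprod L nu != 0 -> U nu].
have -> : g @^-1` U = \bigcup_(L in D) [set w | testprod L (g w) != 0].
  apply/seteqP; split=> w /=; last by move=> [L DL]; exact: DL.
  move=> Ugw; have [L Lw LU] := exists_test oU Ugw; exists L => //=.
  by rewrite Lw oner_neq0.
rewrite bigcup_mkcond; apply: countable_bigcupT_measurable => [|L]; first exact: countableP.
case: ifPn => // _.
have mt := measurable_expcl_comp mg (expcl_testprod L).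
rewrite (_ : [set w | _] = (testprod L \o g) @^-1` [set~ 0]).
  by rewrite -[X in measurable X]setTI; apply: mt => //; exact: measurableC.
by apply/seteqP; split => w /= /eqP.
Qed.

End sums_of_diracs.

Section array_point_processes.
Variables (R : realType) (d : nat -> measure_display).
Variables (Omega : forall n, measurableType (d n)).
Variables (P : forall n, probability (Omega n) R).
Variable X : forall n, nat -> {RV (P n) >-> R}.

Lemma Mp_int_Nmn m n w f :
  Mp_int (Nmn X m w) f = \sum_(1 <= j < m.+1) f (toE (X n j w)).
Proof. by rewrite /Nmn Mp_int_sum; apply: eq_bigr => j _; rewrite Mp_int_dirac. Qed.

Lemma NmnE m n w B : measurable B ->
  Nmn X m w B = (\sum_(1 <= j < m.+1) (toE (X n j w) \in B))%:R%:E.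
Proof.
move=> mB; rewrite /Nmn Mp_sumE natr_sum -sumEFin; apply: eq_bigr => j _.
by rewrite Mp_diracE.
Qed.

Lemma measurable_toE_X n j : measurable_fun setT (fun w => toE (X n j w)).
Proof. by apply: (measurableT_comp (@measurable_toE R)); exact: measurable_funPT. Qed.

Lemma measurable_Nmn m n : measurable_fun setT (@Nmn R d Omega P X m n).
Proof.
apply: measurable_to_Mp => f; under eq_fun do rewrite Mp_int_Nmn.
apply: measurable_sum => j.
by apply: (measurableT_comp (measurable_CK f)); exact: measurable_toE_X.
Qed.

HB.instance Definition _ m n := isMeasurableFun.Build _ _ _ _
  (@Nmn R d Omega P X m n) (@measurable_Nmn m n).

Definition Nmn_RV m n : {RV (P n) >-> Mp R} := @Nmn R d Omega P X m n.

End array_point_processes.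

(** * Double limits towards [m0] *)

Section limits_to_m0.
Variable R : realType.
Implicit Types (u : nat -> \bar R).

Lemma limn_esup_lt u a : (limn_esup u < a)%E -> \forall n \near \oo, (u n < a)%E.
Proof.
rewrite /limn_esup /limf_esup => /ereal_inf_lt[_ [V fV <-] ha].
apply: filterS fV => n Vn; apply: le_lt_trans ha.
by apply: ereal_sup_ubound; exists n.
Qed.

Lemma limn_esup_le u a : (\forall n \near \oo, (u n <= a)%E) -> (limn_esup u <= a)%E.
Proof.
move=> h; rewrite /limn_esup /limf_esup.
apply: le_trans (_ : ereal_sup (u @` [set n | (u n <= a)%E]) <= _)%E.
  by apply: ereal_inf_lbound; exists [set n | (u n <= a)%E].
by apply: ge_ereal_sup => _ [n un <-].
Qed.

Lemma limn_esup_ge0 u : (forall n, (0 <= u n)%E) -> (0 <= limn_esup u)%E.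
Proof.
move=> u0; rewrite leNgt; apply/negP => /limn_esup_lt[n _ /(_ n (leqnn _))] /=.
by rewrite ltNge u0.
Qed.

Lemma cvge_0P u : (forall n, (0 <= u n)%E) ->
  u n @[n --> \oo] --> 0%E <-> forall eps : R, 0 < eps -> \forall n \near \oo, (u n <= eps%:E)%E.
Proof.
move=> u0; split=> [ucvg eps eps0|h].
  have ne : nbhs (0%E : \bar R) [set x | (x < eps%:E)%E].
    by apply: open_nbhs_nbhs; split; [exact: open_ereal_lt_ereal|rewrite /= lte_fin].
  have h : \forall n \near \oo, (u n < eps%:E)%E by exact: (ucvg _ ne).
  by apply: filterS h => n /ltW.
apply/fine_cvgP; split.
  apply: filterS (h _ ltr01) => n un; rewrite ge0_fin_numE//.
  by rewrite (le_lt_trans un)// ltry.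
apply/cvgrPdist_lt => eps eps0; have e20 : 0 < eps / 2 by rewrite divr_gt0.
apply: filterS (h _ e20) => n un; rewrite sub0r normrN /=.
rewrite ger0_norm ?fine_ge0//; apply: le_lt_trans (_ : eps / 2 < eps); last lra.
by rewrite -lee_fin fineK// ge0_fin_numE// (le_lt_trans un)// ltry.
Qed.

(** The sequence [b] does not depend on [m]. Its limit is therefore obtained from a single [m] at
    which both upper limits are small, and conversely it controls every [v m] up to [tau m]. *)
Lemma lim_to_m0_equiv (m0 : \bar R) (b : nat -> R) (v : nat -> nat -> R)
    (tau : nat -> nat -> R) (L : R) :
  (forall m n, 0 <= tau m n) ->
  lim_to_m0 m0 (fun m => limn_esup (fun n => (tau m n)%:E)) 0%E ->
  (forall m (de : R), 0 < de -> \forall n \near \oo, `|b n - v m n| <= tau m n + de) ->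
  b n @[n --> \oo] --> L <->
  lim_to_m0 m0 (fun m => limn_esup (fun n => `|v m n - L|%:E)) 0%E.
Proof.
move=> tau0 htau hbv.
have near1 m (eps : R) : 0 < eps -> b n @[n --> \oo] --> L ->
    (limn_esup (fun n => (tau m n)%:E) < eps%:E)%E ->
    (limn_esup (fun n => `|v m n - L|%:E) <= (3 * eps)%:E)%E.
  move=> eps0 bL ht; apply: limn_esup_le.
  move/cvgrPdist_lt/(_ _ eps0) in bL.
  apply: filterS (filterI bL (filterI (limn_esup_lt ht) (hbv m _ eps0))) => n [h1 [h2 h3]].
  rewrite lte_fin in h2; rewrite lee_fin.
  have -> : v m n - L = - ((b n - v m n) + (L - b n)) by ring.
  rewrite normrN (le_trans (ler_normD _ _))//; lra.
have near2 m (eps : R) : 0 < eps ->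
    (limn_esup (fun n => (tau m n)%:E) < eps%:E)%E ->
    (limn_esup (fun n => `|v m n - L|%:E) < eps%:E)%E ->
    \forall n \near \oo, `|L - b n| < 3 * eps.
  move=> eps0 ht hv.
  apply: filterS (filterI (limn_esup_lt hv) (filterI (limn_esup_lt ht) (hbv m _ eps0))).
  move=> n [h1 [h2 h3]]; rewrite lte_fin in h1; rewrite lte_fin in h2.
  have -> : L - b n = - ((b n - v m n) + (v m n - L)) by ring.
  rewrite normrN (le_lt_trans (ler_normD _ _))//; lra.
have tge m : (0 <= limn_esup (fun n => (tau m n)%:E))%E.
  by apply: limn_esup_ge0 => n; rewrite lee_fin.
have vge m : (0 <= limn_esup (fun n => `|v m n - L|%:E))%E.
  by apply: limn_esup_ge0 => n; rewrite lee_fin.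
have le_eps (x : \bar R) : (forall eps : R, 0 < eps -> (x <= eps%:E)%E) -> (x <= 0)%E.
  by move=> h; apply/lee_addgt0Pr => eps /h; rewrite add0e.
have lt_of_le (x : \bar R) (eps : R) : 0 < eps -> (x <= (eps / 2)%:E)%E -> (x < eps%:E)%E.
  by move=> e0 /le_lt_trans; apply; rewrite lte_fin; lra.
have [ht1 ht2] := htau; split=> [bL|[hv1 hv2]].
  split=> [m0oo|m0fin].
    have /(cvge_0P tge) tcvg := ht1 m0oo.
    apply/(cvge_0P vge) => eps eps0; have e60 : 0 < eps / 3 / 2 by rewrite !divr_gt0.
    apply: filterS (tcvg _ e60) => m /lt_of_le -/(_ ltac:(by rewrite divr_gt0)) h.
    have e30 : 0 < eps / 3 by rewrite divr_gt0.
    by have := near1 m _ e30 bL h; rewrite mulrC divfK.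
  have [m mE t0] := ht2 m0fin; exists m => //; apply/eqP; rewrite eq_le vge andbT.
  apply: le_eps => eps eps0; have e30 : 0 < eps / 3 by rewrite divr_gt0.
  have := near1 m _ e30 bL; rewrite t0 lte_fin e30 => /(_ isT).
  by rewrite mulrC divfK.
apply/cvgrPdist_lt => eps eps0; have e30 : 0 < eps / 3 by rewrite divr_gt0.
have e60 : 0 < eps / 3 / 2 by rewrite !divr_gt0.
have [m [tm vm]] : exists m, (limn_esup (fun n => (tau m n)%:E) < (eps / 3)%:E)%E /\
    (limn_esup (fun n => `|v m n - L|%:E) < (eps / 3)%:E)%E.
  have [m0oo|/eqP m0fin] := eqVneq m0 +oo%E.
    have /(cvge_0P tge)/(_ _ e60) tcvg := ht1 m0oo.
    have /(cvge_0P vge)/(_ _ e60) vcvg := hv1 m0oo.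
    have [m [/= h1 h2]] := filter_ex (filterI tcvg vcvg).
    by exists m; split; exact: lt_of_le.
  have [m mE t0] := ht2 m0fin; have [m' m'E v0] := hv2 m0fin; exists m.
  (* For finite [m0] the two hypotheses carry their own witnesses, which agree because both
     represent [m0]. *)
  have mm : m = m'.
    by move: mE; rewrite -m'E => -[/eqP]; rewrite eqr_nat => /eqP.
  by rewrite t0 mm v0 lte_fin e30.
by have := near2 m _ e30 tm vm; rewrite mulrC divfK.
Qed.

End limits_to_m0.

(** * Increments of block probabilities under stationarity *)

Section counts_in_blocks.
Variables (R : realType) (d : nat -> measure_display).
Variables (Omega : forall n, measurableType (d n)).
Variables (P : forall n, probability (Omega n) R).
Variable X : forall n, nat -> {RV (P n) >-> R}.
Hypothesis (hX0 : nonzero_array X) (hXst : stationary_rows X).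
Implicit Types (s : seq (set (E R) * nat)) (B : set (E R)).

(** The condition of [Jset] on bare counts, so that windows of entries starting at different places
    can be compared directly. *)
Fixpoint Jcount s (c : set (E R) -> nat) : Prop :=
  if s is x :: s' then (x.2 <= c x.1)%N /\ Jcount s' c else True.

Lemma Jcount_mono s c c' : (forall B, (c B <= c' B)%N) -> Jcount s c -> Jcount s c'.
Proof.
by move=> h; elim: s => //= x s ih [h1 /ih h2]; split => //; exact: leq_trans h1 _.
Qed.

Lemma Jcount_eq (eta : R) s c c' : Jwf eta s ->
  (forall B, measurable B -> B `<=` far eta -> c B = c' B) -> Jcount s c -> Jcount s c'.
Proof.
move=> + h; elim: s => //= x s ih [mB Bf _ /ih {}ih] [h1 /ih h2]; split => //.
by rewrite -h.
Qed.

Definition block_count n h m (w : Omega n) B : nat :=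
  \sum_(i < m) (toE (X n (h + i.+1)%N w) \in B).

Definition block_event s n h m : set (Omega n) := [set w | Jcount s (block_count h m w)].
Arguments block_event : clear implicits.

Lemma Jset_Nmn (eta : R) s n m (w : Omega n) : Jwf eta s ->
  Jset s (Nmn X m w) <-> Jcount s (block_count 0 m w).
Proof.
elim: s => //= x s ih [mB _ _ /ih ->].
rewrite /atleast /= NmnE// lee_fin ler_nat.
by rewrite /block_count big_add1 big_mkord.
Qed.

(** The family [Y] is arbitrary because two cases are needed: the entries on the sample space, and
    the coordinates of tuples, in terms of which stationarity is stated. *)
Lemma measurable_Jcount dT (T : measurableType dT) s m (Y : 'I_m -> T -> R) (eta : R) :
  Jwf eta s -> (forall i, measurable_fun setT (Y i)) ->
  measurable [set t | Jcount s (fun B => \sum_(i < m) (toE (Y i t) \in B))%N].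
Proof.
move=> + mY; elim: s => [|x s ih] /=; first by move=> _; exact: measurableT.
move=> [mB _ _ /ih {}ih].
rewrite (_ : [set t | _] = [set t | (x.2 <= \sum_(i < m) (toE (Y i t) \in x.1))%N] `&`
  [set t | Jcount s (fun B => \sum_(i < m) (toE (Y i t) \in B))%N])//.
apply: measurableI => //.
pose g (t : T) : R := \sum_(i < m) \1_(x.1) (toE (Y i t)).
have mg : measurable_fun setT g.
  have mi : measurable_fun setT (\1_(x.1) : E R -> R) by exact: measurable_indic.
  apply: measurable_sum => i.
  exact: (measurableT_comp mi (measurableT_comp (@measurable_toE R) (mY i))).
rewrite (_ : [set t | _] = g @^-1` `[x.2%:R, +oo[).
  by rewrite -[X in measurable X]setTI; apply: mg.
apply/seteqP; split=> t /=; rewrite in_itv/= andbT /g => h.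
  rewrite (eq_bigr (fun i => (toE (Y i t) \in x.1)%:R))//.
  by rewrite -natr_sum ler_nat.
move: h; rewrite (eq_bigr (fun i => (toE (Y i t) \in x.1)%:R))//.
by rewrite -natr_sum ler_nat.
Qed.

Lemma measurable_block_event (eta : R) s n h m : Jwf eta s -> measurable (block_event s n h m).
Proof.
move=> wf; apply: (@measurable_Jcount _ _ s m (fun i w => X n (h + i.+1)%N w) _ wf) => i.
exact: measurable_funPT.
Qed.

Lemma block_event_stationary (eta : R) s n h m : Jwf eta s -> (h + m <= n)%N ->
  P n (block_event s n h m) = P n (block_event s n 0 m).
Proof.
move=> wf hmn.
pose A : set (m.-tuple R) := [set t | Jcount s (fun B => \sum_(i < m) (toE (tnth t i) \in B))%N].
have mA : measurable A.
  apply: (@measurable_Jcount _ _ s m (fun i t => tnth t i) _ wf) => i.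
  exact: measurable_tnth.
have E g : (fun w => [tuple X n (g + i.+1)%N w | i < m]) @^-1` A = block_event s n g m.
  apply/seteqP; split=> w; rewrite /A /block_event /= /block_count.
    by apply: (Jcount_eq wf) => B _ _; apply: eq_bigr => i _; rewrite tnth_mktuple.
  by apply: (Jcount_eq wf) => B _ _; apply: eq_bigr => i _; rewrite tnth_mktuple.
by rewrite -!E; symmetry; exact: hXst.
Qed.

Lemma pair_stationary n h k (eps : R) : (h + k.+1 <= n)%N ->
  P n [set w | (eps < `|X n h.+1 w|)%R /\ (eps < `|X n (h + k.+1)%N w|)%R] =
  P n [set w | (eps < `|X n 1 w|)%R /\ (eps < `|X n k.+1 w|)%R].
Proof.
move=> hkn.
pose A : set (k.+1.-tuple R) := [set t | (eps < `|tnth t ord0|)%R /\ (eps < `|tnth t ord_max|)%R].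
have mt (i : 'I_k.+1) : measurable [set t : k.+1.-tuple R | (eps < `|tnth t i|)%R].
  have mn : measurable_fun setT (fun t : k.+1.-tuple R => `|tnth t i|).
    apply: measurableT_comp; first exact: normr_measurable.
    exact: measurable_tnth.
  rewrite (_ : [set t | _] = (fun t : k.+1.-tuple R => `|tnth t i|) @^-1` `]eps, +oo[).
    by rewrite -[X in measurable X]setTI; apply: mn.
  by apply/seteqP; split=> t /=; rewrite in_itv/= andbT.
have mA : measurable A by exact: measurableI (mt ord0) (mt ord_max).
have := hXst hkn mA.
rewrite (_ : _ @^-1` A = [set w | (eps < `|X n 1 w|)%R /\ (eps < `|X n k.+1 w|)%R]).
  move=> ->; congr (P n _); apply/seteqP; split=> w; rewrite /A /= !tnth_mktuple /= addn1//.
by apply/seteqP; split=> w; rewrite /A /= !tnth_mktuple.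
Qed.

(** [contract] sends [x] to [x / (1 + |x|)] and so does not increase the modulus. *)
Lemma toE_far (x eta : R) : x != 0 -> far eta (toE x) -> eta <= `|x|.
Proof.
move=> x0; rewrite /far /= /chart toE_val//= => /le_trans; apply.
rewrite normrM ler_piMr// normfV ger0_norm ?addr_ge0// invf_le1 ?ltr_pwDl//.
by rewrite lerDl.
Qed.

Lemma block_countS n h m (w : Omega n) B :
  block_count h m.+1 w B = (block_count h m w B + (toE (X n (h + m.+1)%N w) \in B))%N.
Proof. by rewrite /block_count big_ord_recr. Qed.

Lemma block_count_cat n h m (w : Omega n) B :
  block_count 0 (h + m) w B = (block_count 0 h w B + block_count h m w B)%N.
Proof.
rewrite /block_count big_split_ord/=; congr addn.
by apply: eq_bigr => i _; rewrite !add0n addnS.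
Qed.

Lemma toE_notin (eta : R) n j (w : Omega n) B : 0 < eta -> (1 <= j <= n)%N -> B `<=` far eta ->
  `|X n j w| <= eta / 2 -> (toE (X n j w) \in B) = false.
Proof.
move=> eta0 jn Bf h; apply/negbTE/negP => /set_mem/Bf/(toE_far (hX0 jn w)).
lra.
Qed.

Variables (eta : R) (s : seq (set (E R) * nat)).
Hypotheses (eta0 : 0 < eta) (wf : Jwf eta s).

(** An entry falling in a set of [s] has modulus at least [eta]; halving makes it a strict
    exceedance, as counted in (AN) and (AC). *)
Let eps := eta / 2.
Let q n m : R := fine (P n (block_event s n 0 m)).
Let a n : R := fine (P n [set w | (eps < `|X n 1 w|)%R]).
Let c n l : R := fine (P n [set w | (eps < `|X n 1 w|)%R /\ (eps < `|X n l w|)%R]).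

Let Pfin n (A : set (Omega n)) : measurable A -> P n A \is a fin_num.
Proof. by move=> mA; exact: fin_num_measure. Qed.

Lemma measurable_exceed n j (x : R) : measurable [set w | (x < `|X n j w|)%R].
Proof.
have mn : measurable_fun setT (fun w => `|X n j w|).
  by apply: measurableT_comp; [exact: normr_measurable|exact: measurable_funPT].
rewrite (_ : [set w | _] = (fun w => `|X n j w|) @^-1` `]x, +oo[).
  by rewrite -[X in measurable X]setTI; apply: mn.
by apply/seteqP; split=> t /=; rewrite in_itv/= andbT.
Qed.

Lemma exceed_stationary n j : (1 <= j <= n)%N ->
  P n [set w | (eps < `|X n j w|)%R] = P n [set w | (eps < `|X n 1 w|)%R].
Proof.
case: j => // j /andP[_ jn].
have := @pair_stationary n j 0 eps; rewrite addn1 => /(_ jn).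
have E (A : set (Omega n)) : [set w | A w /\ A w] = A by apply/seteqP; split=> w // -[].
by rewrite (E [set w | eps < `|X n j.+1 w|]) (E [set w | eps < `|X n 1 w|]).
Qed.

Let block_eventS n h m : block_event s n h m `<=` block_event s n h m.+1.
Proof.
by move=> w; apply: Jcount_mono => B; rewrite block_countS leq_addr.
Qed.

(** The window starting after [h] fulfils the condition exactly when its last entry, of index
    [h + m.+1], is added; that entry must then be an exceedance. *)
Let incr_event n h m := block_event s n h m.+1 `\` block_event s n h m.
Arguments incr_event : clear implicits.

Let m_incr n h m : measurable (incr_event n h m).
Proof. by apply: measurableD; exact: measurable_block_event wf. Qed.

Lemma incr_eventE n h m : (h + m.+1 <= n)%N ->
  fine (P n (incr_event n h m)) = q n m.+1 - q n m.
Proof.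
move=> hmn; have mb l g := @measurable_block_event _ _ n g l wf.
rewrite /incr_event measureD//; last by rewrite (le_lt_trans (probability_le1 _ _)) ?ltry.
rewrite (setIidr (@block_eventS n h m)) fineB ?Pfin//.
rewrite /q; congr (fine _ - fine _); first exact: (block_event_stationary wf hmn).
by apply: (block_event_stationary wf); apply: leq_trans hmn; rewrite leq_add2l.
Qed.

Lemma incr_event_exceed n h m : (h + m.+1 <= n)%N ->
  incr_event n h m `<=` [set w | (eps < `|X n (h + m.+1)%N w|)%R].
Proof.
move=> hmn w [h1 h2] /=; rewrite ltNge; apply/negP => le; apply: h2.
apply: (Jcount_eq wf) h1 => B mB Bf; rewrite block_countS.
by rewrite (toE_notin eta0 _ Bf le) ?addn0// hmn addnS.
Qed.

Lemma q_incr_bound n m : (m < n)%N -> 0 <= q n m.+1 - q n m <= a n.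
Proof.
move=> mn; rewrite -(@incr_eventE n 0 m)//; apply/andP; split; first exact: fine_ge0.
have me j := measurable_exceed n j eps.
rewrite /a -(exceed_stationary (j := m.+1))//; apply: fine_le; rewrite ?Pfin//.
by apply: le_measure; rewrite ?inE//; apply: (@incr_event_exceed n 0 m).
Qed.

Let bad n (h m i : nat) : set (Omega n) :=
  [set w | (eps < `|X n i.+1 w|)%R /\ (eps < `|X n (h + m.+1)%N w|)%R].

Arguments bad : clear implicits.

Lemma small_prefix n h m (w : Omega n) : (h + m.+1 <= n)%N ->
  (eps < `|X n (h + m.+1)%N w|)%R -> ~ (\big[setU/set0]_(i < h) bad n h m i) w ->
  forall l, (l <= m.+1)%N ->
    (block_event s n 0 (h + l) w <-> block_event s n h l w).
Proof.
move=> hmn ej nbad l lm.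
have zero B : B `<=` far eta -> block_count 0 h w B = 0%N.
  move=> Bf; rewrite /block_count big1// => i _; rewrite add0n.
  rewrite (toE_notin eta0 _ Bf)//.
    rewrite /= (leq_trans (ltn_ord i))// (leq_trans _ hmn)// leq_addr//.
  rewrite leNgt; apply/negP => ei; apply: nbad.
  by rewrite -(bigcup_mkord h (bad n h m)); exists i => //=.
split; apply: (Jcount_eq wf) => B mB Bf; by rewrite block_count_cat zero// add0n.
Qed.

(** The long and the short window end at the same entry, and their increment events differ only if
    that entry and one of the first [h] both exceed [eps], hence lie at least [m.+1] apart.
    Stationarity moves each such pair to start at index 1. *)
Lemma incr_diff n h m : (h + m.+1 <= n)%N ->
  `|(q n (h + m).+1 - q n (h + m)) - (q n m.+1 - q n m)| <= \sum_(i < h) c n (m.+2 + i).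
Proof.
move=> hmn.
pose U := \big[setU/set0]_(i < h) bad n h m i.
have mbad i : measurable (bad n h m i) by apply: measurableI; exact: measurable_exceed.
have mU : measurable U by apply: bigsetU_measurable => i _.
have PU : fine (P n U) <= \sum_(i < h) c n (m.+2 + i).
  (* The pair of indices [i.+1] and [h + m.+1] has the law of the pair [1] and [m.+2 + (h - i.+1)],
     hence the reversal of the summation index. *)
  rewrite (reindex_inj rev_ord_inj)/=.
  have -> : \sum_(i < h) c n (m.+2 + (h - i.+1)) = \sum_(i < h) fine (P n (bad n h m i)).
    apply: eq_bigr => i _; rewrite /c /bad.
    have ih := ltn_ord i.
    have -> : (h + m.+1 = i + (m.+1 + (h - i.+1)).+1)%N by lia.
    congr fine; symmetry; apply: pair_stationary; lia.
  rewrite -lee_fin -sumEFin fineK ?Pfin//.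
  apply: le_trans (_ : \sum_(i < h) P n (bad n h m i) <= _)%E.
    exact: Boole_inequality.
  by apply: lee_sum => i _; rewrite fineK ?Pfin.
have key (A A' : set (Omega n)) : measurable A -> measurable A' -> A `<=` A' `|` U ->
    fine (P n A) <= fine (P n A') + fine (P n U).
  move=> mA mA' AU; rewrite -lee_fin EFinD !fineK ?Pfin//.
  apply: le_trans (measureU2 _ mA' mU); apply: le_measure; rewrite ?inE//.
  exact: measurableU.
rewrite -(@incr_eventE n 0 (h + m)); last by rewrite add0n -addnS.
rewrite -(@incr_eventE n h m)//.
have s1 : incr_event n 0 (h + m) `<=` incr_event n h m `|` U.
  move=> w wi; have [|nU] := pselect (U w); first by right.
  have ej := @incr_event_exceed n 0 (h + m) _ w wi.
  rewrite add0n -addnS in ej; have {}ej := ej hmn.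
  left; move: wi => [w1 w2]; split.
    by apply/(small_prefix hmn ej nU (leqnn _)); rewrite addnS.
  by move=> /(small_prefix hmn ej nU (leqnSn _)).
have s2 : incr_event n h m `<=` incr_event n 0 (h + m) `|` U.
  move=> w wi; have [|nU] := pselect (U w); first by right.
  have ej := incr_event_exceed hmn wi.
  left; move: wi => [w1 w2]; split.
    by move/(small_prefix hmn ej nU (leqnn _)) : w1; rewrite addnS.
  by move=> /(small_prefix hmn ej nU (leqnSn _)).
have k1 := key _ _ (m_incr n 0 (h + m)) (m_incr n h m) s1.
have k2 := key _ _ (m_incr n h m) (m_incr n 0 (h + m)) s2.
by rewrite ler_norml; apply/andP; split; lra.
Qed.

Let q0 n : (0 < size s)%N -> q n 0 = 0.
Proof.
rewrite /q; case: s wf => // x t [_ _ k0 _] _.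
rewrite (_ : block_event _ _ _ _ = set0) ?measure0//.
apply/seteqP; split=> // w; rewrite /block_event /= => -[+ _].
by rewrite /block_count big_ord0 leqNgt k0.
Qed.

Let a0 n : 0 <= a n. Proof. exact: fine_ge0. Qed.
Let c0 n l : 0 <= c n l. Proof. exact: fine_ge0. Qed.

(** The probability for [r] entries is the sum of [r] increments. Each of the first [M] differs from
    the increment at [M] by at most [a n], as both lie between 0 and [a n]; each later one differs
    by at most the tail sum, by [incr_diff]. *)
Lemma block_telescope n r M : (0 < size s)%N -> (r <= n)%N -> (M <= n)%N ->
  `|q n r - r%:R * (q n M - q n M.-1)| <=
    M%:R * a n + r%:R * \sum_(M.+1 <= l < r.+1) c n l.
Proof.
move=> s0 rn Mn; set u := q n M - q n M.-1; set T := \sum_(M.+1 <= l < r.+1) c n l.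
have T0 : 0 <= T by apply: sumr_ge0.
have -> : q n r - r%:R * u = \sum_(j < r) (q n j.+1 - q n j - u).
  have tele k : q n k = \sum_(j < k) (q n j.+1 - q n j).
    elim: k => [|j ih]; first by rewrite big_ord0 q0.
    by rewrite big_ord_recr/= -ih; ring.
  by rewrite sumrB -tele sumr_const card_ord mulr_natl.
apply: le_trans (ler_norm_sum _ _ _) _.
have bound (j : 'I_r) : `|q n j.+1 - q n j - u| <= (j < M)%:R * a n + T.
  have jn : (j < n)%N by apply: leq_trans rn.
  have [jM|Mj] := ltnP j M.
    rewrite mul1r; apply: (@le_trans _ _ (a n)); last by rewrite lerDl.
    have := q_incr_bound jn; case: M Mn jM @u {T T0} => // m mn _ u.
    have := q_incr_bound mn; rewrite -/u => /andP[? ?] /andP[? ?].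
    by rewrite ler_norml; apply/andP; split; lra.
  rewrite mul0r add0r; case: M Mn Mj @u @T {T0} => [|m] Mn Mj u T.
    (* For [M = 0] the reference increment is 0 since [0.-1 = 0], and the bound [a n] is [c n 1],
       the first term of the tail sum. *)
    have /andP[h1 h2] := q_incr_bound jn.
    have -> : u = 0 by rewrite /u subrr.
    rewrite subr0 ger0_norm// (le_trans h2)// /T big_ltn; last first.
      by rewrite ltnS (leq_ltn_trans _ (ltn_ord j)).
    apply: (@le_trans _ _ (c n 1)); last by rewrite lerDl sumr_ge0.
    by rewrite /c (_ : [set w | _ /\ _] = [set w | eps < `|X n 1 w|])//; apply/seteqP; split=> w // -[].
  have hj : (j = (j - m) + m :> nat)%N by rewrite subnK// ltnW.
  rewrite [in X in X <= _]hj; apply: le_trans (incr_diff _) _.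
    by rewrite addnS -hj.
  rewrite -(big_mkord xpredT (fun i => c n (m.+2 + i)%N)).
  have -> : \sum_(0 <= i < j - m) c n (m.+2 + i)%N = \sum_(m.+2 <= l < m.+2 + (j - m)) c n l.
    symmetry; rewrite -{1}[m.+2]add0n big_addn addKn.
    by apply: eq_bigr => i _; rewrite addnC.
  rewrite /T [leRHS](@big_cat_nat _ _ _ (m.+2 + (j - m))%N)/=.
  - by rewrite lerDl sumr_ge0.
  - exact: leq_addr.
  - by have := ltn_ord j; lia.
apply: le_trans (ler_sum _ (fun j _ => bound j)) _.
rewrite big_split/= sumr_const card_ord -mulr_suml -[T *+ r]mulr_natl lerD2r.
apply: ler_wpM2r => //; rewrite -natr_sum ler_nat.
have -> : (\sum_(j < r) (j < M) = minn r M)%N; last exact: geq_minr.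
by elim: (r) => [|k ih]; rewrite ?big_ord0 ?big_ord_recr/= ?ih; lia.
Qed.

End counts_in_blocks.

Section block_limit.
Variables (R : realType) (d : nat -> measure_display).
Variables (Omega : forall n, measurableType (d n)).
Variables (P : forall n, probability (Omega n) R).
Variable X : forall n, nat -> {RV (P n) >-> R}.
Hypothesis (hX0 : nonzero_array X) (hXst : stationary_rows X).
Variable r : nat -> nat.
Hypotheses (hAN : cond_AN X) (hAC : cond_AC X r).
Hypothesis kcvg : (n %/ r n)%N @[n --> \oo] --> \oo.
Implicit Type s : seq (set (E R) * nat).

Definition block_prob s n m : R := fine (P n [set w | Jset s (Nmn X m w)]).

Lemma exceed_bounded (x : R) : 0 < x -> exists2 C : R, 0 < C &
  \forall n \near \oo, n%:R * fine (P n [set w | (x < `|X n 1 w|)%R]) <= C.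
Proof.
move=> x0; have [a] : exists a : R,
    (limn_esup (fun n => n%:R%:E * P n [set w | (x < `|X n 1 w|)%R]) < a%:E)%E.
  have := hAN x0; case: (limn_esup _) => [l||] // _.
  - by exists (l + 1); rewrite lte_fin ltrDl.
  - by exists 0; exact: ltNyr.
move/limn_esup_lt => h; exists (`|a| + 1); first by rewrite ltr_wpDl.
apply: filterS h => n; rewrite -(@fineK _ (P n _)); last first.
  by apply: fin_num_measure; exact: measurable_exceed.
rewrite -EFinM lte_fin => /ltW/le_trans; apply.
by rewrite (le_trans (ler_norm a))// lerDl.
Qed.

Lemma cvg_nat_near (u : nat -> nat) (C : R) : u n @[n --> \oo] --> \oo ->
  \forall n \near \oo, C <= (u n)%:R.
Proof.
move=> ucvg; have h : \forall n \near \oo, (Num.truncn `|C| < u n)%N.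
  by apply: (ucvg [set m | (Num.truncn `|C| < m)%N]); exists (Num.truncn `|C|).+1.
apply: filterS h => n h; apply: le_trans (ler_norm C) _; apply: ltW.
apply: lt_le_trans (truncnS_gt _) _.
by rewrite ler_nat.
Qed.

Let tail (eps : R) m n : R := n%:R * \sum_(m.+1 <= j < (r n).+1)
  fine (P n [set w | (eps < `|X n 1 w|)%R /\ (eps < `|X n j w|)%R]).

Let tailE eps m n : cluster_tail X r eps m n = (tail eps m n)%:E.
Proof.
rewrite /cluster_tail /tail EFinM -sumEFin; congr (_ * _)%E.
apply: eq_bigr => j _; rewrite fineK//; apply: fin_num_measure.
by apply: measurableI; exact: measurable_exceed.
Qed.

Let tail_ge0 eps m n : 0 <= tail eps m n.
Proof. by apply: mulr_ge0 => //; apply: sumr_ge0 => j _; exact: fine_ge0. Qed.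

(** Multiply [block_telescope] by [k_n = n %/ r n]. As [k_n * r n <= n], the tail sum becomes the
    quantity of (AC), and with [C] the bound from (AN) the first [m] increments cost at most
    [m * C / r n]. Replacing [k_n * r n] by [n] costs at most [r n * a <= C / k_n], where [a] is the
    exceedance probability of one entry. The thresholds for [r n] and [k_n] make each of these two
    errors at most [de / 2]. *)
Lemma block_asymptotics (eta : R) s m (de : R) : 0 < eta -> Jwf eta s -> (0 < size s)%N ->
  0 < de -> \forall n \near \oo,
  `|(n %/ r n)%:R * block_prob s n (r n) -
    n%:R * (block_prob s n m - block_prob s n m.-1)| <= tail (eta / 2) m n + de.
Proof.
move=> eta0 wf s0 de0; have e20 : 0 < eta / 2 by rewrite divr_gt0.
have [C C0 hC] := exceed_bounded e20.
have [_ rcvg _] := hAC.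
have nr := cvg_nat_near (m%:R * C * 2 / de + 1) rcvg.
have nk := cvg_nat_near (C * 2 / de + 1) kcvg.
near=> n.
have hn : n%:R * fine (P n [set w | (eta / 2 < `|X n 1 w|)%R]) <= C by near: n; exact: hC.
have hr : m%:R * C * 2 / de + 1 <= (r n)%:R by near: n; exact: nr.
have hk : C * 2 / de + 1 <= (n %/ r n)%:R by near: n; exact: nk.
have mn : (m <= n)%N by near: n; exists m.
have n0 : (0 < n)%N by near: n; exists 1%N.
have r0 : (0 : R) < (r n)%:R.
  by apply: lt_le_trans hr; rewrite ltr_wpDl// !mulr_ge0// ?invr_ge0 ltW.
have k0 : (0 : R) < (n %/ r n)%:R.
  by apply: lt_le_trans hk; rewrite ltr_wpDl// !mulr_ge0// ?invr_ge0 ltW.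
have rn : (r n <= n)%N.
  by move: (k0); rewrite ltr0n divn_gt0// -(ltr0n R).
have := @block_telescope R d Omega P X hX0 hXst eta s eta0 wf n (r n) m s0 rn mn.
have E l : block_event X s 0 l = [set w : Omega n | Jset s (Nmn X l w)].
  by apply/seteqP; split=> w; case: (Jset_Nmn X l w wf).
rewrite !E -!/(block_prob s n _).
have {mn} uP : `|block_prob s n m - block_prob s n m.-1| <=
    fine (P n [set w | (eta / 2 < `|X n 1 w|)%R]).
  move: (m) mn => [|l] ln; first by rewrite subrr normr0 fine_ge0.
  have := @q_incr_bound R d Omega P X hX0 hXst eta s eta0 wf n l ln.
  by rewrite !E => /andP[? ?]; rewrite ger0_norm.
rewrite /tail; move: uP hn.
set a := fine _; set u := _ - block_prob _ _ _; set q := block_prob _ _ _.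
set T := \sum_(_ <= _ < _) _.
have T0 : 0 <= T by apply: sumr_ge0 => j _; exact: fine_ge0.
have a0 : 0 <= a by exact: fine_ge0.
move=> uP hn hD.
have /(congr1 (fun x => x%:R : R)) := divn_eq n (r n).
rewrite natrD natrM.
have : (n %% r n)%:R <= (r n)%:R :> R by rewrite ler_nat ltnW// ltn_mod -(ltr0n R).
have : 0 <= (n %% r n)%:R :> R by [].
move: hn hr hk r0 k0 hD; set nn := n%:R; set rr := (r n)%:R; set k := (n %/ r n)%:R.
set z := (n %% r n)%:R; set M := m%:R.
move=> hn hr hk r0 k0 hD z0 zr nE.
have M0 : 0 <= M by [].
have -> : k * q - nn * u = k * (q - rr * u) - z * u by rewrite nE; ring.
apply: le_trans (ler_normB _ _) _; rewrite !normrM (ger0_norm (ltW k0)) (ger0_norm z0).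
have kra : k * rr * a <= C.
  by apply: le_trans hn; rewrite ler_wpM2r// nE lerDl.
have h1 : k * `|q - rr * u| <= k * (M * a) + nn * T.
  apply: le_trans (ler_wpM2l (ltW k0) hD) _.
  by rewrite mulrDr lerD2l mulrA ler_wpM2r// nE lerDl.
have h2 : z * `|u| <= rr * a by apply: ler_pM.
have h3 : k * (M * a) <= de / 2.
  rewrite -(ler_pM2r r0); apply: (@le_trans _ _ (M * C)).
    by rewrite (_ : _ * rr = M * (k * rr * a)); [exact: ler_wpM2l|ring].
  have := ler_wpM2l (ltW de0) hr; rewrite mulrDr mulr1.
  rewrite (_ : de * (M * C * 2 / de) = M * C * 2); last by field; rewrite gt_eqF.
  lra.
have h4 : rr * a <= de / 2.
  rewrite -(ler_pM2r k0); apply: (@le_trans _ _ C).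
    by rewrite (_ : _ * k = k * rr * a)//; ring.
  have := ler_wpM2l (ltW de0) hk; rewrite mulrDr mulr1.
  rewrite (_ : de * (C * 2 / de) = C * 2); last by field; rewrite gt_eqF.
  lra.
lra.
Unshelve. all: by end_near.
Qed.

Lemma block_limit (eta : R) s (L : R) : 0 < eta -> Jwf eta s -> (0 < size s)%N ->
  (n %/ r n)%:R * block_prob s n (r n) @[n --> \oo] --> L <->
  lim_to_m0 (m0 X r) (fun m => limn_esup (fun n =>
    `|n%:R * (block_prob s n m - block_prob s n m.-1) - L|%:E)) 0%E.
Proof.
move=> eta0 wf s0; have e20 : 0 < eta / 2 by rewrite divr_gt0.
apply: (lim_to_m0_equiv (tau := tail (eta / 2))) => [//||m de de0].
  have [_ _ /(_ _ e20)] := hAC.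
  rewrite (_ : (fun m => limn_esup _) = (fun m => limn_esup (fun n => (tail (eta / 2) m n)%:E)))//.
  by apply/funext => m; congr limn_esup; apply/funext => n; rewrite tailE.
exact: block_asymptotics.
Qed.

End block_limit.

(** * The limit of the block laws *)

Section power_limit.
Variable R : realType.

Lemma divr_nat_cvg0 (k : nat -> nat) (b : nat -> R) (q : R) :
  k n @[n --> \oo] --> \oo -> b n @[n --> \oo] --> q ->
  (k n)%:R^-1 * b n @[n --> \oo] --> 0.
Proof.
move=> kcvg bq.
have kV : (k n)%:R^-1 @[n --> \oo] --> (0 : R).
  apply/cvgrPdist_le => e e0.
  have := cvg_nat_near (e^-1) kcvg; apply: filterS => n h.
  have k0 : 0 < (k n)%:R :> R by apply: lt_le_trans h; rewrite invr_gt0.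
  rewrite sub0r normrN ger0_norm ?invr_ge0//.
  by rewrite -[leRHS]invrK lef_pV2// posrE invr_gt0.
by rewrite -(mul0r q); exact: cvgM.
Qed.

(** With [b = - k * ln a] the power is [expR (- b)], and [1 + t <= expR t] gives
    [a * b <= k * (1 - a) <= b]. Either convergence forces [a] to tend to 1, so the outer terms have
    the same limit. *)
Lemma power_cvgP (k : nat -> nat) (a : nat -> R) (q : R) :
  k n @[n --> \oo] --> \oo -> (forall n, 0 < a n <= 1) ->
  a n ^+ k n @[n --> \oo] --> expR (- q) <->
  (k n)%:R * (1 - a n) @[n --> \oo] --> q.
Proof.
move=> kcvg a01; have a0 n : 0 < a n by have /andP[] := a01 n.
pose b n := (k n)%:R * - ln (a n).
have aE n : a n = expR (ln (a n)) by rewrite lnK// posrE.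
have aXE n : a n ^+ k n = expR (- b n).
  by rewrite /b mulrN opprK mulrC expRM_natr -aE.
have b_le n : (k n)%:R * (1 - a n) <= b n.
  apply: ler_wpM2l => //; have := expR_ge1Dx (ln (a n)); rewrite -aE; lra.
have b_ge n : a n * b n <= (k n)%:R * (1 - a n).
  rewrite /b mulrCA; apply: ler_wpM2l => //.
  have := expR_ge1Dx (- ln (a n)); rewrite expRN -aE => h.
  have := ler_wpM2l (ltW (a0 n)) h; rewrite mulfV ?gt_eqF//; lra.
(* From [k * (1 - a) <= u] with [u] convergent follows [1 - u / k <= a <= 1]. *)
have step u : u n @[n --> \oo] --> q -> (\forall n \near \oo, 0 < (k n)%:R :> R) ->
    (forall n, 0 <= u n) ->
    (forall n, (k n)%:R * (1 - a n) <= u n) -> a n @[n --> \oo] --> (1 : R).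
  move=> uq k0 u0 hu.
  have h : 1 - (k n)%:R^-1 * u n @[n --> \oo] --> (1 : R).
    by rewrite -[X in _ --> X]subr0; apply: cvgB; [exact: cvg_cst|exact: (divr_nat_cvg0 kcvg uq)].
  apply: (@squeeze_cvgr _ \oo _ R _ (fun=> 1) a _ 1 h); last exact: cvg_cst.
  apply: filterS k0 => n kn; have /andP[_ ->] := a01 n; rewrite andbT.
  by rewrite lerBlDl -lerBlDr mulrC ler_pdivlMr// mulrC.
have k0 : \forall n \near \oo, 0 < (k n)%:R :> R.
  by have := cvg_nat_near (1 : R) kcvg; apply: filterS => n; exact: lt_le_trans.
have bE : a n ^+ k n @[n --> \oo] --> expR (- q) <-> b n @[n --> \oo] --> q.
  have -> : (fun n => a n ^+ k n) = (fun n => expR (- b n)) by apply/funext => n; exact: aXE.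
  split=> h; last by apply: (cvg_comp _ _ (cvgN h)); exact: continuous_expR.
  have : - ln (expR (- b n)) @[n --> \oo] --> - ln (expR (- q)).
    apply: cvgN; apply: (cvg_comp _ _ h); apply: continuous_ln; exact: expR_gt0.
  by rewrite expRK opprK; under eq_fun do rewrite expRK opprK.
rewrite bE; split=> h.
- have ac : a n @[n --> \oo] --> (1 : R).
    apply: (step _ h k0) => // n; apply: le_trans (b_le n).
    by apply: mulr_ge0 => //; rewrite subr_ge0; have /andP[] := a01 n.
  have ab : a n * b n @[n --> \oo] --> q by rewrite -(mul1r q); exact: cvgM.
  by apply: (@squeeze_cvgr _ \oo _ R _ _ _ _ _ ab h); near=> n; rewrite b_ge b_le.
- have ac : a n @[n --> \oo] --> (1 : R).
    apply: (step _ h k0) => // n.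
    by apply: mulr_ge0 => //; rewrite subr_ge0; have /andP[] := a01 n.
  have aV : (a n)^-1 @[n --> \oo] --> (1 : R).
    by rewrite -[X in _ --> X]invr1; apply: cvgV => //; exact: oner_neq0.
  have ab : (a n)^-1 * ((k n)%:R * (1 - a n)) @[n --> \oo] --> q.
    by rewrite -(mul1r q); exact: cvgM.
  apply: (@squeeze_cvgr _ \oo _ R _ _ _ _ _ h ab); near=> n; rewrite b_le/=.
  by rewrite mulrC ler_pdivlMr// mulrC b_ge.
Unshelve. all: by end_near.
Qed.

End power_limit.

Section outside_sets.
Variable R : realType.
Implicit Types (x y : R) (e : E R) (B : set (E R)).

Lemma contract_gt0 x : 0 < x -> 0 < contract x%:E.
Proof. by move=> x0; rewrite -[ltLHS](@contract0 R) lt_contract lte_fin. Qed.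

Lemma chart_outside x e : 0 < x -> outside x e <-> contract x%:E < `|chart e|.
Proof.
move=> x0; change (((e < (- x)%:E)%E \/ (x%:E < e)%E) <-> contract x%:E < `|chart e|).
rewrite EFinN -lt_contract contractN.
rewrite -[(x%:E < _)%E]lt_contract ltr_normr -/(chart e).
by split=> [[h|h]|/orP[h|h]]; [apply/orP; right; lra|apply/orP; left|right|left; lra].
Qed.

Lemma open_outside x : 0 < x -> open (outside x : set (E R)).
Proof.
move=> x0; rewrite (_ : outside x = [set e | contract x%:E < `|chart e|]).
  by apply: cont_open_gt; apply: cont_norm; exact: chart_cont.
by apply/seteqP; split=> e /(chart_outside e x0).
Qed.

Lemma measurable_outside x : 0 < x -> measurable (outside x : set (E R)).
Proof. by move=> x0; apply: open_measurable_E; exact: open_outside. Qed.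

Lemma outside_far x : 0 < x -> outside x `<=` far (contract x%:E).
Proof. by move=> x0 e /(chart_outside e x0)/ltW. Qed.

Lemma rcborel_outside x : 0 < x -> rcborel (outside x : set (E R)).
Proof.
move=> x0; apply: (far_rcborel (contract_gt0 x0) (measurable_outside x0)).
exact: outside_far.
Qed.

Definition sphere x : set (E R) := [set e | `|chart e| = contract x%:E].

Lemma closed_sphere x : closed (sphere x).
Proof.
rewrite (_ : sphere x = (fun e => `|chart e|) @^-1` [set contract x%:E])//.
have /continuous_closedP h := cont_norm (@chart_cont R).
by apply: h; exact: closed_eq.
Qed.

Lemma measurable_sphere x : measurable (sphere x).
Proof. by apply: closed_measurable_E; exact: closed_sphere. Qed.

Lemma sphere_far x : sphere x `<=` far (contract x%:E).
Proof. by move=> e; rewrite /sphere /far /= => ->. Qed.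

Lemma rcborel_sphere x : 0 < x -> rcborel (sphere x).
Proof.
move=> x0; apply: (far_rcborel (contract_gt0 x0) (measurable_sphere x)).
exact: sphere_far.
Qed.

Lemma boundary_outside x : 0 < x -> boundary (outside x) `<=` sphere x.
Proof.
move=> x0 e [ce ie]; have oo := open_outside x0.
have {ie}nx : ~ outside x e by move=> h; apply: ie; rewrite (interior_id _).1.
have le : contract x%:E <= `|chart e|.
  move: ce; rewrite closureE => /(_ (far (contract x%:E))); apply.
  by split; [exact: closed_far|exact: outside_far].
apply/eqP; rewrite eq_le le andbT leNgt; apply/negP => h.
by apply: nx; apply/chart_outside.
Qed.

Lemma sphereE x : 0 < x -> sphere x = [set toE x] `|` [set toE (- x)].
Proof.
move=> x0; have xn : x != 0 by rewrite gt_eqF.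
have c0 := contract_gt0 x0.
apply/seteqP; split=> e.
  change (`|chart e| = contract x%:E -> ([set toE x] `|` [set toE (- x)]) e) => h.
  have /orP[/eqP h'|/eqP h'] : (chart e == contract x%:E) || (chart e == - contract x%:E).
    by move/eqP: h; rewrite eqr_norml => /andP[].
    by left; apply: val_inj; rewrite /= toE_val//; exact: contract_inj.
  right; apply: val_inj; rewrite /= toE_val ?oppr_eq0//; apply: contract_inj.
  by rewrite EFinN contractN.
have cc : `|contract x%:E| = contract x%:E by rewrite ger0_norm// ltW.
change (([set toE x] `|` [set toE (- x)]) e -> `|chart e| = contract x%:E) => -[] ->.
  by rewrite /chart toE_val.
by rewrite /chart toE_val ?oppr_eq0// EFinN contractN normrN.
Qed.

Lemma toE_outside x y : y != 0 -> outside x (toE y) <-> x < `|y|.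
Proof.
move=> y0; change (((toE y < (- x)%:E)%E \/ (x%:E < toE y)%E) <-> x < `|y|).
rewrite toE_val// !lte_fin ltr_normr.
by split=> [[h|h]|/orP[h|h]]; [apply/orP; right; lra|apply/orP; left|right|left; lra].
Qed.

Lemma outsideS x y : x <= y -> outside y `<=` (outside x : set (E R)).
Proof.
move=> xy e [h|h]; [left|right]; last by apply: le_lt_trans h; rewrite lee_fin.
by apply: lt_le_trans h _; rewrite lee_fin lerN2.
Qed.

Lemma infptsE : infpts R = \bigcap_n outside (n.+1%:R : R).
Proof.
apply/seteqP; split=> e.
  by move=> [h|h] n _; rewrite /outside /= h; [left; exact: ltNyr|right; exact: ltry].
case: e => -[y| |] y0 /= h; [exfalso|by right|by left].
have := h (Num.truncn `|y|) I; rewrite /outside /= !lte_fin.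
have := truncnS_gt `|y|; rewrite ltr_norml => /andP[h1 h2].
by rewrite !ltNge !ltW// => -[].
Qed.

End outside_sets.

(** Strict positivity of the block transforms is what allows logarithms in [power_cvgP]. A positive
    function with zero integral would make the whole space null. *)
Lemma probability_vf_gt0 (R : realType) (Q : probability (Mp R) R) f :
  0 < \int[Q]_mu vf f mu.
Proof.
rewrite lt_neqAle Rintegral_ge0 ?andbT; last by move=> mu _; exact: vf_ge0.
apply/eqP => h0.
have mv : measurable_fun setT (EFin \o vf f) by apply/measurable_EFinP; exact: measurable_vf.
have iv := vf_integrable Q f.
have : (\int[Q]_(mu in setT) `|(EFin \o vf f) mu|)%E = 0%E.
  rewrite (eq_integral (EFin \o vf f)); last by move=> mu _; rewrite gee0_abs// lee_fin vf_ge0.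
  by rewrite -[LHS]fineK ?integrable_fin_num//; rewrite -/(Rintegral Q setT (vf f)) -h0.
move/(ae_eq_integral_abs Q measurableT mv) => [A [mA A0 sub]].
have : (Q setT <= Q A)%E.
  apply: le_measure; rewrite ?inE// => mu _; apply: sub => /= /(_ I) [] /eqP.
  by rewrite gt_eqF// expR_gt0.
by rewrite A0 (probability_setT Q) leNgt lte01.
Qed.

Section block_laws.
Variables (R : realType) (d : nat -> measure_display).
Variables (Omega : forall n, measurableType (d n)).
Variables (P : forall n, probability (Omega n) R).
Variable X : forall n, nat -> {RV (P n) >-> R}.
Variable r : nat -> nat.
Implicit Type s : seq (set (E R) * nat).

(* On average a row of length [n] contains [n %/ r n] blocks of length [r n]. *)
Definition block_law n : {measure set (Mp R) -> \bar R} :=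
  mscale ((n %/ r n)%:R : R)%:nng (distribution (P n) (Nmn_RV X (r n) n)).

Lemma block_lawE n A :
  block_law n A = ((n %/ r n)%:R%:E * P n [set w | A (Nmn X (r n) w)])%E.
Proof. by []. Qed.

Lemma block_law_locfin n : locfin (block_law n).
Proof.
move=> B rB; rewrite block_lawE; apply: lte_mul_pinfty => //.
exact: (@law_locfin _ _ _ (P n) (Nmn_RV X (r n) n) B rB).
Qed.

Definition block_laplace n f : R :=
  \int[distribution (P n) (Nmn_RV X (r n) n)]_mu vf f mu.

Lemma block_law_laplace n f :
  \int[block_law n]_mu (1 - vf f mu) = (n %/ r n)%:R * (1 - block_laplace n f).
Proof.
rewrite -probability_one_sub_vf /Rintegral ge0_integral_mscale//=; last 2 first.
- apply/measurable_EFinP.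
  by apply: measurable_funB; [exact: measurable_cst|exact: measurable_vf].
- by move=> mu _; rewrite lee_fin subr_ge0 vf_le1.
rewrite fineM//; apply: integrable_fin_num => //.
by apply: one_sub_vf_integrable; exact: law_locfin.
Qed.

Lemma block_laplaceE n f : block_laplace n f = \int[P n]_w vf f (Nmn X (r n) w).
Proof.
apply: (@Rintegral_law _ _ _ (P n) (Nmn_RV X (r n) n) (vf f)); first exact: measurable_vf.
by exists 1 => mu; exact: norm_vf_le1.
Qed.

Lemma block_laplace_gt0 n f : 0 < block_laplace n f.
Proof. exact: (probability_vf_gt0 (distribution (P n) (Nmn_RV X (r n) n)) f). Qed.

Lemma block_laplace_le1 n f : block_laplace n f <= 1.
Proof.
rewrite -subr_ge0 -probability_one_sub_vf; apply: Rintegral_ge0 => mu _.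
by rewrite subr_ge0 vf_le1.
Qed.

Hypotheses (hX0 : nonzero_array X) (hXst : stationary_rows X) (hAN : cond_AN X).
Hypothesis kcvg : (n %/ r n)%N @[n --> \oo] --> \oo.

(** By stationarity a block has on average [r n] times the exceedance probability of one entry as
    its number of points in [outside x]; the factor [n %/ r n] brings this below the quantity
    bounded by (AN). *)
Lemma block_law_moment (x : R) : 0 < x -> exists C : R,
  \forall n \near \oo, (\int[block_law n]_mu mu (outside x) <= C%:E)%E.
Proof.
move=> x0; have [C C0 hC] := exceed_bounded hAN x0; exists C.
have nk := cvg_nat_near 1 kcvg.
have rO := rcborel_outside x0; have mO := measurable_outside x0.
near=> n.
have hn : n%:R * fine (P n [set w | (x < `|X n 1 w|)%R]) <= C by near: n; exact: hC.
have k0 : 1 <= (n %/ r n)%:R :> R by near: n; exact: nk.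
have rn : (r n <= n)%N.
  move: k0; rewrite ler1n; case: (r n) => [|k]; first by rewrite divn0.
  by rewrite divn_gt0.
have mmass : measurable_fun setT (fun mu : Mp R => mu (outside x)).
  rewrite (_ : (fun mu : Mp R => _) = (fun mu : Mp R => (mass mu (outside x))%:E)).
    by apply/measurable_EFinP; apply: measurable_mass.
  by apply/funext => mu; rewrite mass_EFin.
rewrite ge0_integral_mscale//= ge0_integral_distribution//=.
have -> : (\int[P n]_w Nmn X (r n) w (outside x) =
    (r n)%:R%:E * P n [set w | (x < `|X n 1 w|)%R])%E.
  have mj j : measurable [set w | (x < `|X n j w|)%R] by exact: measurable_exceed.
  transitivity (\int[P n]_w \sum_(1 <= j < (r n).+1)
      (\1_[set w | (x < `|X n j w|)%R] w : R)%:E)%E.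
    apply: eq_integral => w _; rewrite NmnE// natr_sum -sumEFin.
    rewrite big_nat [RHS]big_nat; apply: eq_bigr => j /andP[j1 jr].
    have Xn0 : X n j w != 0 by apply: hX0; rewrite j1/= (leq_trans _ rn).
    rewrite indicE; congr (_%:R%:E); congr nat_of_bool.
    apply/idP/idP => /set_mem h; apply/mem_set.
      by apply/(toE_outside x Xn0).
    by move/(toE_outside x Xn0) : h.
  rewrite ge0_integral_sum//; last first.
    by move=> j; apply/measurable_EFinP; exact: measurable_indic.
  under eq_bigr do rewrite integral_indic// setIT.
  rewrite big_nat (eq_bigr (fun=> P n [set w | (x < `|X n 1 w|)%R])).
    rewrite -big_nat -[P n _]fineK; last by apply: fin_num_measure.
    by rewrite sumEFin sumr_const_nat subn1 -EFinM mulr_natl.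
  move=> j /andP[j1 jr].
  (* That lemma is stated at half of its parameter, hence [x * 2]. *)
  have := @exceed_stationary R d Omega P X hXst (x * 2) n j.
  by rewrite mulfK//; apply; rewrite j1 (leq_trans _ rn).
rewrite -[P n _]fineK; last by apply: fin_num_measure; exact: measurable_exceed.
rewrite -!EFinM lee_fin; apply: le_trans hn; rewrite mulrA ler_wpM2r//.
  exact: fine_ge0.
by rewrite -natrM ler_nat leq_divM.
Unshelve. all: by end_near.
Qed.

End block_laws.

Section laplace_equivalence.
Variables (R : realType) (d : nat -> measure_display).
Variables (Omega : forall n, measurableType (d n)).
Variables (P : forall n, probability (Omega n) R).
Variable X : forall n, nat -> {RV (P n) >-> R}.
Variable r : nat -> nat.
Hypothesis hAD1 : cond_AD1 X r.
Context (d0 : measure_display) (Omega0 : measurableType d0)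
  (P0 : probability Omega0 R) (N : {RV P0 >-> Mp R}) (lambda : {measure set (Mp R) -> \bar R}).
Hypothesis hlambda : canonical_measure N lambda.

Let continuous_vf f : continuous (vf f : Mp R -> R).
Proof.
apply: (@cont_comp _ (Mp R) (fun mu => Mp_int mu f) (fun x => expR (- x))).
  exact: continuous_expRN.
exact: Mp_int_continuous.
Qed.

Let row_laplace n f : R := \int[distribution (P n) (Nmn_RV X n n)]_mu vf f mu.

Let row_block_cvg f : `|row_laplace n f - block_laplace X r n f ^+ (n %/ r n)| @[n --> \oo] --> 0.
Proof.
have [_ _ _ /(_ f)] := hAD1.
have eE m n : ('E_(P n)[fun w => expR (- \sum_(1 <= j < m.+1) f (toE (X n j w)))])%E =
    (\int[P n]_w vf f (Nmn X m w))%:E.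
  have -> : (fun w => expR (- \sum_(1 <= j < m.+1) f (toE (X n j w)))) = vf f \o @Nmn _ _ _ _ X m n.
    by apply/funext => w /=; rewrite /vf Mp_int_Nmn.
  rewrite expectation_Rintegral//; last by exists 1 => w; exact: norm_vf_le1.
  by apply: (measurableT_comp (measurable_vf f)); exact: measurable_Nmn.
have E n : (`| 'E_(P n)[fun w => expR (- \sum_(1 <= j < n.+1) f (toE (X n j w)))]
  - 'E_(P n)[fun w => expR (- \sum_(1 <= j < (r n).+1) f (toE (X n j w)))] ^+ (n %/ r n) |)%E =
  `|row_laplace n f - block_laplace X r n f ^+ (n %/ r n)|%:E.
  rewrite !eE -EFin_expe -EFinB block_laplaceE /row_laplace.
  rewrite (@Rintegral_law _ _ _ (P n) (Nmn_RV X n n) (vf f))//; first exact: measurable_vf.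
  by exists 1 => mu; exact: norm_vf_le1.
by under eq_fun do rewrite E; move/fine_cvg.
Qed.

Lemma row_laplace_cvgP f :
  row_laplace n f @[n --> \oo] --> \int[distribution P0 N]_mu vf f mu <->
  \int[block_law X r n]_mu (1 - vf f mu) @[n --> \oo] --> \int[lambda]_mu (1 - vf f mu).
Proof.
have [_ _ kcvg _] := hAD1.
have -> : (fun n => \int[block_law X r n]_mu (1 - vf f mu)) =
    (fun n => (n %/ r n)%:R * (1 - block_laplace X r n f)).
  by apply/funext => n; exact: block_law_laplace.
rewrite (canonical_laplace hlambda) -(power_cvgP _ kcvg); last first.
  by move=> n; rewrite block_laplace_gt0 block_laplace_le1.
have /norm_cvg0P h := row_block_cvg f.
set L := expR _; split=> hL.
  have -> : (fun n => block_laplace X r n f ^+ (n %/ r n)) =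
      (fun n => row_laplace n f - (row_laplace n f - block_laplace X r n f ^+ (n %/ r n))).
    by apply/funext => n; rewrite subKr.
  by rewrite -(subr0 L); exact: cvgB.
have -> : row_laplace^~ f = (fun n => block_laplace X r n f ^+ (n %/ r n) +
    (row_laplace n f - block_laplace X r n f ^+ (n %/ r n))).
  by apply/funext => n; rewrite addrC subrK.
by rewrite -(addr0 L); exact: cvgD.
Qed.

Lemma cvg_in_distributionP :
  cvg_in_distribution P (fun n => @Nmn _ _ _ _ X n n) P0 N <->
  forall f, \int[block_law X r n]_mu (1 - vf f mu) @[n --> \oo] --> \int[lambda]_mu (1 - vf f mu).
Proof.
have cE (phi : Mp R -> R) (n : nat) : continuous phi -> (exists C : R, forall mu, `|phi mu| <= C) ->
    ('E_(P n)[phi \o @Nmn _ _ _ _ X n n] = (\int[distribution (P n) (Nmn_RV X n n)]_mu phi mu)%:E)%E.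
  move=> cphi bphi; have mphi := continuous_measurable_Mp cphi.
  rewrite (Rintegral_law _ mphi bphi) expectation_Rintegral//.
    by apply: measurableT_comp => //; exact: measurable_Nmn.
  by have [C hC] := bphi; exists C => w; exact: hC.
have cE0 (phi : Mp R -> R) : continuous phi -> (exists C : R, forall mu, `|phi mu| <= C) ->
    ('E_P0[phi \o N] = (\int[distribution P0 N]_mu phi mu)%:E)%E.
  move=> cphi bphi; have mphi := continuous_measurable_Mp cphi.
  rewrite (Rintegral_law _ mphi bphi) expectation_Rintegral//.
    by apply: measurableT_comp => //; exact: measurable_funPT.
  by have [C hC] := bphi; exists C => w; exact: hC.
split=> h.
  move=> f; refine (proj1 (row_laplace_cvgP f) _).
  have b1 : exists C : R, forall mu, `|vf f mu| <= C by exists 1 => mu; exact: norm_vf_le1.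
  have := h _ (@continuous_vf f) b1.
  rewrite (cE0 _ (@continuous_vf f) b1); under eq_fun do rewrite (cE _ _ (@continuous_vf f) b1).
  exact: fine_cvg.
move=> phi cphi bphi; rewrite cE0//; under eq_fun do rewrite cE//.
apply: cvg_EFin; first exact: nearW.
apply: (@laplace_cvg_bounded R (fun n => distribution (P n) (Nmn_RV X n n))) => // f.
exact: (proj2 (row_laplace_cvgP f) (h f)).
Qed.

End laplace_equivalence.

Section charging_infinity.
Variable R : realType.
Implicit Types (mu : Mp R) (x : R) (A : set (Mp R)).

Lemma infpts_far : infpts R = far 1.
Proof.
have h e : (infpts R) e <-> far 1 e.
  change ((e = -oo%E :> \bar R \/ e = +oo%E :> \bar R) <-> 1 <= `|chart e|).
  rewrite /chart; split=> [[->|->]|e1]; rewrite /= ?normrN ?normr1//.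
  have : `|chart e| == 1 by rewrite eq_le e1 chart_le1.
  rewrite eqr_norml ler01 andbT => /orP[|] /eqP h; [right|left]; apply/eqP.
    by rewrite -contract_eq1; apply/eqP.
  by rewrite -contract_eqN1; apply/eqP.
by apply/seteqP; split=> e /h.
Qed.

Lemma rcborel_infpts : rcborel (infpts R).
Proof. by rewrite infpts_far; exact: rcborel_far_set. Qed.

(** The masses of the sets [outside n.+1%:R] are integers decreasing to the mass of the points at
    infinity, so they are eventually 0. *)
Lemma outside_vanish mu : mu (infpts R) = 0%E -> exists2 x, 0 < x & mu (outside x) = 0%E.
Proof.
rewrite infptsE => h.
have mO (n : nat) : measurable (outside n.+1%:R : set (E R)) by exact: measurable_outside.
have cvg : mu (outside n.+1%:R) @[n --> \oo] --> mu (\bigcap_n outside (n.+1%:R : R)).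
  apply: nonincreasing_cvg_mu => //.
  - by apply: Mp_fin; apply: rcborel_outside.
  - exact: bigcap_measurable.
  - by move=> m n mn; apply/subsetPset; apply: outsideS; rewrite ler_nat.
rewrite h in cvg.
have /cvge_0P/(_ 2^-1) : mu (outside n.+1%:R) @[n --> \oo] --> 0%E by [].
case=> // [n _ /(_ n (leqnn _))] /= hn; exists n.+1%:R => //.
have [k kE] := Mp_nat mu (rcborel_outside (ltr0Sn R n)).
move: hn; rewrite kE lee_fin => hn; suff -> : k = 0%N by [].
apply/eqP; rewrite -leqn0 -ltnS -(ltr_nat R); lra.
Qed.

Let Mp_zeroE (B : set (E R)) : (0 : Mp R) B = 0%E.
Proof. by []. Qed.

Lemma M0cE : M0c R = hit (infpts R).
Proof.
apply/seteqP; split=> mu.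
  move=> [/= mu0 nM0]; rewrite /hit /= lt_neqAle measure_ge0 andbT; apply/eqP => h.
  apply: nM0; split; [by rewrite -h|exact/eqP|by apply: outside_vanish; rewrite -h].
rewrite /hit /= => h; split=> /= [mu0|[h0 _ _]]; last by move: h; rewrite h0 ltxx.
by move: h; rewrite mu0 Mp_zeroE ltxx.
Qed.

Lemma MxE x : Mx x = hit (outside x) `\` hit (infpts R) :> set (Mp R).
Proof.
apply/seteqP; split=> mu.
  by move=> [[h _ _] h2]; split => //; rewrite /hit /= h ltxx.
rewrite /hit /= => -[h1 /negP]; rewrite -leNgt => h2.
have h : mu (infpts R) = 0%E by apply/eqP; rewrite eq_le h2 measure_ge0.
split => //; split => //; last exact: outside_vanish.
by apply/eqP => mu0; move: h1; rewrite mu0 Mp_zeroE ltxx.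
Qed.

Variable lambda : {measure set (Mp R) -> \bar R}.
Hypothesis lambda0 : lambda (hit (infpts R)) = 0%E.

(** [Mx x] differs from [hit (outside x)] only by measures charging infinity, which are null for
    [lambda]. The latter set is a condition on counts, to which the convergence results apply. *)
Lemma lambda_Mx x A : 0 < x -> measurable A ->
  lambda (A `&` Mx x) = lambda (hit (outside x) `&` A).
Proof.
move=> x0 mA; have mi : measurable (hit (infpts R)) by apply: measurable_hit; exact: rcborel_infpts.
have mo : measurable (hit (outside x) : set (Mp R)) by apply: measurable_hit; exact: rcborel_outside.
rewrite MxE setIDA setIC.
have mU : measurable (hit (outside x) `&` A) by exact: measurableI.
apply/eqP; rewrite eq_le; apply/andP; split.
  by apply: le_measure; rewrite ?inE//; exact: measurableD.
have := measureU2 lambda (measurableD mU mi) mi.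
rewrite [X in (_ <= _ + X)%E]lambda0 adde0; apply: le_trans; apply: le_measure; rewrite ?inE//.
  by apply: measurableU => //; exact: measurableD.
by move=> mu h; have [hi|hi] := pselect (hit (infpts R) mu); [right|left].
Qed.

End charging_infinity.

Section fixed_atoms.
Context (R : realType) (d : measure_display) (Omega : measurableType d)
  (P : probability Omega R) (N : {RV P >-> Mp R}) (lambda : {measure set (Mp R) -> \bar R}).
Hypotheses (hlambda : canonical_measure N lambda) (hNR : on_real_line N).

Lemma measurable_singleton (e : E R) : measurable [set e].
Proof.
apply: closed_measurable_E.
rewrite (_ : [set e] = @chart R @^-1` [set chart e]).
  have /continuous_closedP h := @chart_cont R.
  by apply: h; exact: closed_eq.
apply/seteqP; split=> y /=; first by move=> ->.
by move=> h; apply: val_inj; exact: contract_inj h.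
Qed.

Let measurable_charged (B : set (E R)) : rcborel B -> measurable [set w | (0 < N w B)%E].
Proof. by move=> rB; have := measurable_funPT N measurableT _ (measurable_hit rB); rewrite setTI. Qed.

Lemma canonical_infpts : lambda (hit (infpts R)) = 0%E.
Proof.
apply: (canonical_null hlambda); first by rewrite infpts_far; exact: closed_far.
  by exists 1 => //; rewrite infpts_far.
have [A [mA A0 sub]] := hNR; apply/eqP; rewrite eq_le measure_ge0 andbT.
apply: (@le_trans _ _ (P A)); last by rewrite A0.
apply: le_measure; rewrite ?inE//; first exact: measurable_charged (@rcborel_infpts R).
by move=> w /= h; apply: sub => /= h0; move: h; rewrite h0 ltxx.
Qed.

Lemma sphere_law (x : R) : 0 < x ->
  ~ fixed_atom_modulus N x <-> distribution P N (hit (sphere x)) = 0%E.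
Proof.
move=> x0; have xn : x != 0 by rewrite gt_eqF.
have mN := measurable_charged.
have rS := rcborel_sphere x0.
have far_s : sphere x `<=` far (contract x%:E) := @sphere_far R x.
have rp (y : R) : [set toE y] `<=` sphere x -> rcborel [set toE y].
  move=> ys; apply: (far_rcborel (contract_gt0 x0)); first exact: measurable_singleton.
  exact: subset_trans ys _.
have s1 : [set toE x] `<=` sphere x by rewrite sphereE// => e; left.
have s2 : [set toE (- x)] `<=` sphere x by rewrite sphereE// => e; right.
have le y : [set toE y] `<=` sphere x ->
    (P [set w | (0 < N w [set toE y])%E] <= P [set w | (0 < N w (sphere x))%E])%E.
  move=> ys; apply: le_measure; rewrite ?inE//; [exact/mN/rp|exact: mN|].
  move=> w /= /lt_le_trans; apply; apply: le_measure; rewrite ?inE//.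
    exact: measurable_singleton.
  exact: measurable_sphere.
split=> [nD|h].
  rewrite /distribution /pushforward /=.
  have z y : y != 0 -> ~ fixed_atom N y -> P [set w | (0 < N w [set toE y])%E] = 0%E.
    move=> y0 ny; apply/eqP; rewrite eq_le measure_ge0 andbT leNgt; apply/negP => h.
    by apply: ny.
  have z1 := z x xn (fun h => nD (conj x0 (or_introl h))).
  have xn' : - x != 0 by rewrite oppr_eq0.
  have z2 := z (- x) xn' (fun h => nD (conj x0 (or_intror h))).
  apply/eqP; rewrite eq_le measure_ge0 andbT.
  have := measureU2 P (mN _ (rp _ s1)) (mN _ (rp _ s2)).
  rewrite [X in (_ <= X + _)%E]z1 [X in (_ <= _ + X)%E]z2 adde0; apply: le_trans.
  apply: le_measure; rewrite ?inE//.
  - exact: mN.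
  - by apply: measurableU; apply: mN; exact: rp.
  - move=> w; rewrite /hit /= sphereE// => h.
    have := measureU2 (N w) (measurable_singleton (toE x)) (measurable_singleton (toE (- x))).
    move/(lt_le_trans h) => {}h; apply: contrapT => /not_orP[] /= /negP + /negP.
    rewrite -!leNgt => h1 h2; move: h; rewrite ltNge => /negP; apply.
    by rewrite -[0%E]adde0 leeD.
case=> _ [] [_]; rewrite ltNge => /negP; apply.
  by rewrite (le_trans (le _ s1))// [X in (X <= _)%E]h.
by rewrite (le_trans (le _ s2))// [X in (X <= _)%E]h.
Qed.

Lemma canonical_sphere (x : R) : 0 < x -> ~ fixed_atom_modulus N x ->
  lambda (hit (sphere x)) = 0%E.
Proof.
move=> x0 /(sphere_law x0) h; apply: (canonical_null hlambda) => //.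
- exact: closed_sphere.
- by exists (contract x%:E); [exact: contract_gt0|exact: sphere_far].
Qed.

(** Spheres of different radii are disjoint, so only countably many of them are hit by [N] with
    positive probability. *)
Lemma not_fixed_atom_between (a b : R) : 0 < a -> a < b ->
  exists2 x, a < x < b & ~ fixed_atom_modulus N x.
Proof.
(* Small radii get the empty set, so that the whole family lies in one relatively compact set. *)
move=> a0 ab; pose A t := if a < t then sphere t else set0.
have cA : countable [set t | distribution P N (hit (A t)) != 0%E].
  apply: (hit_disjoint_countable (B := far (contract a%:E))).
  - exact: law_locfin.
  - by apply: rcborel_far_set; exact: contract_gt0.
  - by move=> t; rewrite /A; case: ifP => // _; exact: measurable_sphere.
  - move=> t; rewrite /A; case: ifP => ta e et; last by [].
    have h : contract t%:E <= `|chart e| := @sphere_far R t e et.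
    change (contract a%:E <= `|chart e|); apply: le_trans h.
    by rewrite ltW// lt_contract lte_fin.
  - move=> t u tu; rewrite /A; case: ifP => // _; last by rewrite set0I.
    case: ifP => // _; last by rewrite setI0.
    apply/seteqP; split=> // e [h1 h2]; move/eqP: tu; apply.
    have : contract t%:E = contract u%:E :> R by rewrite -[LHS]h1 -[RHS]h2.
    by move/contract_inj => -[].
have [x /andP[ax xb] nx] := countable_itv_avoid ab cA.
exists x; first by rewrite ax xb.
apply/(sphere_law (lt_trans a0 ax)); move: nx; rewrite /= /A ax => /negP.
by rewrite negbK => /eqP.
Qed.

End fixed_atoms.

(** * Count events with null boundary *)

Section null_boundaries.
Variable R : realType.
Implicit Types (mu : Mp R) (x eta : R) (B : set (E R)) (s : seq (set (E R) * nat)).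

Lemma Jwf_le eta eta' s : eta' <= eta -> Jwf eta s -> Jwf eta' s.
Proof.
move=> le; elim: s => //= y s ih [mB Bf k0 /ih h]; split => // e /Bf.
exact: le_trans.
Qed.

Lemma Jgood_wf (good : set (E R) -> Prop) s : (forall B, good B -> rcborel B) ->
  Jgood good s -> exists2 eta, 0 < eta & Jwf eta s.
Proof.
move=> grc; elim: s => [|y s ih] /=; first by exists 1.
move=> [gy k0 /ih[eta eta0 wf]]; have ry := grc _ gy.
have [eta' eta'0 yf] := rcborel_far ry; have [my _] := ry.
exists (Num.min eta eta'); first by rewrite lt_min eta0.
split=> //; last by apply: Jwf_le wf; rewrite ge_min lexx.
by move=> e /yf; apply: le_trans; rewrite ge_min lexx orbT.
Qed.

Lemma measurable_boundary B : measurable (boundary B).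
Proof.
apply: measurableD; first by apply: closed_measurable_E; exact: closed_closure.
by apply: open_measurable_E; exact: open_interior.
Qed.

Lemma rcborel_boundary eta B : 0 < eta -> B `<=` far eta -> rcborel (boundary B).
Proof.
move=> eta0 Bf; apply: (far_rcborel eta0 (measurable_boundary B)) => e [+ _].
by rewrite closureE; apply; split => //; exact: closed_far.
Qed.

Lemma le_closure_interior mu B : mu (boundary B) = 0%E ->
  (mu (closure B) <= mu (interior B))%E.
Proof.
move=> b0; have mi : measurable (interior B) by apply: open_measurable_E; exact: open_interior.
have := measureU2 mu mi (measurable_boundary B).
rewrite [X in (_ <= _ + X)%E]b0 adde0; apply: le_trans; apply: le_measure; rewrite ?inE.
- by apply: closed_measurable_E; exact: closed_closure.
- by apply: measurableU => //; exact: measurable_boundary.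
- by move=> e ce; have [|ni] := pselect (interior B e); [left|right; split].
Qed.

Variable lambda : {measure set (Mp R) -> \bar R}.
Hypothesis lambda0 : lambda (hit (infpts R)) = 0%E.
Variable x : R.
Hypotheses (x0 : 0 < x) (lambdax : lambda (hit (sphere x)) = 0%E).

Lemma Bxl_hit B eta : 0 < eta -> B `<=` far eta -> measurable B ->
  Bxl lambda x B <-> lambda (hit (outside x) `&` hit (boundary B)) = 0%E.
Proof.
move=> eta0 Bf mB; rewrite -lambda_Mx//; last first.
  by apply: measurable_hit; exact: rcborel_boundary Bf.
have rB := far_rcborel eta0 mB Bf.
rewrite (_ : hit (boundary B) `&` Mx x = [set mu : Mp R | Mx x mu /\ (0 < mu (boundary B))%E]).
  by split=> [[]//|]; split.
by rewrite setIC.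
Qed.

(** [Z] gathers the measures that charge both [outside x] and the boundary of some set of [s]. On
    the rest of [Mx x] each closure has the mass of the corresponding interior. *)
Lemma Bxl_exceptional eta s : 0 < eta -> Jwf eta s -> Jgood (Bxl lambda x) s ->
  exists Z : set (Mp R), [/\ measurable Z, lambda Z = 0%E & forall mu, Mx x mu -> ~ Z mu ->
    Jset (Jmap (@closure (E R)) s) mu -> Jset (Jmap (@interior (E R)) s) mu].
Proof.
move=> eta0; elim: s => [_ _|[B k] s ih] /=; first by exists set0; rewrite measure0.
move=> [mB Bf k0 /ih{}ih] [gB _ /ih[Z [mZ Z0 hZ]]].
have mb : measurable (hit (boundary B)) by apply: measurable_hit; exact: rcborel_boundary Bf.
have mo : measurable (hit (outside x) : set (Mp R)) by apply: measurable_hit; exact: rcborel_outside.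
have /(Bxl_hit eta0 Bf mB) h := gB.
exists ((hit (outside x) `&` hit (boundary B)) `|` Z); split.
- by apply: measurableU => //; exact: measurableI.
- apply/eqP; rewrite eq_le measure_ge0 andbT.
  have := measureU2 lambda (measurableI _ _ mo mb) mZ.
  by rewrite [X in (_ <= X + _)%E]h [X in (_ <= _ + X)%E]Z0 adde0.
move=> mu Mmu /not_orP[n1 n2] [h1 h2]; split; last exact: hZ.
apply: le_trans h1 _ => /=; apply: le_closure_interior.
apply/eqP; rewrite eq_le measure_ge0 andbT leNgt; apply/negP => hb.
by apply: n1; split => //; have [_] := Mmu.
Qed.

Let s1 s := (outside x : set (E R), 1%N) :: s.

Lemma Jgood_outside_wf s : Jgood (Bxl lambda x) s -> exists2 eta, 0 < eta & Jwf eta (s1 s).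
Proof.
move=> gs; apply: (@Jgood_wf rcborel) => //=; split=> //; first exact: rcborel_outside.
by elim: s gs => //= y s ih [[? _] ? /ih ?].
Qed.

(** [Bxl] controls boundaries only on [Mx x], so the first set is treated first: a measure charging
    the closure of [outside x] but neither [sphere x] nor infinity charges [outside x] itself and
    belongs to [Mx x]. [Bxl_exceptional] then handles [s]. *)
Lemma Jset_null_boundary s : Jgood (Bxl lambda x) s ->
  lambda (Jset (Jmap (@closure (E R)) (s1 s))) = lambda (Jset (Jmap (@interior (E R)) (s1 s))).
Proof.
move=> gs; have [eta eta0 wf] := Jgood_outside_wf gs.
have wfc := Jwf_closure wf; have wfi := Jwf_interior wf.
have mc := measurable_Jset eta0 wfc; have mi := measurable_Jset eta0 wfi.
apply/eqP; rewrite eq_le; apply/andP; split; last first.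
  apply: le_measure; rewrite ?inE//; apply: (Jset_le eta0 wfi wfc) => B.
  by apply: (subset_trans (@interior_subset _ B)); exact: subset_closure.
have [_ _ _ wfs] := wf.
have [Z [mZ Z0 hZ]] := Bxl_exceptional eta0 wfs gs.
pose W := Z `|` (hit (sphere x) `|` hit (infpts R)).
have mS : measurable (hit (sphere x)) by apply: measurable_hit; exact: rcborel_sphere.
have mI : measurable (hit (infpts R)) by apply: measurable_hit; exact: rcborel_infpts.
have mSI : measurable (hit (sphere x) `|` hit (infpts R)) by exact: measurableU.
have mW : measurable W by exact: measurableU.
have W0 : lambda W = 0%E.
  apply/eqP; rewrite eq_le measure_ge0 andbT.
  have h1 := measureU2 lambda mZ mSI; have h2 := measureU2 lambda mS mI.
  apply: le_trans h1 _; rewrite [X in (X + _)%E]Z0 add0e; apply: le_trans h2 _.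
  by rewrite [X in (X + _)%E]lambdax [X in (_ + X)%E]lambda0 adde0.
have := measureU2 lambda mi mW.
rewrite [X in (_ <= _ + X)%E]W0 adde0; apply: le_trans; apply: le_measure; rewrite ?inE//.
  exact: measurableU.
move=> mu h; have [|nW] := pselect (W mu); [by right|left].
move: nW => /not_orP[nZ /not_orP[nS nI]]; have [h1 h2] := h.
have b0 : mu (boundary (outside x)) = 0%E.
  apply/eqP; rewrite eq_le measure_ge0 andbT leNgt; apply/negP => hb; apply: nS.
  apply: hitS hb; [exact: measurable_boundary|exact: measurable_sphere|exact: boundary_outside].
have h1' : atleast (interior (outside x)) 1 mu.
  by apply: le_trans h1 _; exact: le_closure_interior.
split => //; apply: hZ => //; rewrite MxE; split => //.
by rewrite (hit_atleast (rcborel_outside x0)); move: h1'; rewrite ((interior_id _).1 (open_outside x0)).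
Qed.

End null_boundaries.

Lemma limn_esup_near (R : realType) (u v : nat -> \bar R) :
  (\forall n \near \oo, u n = v n) -> limn_esup u = limn_esup v.
Proof.
suff le (f g : nat -> \bar R) : (\forall n \near \oo, f n = g n) ->
    (limn_esup f <= limn_esup g)%E.
  move=> uv; apply/eqP; rewrite eq_le !le//.
  by apply: filterS uv => n ->.
move=> fg; rewrite /limn_esup /limf_esup; apply: le_ereal_inf_tmp => _ [V FV <-].
apply: (@le_trans _ _ (ereal_sup (f @` (V `&` [set n | f n = g n])))).
  by apply: ereal_inf_lbound; exists (V `&` [set n | f n = g n]) => //; exact: filterI.
apply: ge_ereal_sup => _ [n [Vn fgn] <-]; apply: ereal_sup_ubound; exists n => //.
Qed.

Section level_sets.
Variable R : realType.
Variable lambda : {measure set (Mp R) -> \bar R}.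
Hypotheses (llam : locfin lambda) (lambda0 : lambda (hit (infpts R)) = 0%E).
Implicit Types (s : seq (set (E R) * nat)).

Lemma CK_outside (f : CKplus R) : exists2 eta : R, 0 < eta &
  forall x, 0 < x -> x < eta -> forall e, f e != 0 -> outside x e.
Proof.
have [eta eta0 fe] := CK_far f; exists eta => // x x0 xe e /fe h.
apply/(chart_outside e x0); apply: lt_le_trans h; apply: le_lt_trans xe.
rewrite /= ger0_norm ?(ltW x0)// ler_pdivrMr ?ltr_pwDl ?(ltW x0)//.
by rewrite ler_peMr ?(ltW x0)// lerDl ltW.
Qed.

(** The boundary of the set where [f > t] lies in the level set [f = t]. Level sets are disjoint
    and, for [t > 0], contained in [outside x], so all but countably many are null. *)
Lemma level_sets_Bxl (f : CKplus R) (x : R) : 0 < x -> (forall e, f e != 0 -> outside x e) ->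
  exists2 D : set R, countable D & forall t, 0 < t -> ~ D t -> Bxl lambda x [set e | t < f e].
Proof.
move=> x0 fx; pose A t := if 0 < t then [set e | f e = t] else set0.
have cl t : closed [set e | f e = t].
  have /continuous_closedP h := @CK_continuous _ f.
  by apply: (h [set t]); exact: closed_eq.
exists [set t | lambda (hit (A t)) != 0%E].
  apply: (hit_disjoint_countable llam (rcborel_outside x0)).
  - by move=> t; rewrite /A; case: ifP => // _; exact: closed_measurable_E.
  - move=> t; rewrite /A; case: ifP => t0 e; last by [].
    by move=> ft; apply: fx; rewrite ft gt_eqF.
  - move=> t u tu; rewrite /A; case: ifP => _; last by rewrite set0I.
    case: ifP => _; last by rewrite setI0.
    by apply/seteqP; split=> // e [ft fu]; move/eqP: tu; apply; rewrite -ft -fu.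
move=> t t0 /negP; rewrite negbK /A t0 => /eqP h.
have of' : open [set e | t < f e] by apply: cont_open_gt; exact: CK_continuous.
have mf := open_measurable_E of'.
have ff : [set e | t < f e] `<=` far (contract x%:E).
  move=> e ft; apply: (outside_far x0); apply: fx.
  by rewrite gt_eqF// (lt_trans t0 ft).
have rE : rcborel [set e | f e = t].
  apply: (far_rcborel (contract_gt0 x0) (closed_measurable_E (cl t))) => e ft.
  by apply: (outside_far x0); apply: fx; rewrite ft gt_eqF.
have bs : boundary [set e | t < f e] `<=` [set e | f e = t].
  move=> e [ce ie] /=; apply/eqP; rewrite eq_le; apply/andP; split.
    rewrite leNgt; apply/negP => lt; apply: ie.
    by rewrite ((interior_id _).1 of').
  move: ce; rewrite closureE => /(_ [set e | t <= f e]); apply; split; last first.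
    by move=> y /ltW.
  have /continuous_closedP hc := @CK_continuous _ f.
  by apply: (hc [set y | t <= y]); exact: closed_ge.
apply/(Bxl_hit lambda0 x0 (contract_gt0 x0) ff mf).
apply/eqP; rewrite eq_le measure_ge0 andbT -[leRHS]h.
have mb : measurable (hit (boundary [set e | t < f e])).
  by apply: measurable_hit; exact: (rcborel_boundary (contract_gt0 x0) ff).
apply: le_measure; rewrite ?inE.
- by apply: measurableI => //; apply: measurable_hit; exact: rcborel_outside.
- exact: measurable_hit.
- move=> mu [_]; apply: hitS => //; first exact: measurable_boundary.
  exact: closed_measurable_E.
Qed.

Lemma Jxl_Jset (x : R) M : Jxl lambda x M ->
  exists2 s, Jgood (Bxl lambda x) s & M = Jset s.
Proof.
move=> [d [B [k [d0 hB hk ->]]]].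
exists [seq (B i, k i) | i <- enum 'I_d].
  by elim: (enum 'I_d) => //= i t ih; split.
have E t mu : Jset [seq (B i, k i) | i <- t] mu <->
    forall i, i \in t -> ((k i)%:R%:E <= mu (B i))%E.
  elim: t => [|i t ih] //=; split.
    by move=> [h /ih h'] j; rewrite inE => /orP[/eqP ->//|/h'].
  move=> h; split; first by apply: h; rewrite inE eqxx.
  by apply/ih => j jt; apply: h; rewrite inE jt orbT.
apply/seteqP; split=> mu.
  by move=> h; apply/E => i _; exact: h.
by move=> /E h i _; apply: h; rewrite mem_enum.
Qed.

(** The class [Jxl] consists of nonempty intersections; the empty list is covered by clause (a'). *)
Lemma Jset_Jxl (x : R) s : (0 < size s)%N -> Jgood (Bxl lambda x) s -> Jxl lambda x (Jset s).
Proof.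
move=> s0 gs; exists (size s), (fun i => (tnth (in_tuple s) i).1), (fun i => (tnth (in_tuple s) i).2).
have gA (t : seq (set (E R) * nat)) (y : set (E R) * nat) : Jgood (Bxl lambda x) t ->
    y \in t -> Bxl lambda x y.1 /\ (0 < y.2)%N.
  elim: t => //= z t ih [h1 h2 h3]; rewrite inE => /orP[/eqP ->//|]; exact: ih.
have inT (i : 'I_(size s)) : tnth (in_tuple s) i \in s by exact: mem_tnth.
split=> // [i|i|]; [by have [] := gA s _ gs (inT i)|by have [] := gA s _ gs (inT i)|].
have E t mu : Jset t mu <-> forall i, (i < size t)%N ->
    ((nth (set0, 0%N) t i).2%:R%:E <= mu (nth (set0, 0%N) t i).1)%E.
  elim: t => [|y t ih] //=; split.
    by move=> [h /ih h'] [|i] //; exact: h'.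
  move=> h; split; first exact: (h 0%N).
  by apply/ih => i it; exact: (h i.+1).
apply/seteqP; split=> mu.
  by move=> /E h i _ /=; rewrite (tnth_nth (set0, 0%N)); exact: h.
move=> h; apply/E => i is'; have := h (Ordinal is') I.
by rewrite /= (tnth_nth (set0, 0%N)).
Qed.

End level_sets.

Section exceedance_events.
Variables (R : realType) (d : nat -> measure_display).
Variables (Omega : forall n, measurableType (d n)).
Variables (P : forall n, probability (Omega n) R).
Variable X : forall n, nat -> {RV (P n) >-> R}.
Hypothesis hX0 : nonzero_array X.
Implicit Types (s : seq (set (E R) * nat)).

Lemma Mmn_outside n m (x : R) (w : Omega n) : 0 < x -> (m <= n)%N ->
  x < Mmn X m w <-> atleast (outside x) 1 (Nmn X m w).
Proof.
move=> x0 mn; rewrite /atleast /= NmnE; last exact: measurable_outside.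
rewrite lee_fin ler1n.
have {mn} : {in index_iota 1 m.+1, forall j, (1 <= j <= n)%N}.
  by move=> j; rewrite mem_index_iota => /andP[-> jm] /=; exact: leq_trans mn.
rewrite /Mmn; elim: (index_iota 1 m.+1) => [|j t ih] tn.
  by rewrite !big_nil; split => // h; have := lt_trans x0 h; rewrite ltxx.
have {}ih := ih (fun i it => tn i (mem_behead (s := j :: t) it)).
have Xn0 : X n j w != 0 by apply: hX0; apply: tn; rewrite mem_head.
rewrite !big_cons lt_max addn_gt0 lt0b; split=> /orP[].
- by move=> /(toE_outside x Xn0) h; rewrite (mem_set h).
- by move=> /ih ->; rewrite orbT.
- by move=> /set_mem/(toE_outside x Xn0) ->.
- by move=> /ih ->; rewrite orbT.
Qed.

Lemma Jset_Mmn n m (x : R) s : 0 < x -> (m <= n)%N ->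
  [set w : Omega n | Jset s (Nmn X m w) /\ (x < Mmn X m w)%R] =
  [set w | Jset ((outside x, 1%N) :: s) (Nmn X m w)].
Proof.
move=> x0 mn; apply/seteqP; split=> w /= [].
  by move=> h /(Mmn_outside w x0 mn).
by move=> /(Mmn_outside w x0 mn).
Qed.

Variable r : nat -> nat.

Lemma fine_block_law n (eta : R) s : 0 < eta -> Jwf eta s ->
  fine (block_law X r n (Jset s)) = (n %/ r n)%:R * block_prob X s n (r n).
Proof.
move=> eta0 wf; rewrite block_lawE fineM//; apply: fin_num_measure.
have := @measurable_Nmn R d Omega P X (r n) n measurableT _ (measurable_Jset eta0 wf).
by rewrite setTI.
Qed.

Lemma fin_block_prob n m (eta : R) s : 0 < eta -> Jwf eta s ->
  P n [set w | Jset s (Nmn X m w)] = (block_prob X s n m)%:E.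
Proof.
move=> eta0 wf; rewrite /block_prob fineK//; apply: fin_num_measure.
have := @measurable_Nmn R d Omega P X m n measurableT _ (measurable_Jset eta0 wf).
by rewrite setTI.
Qed.

End exceedance_events.

(** * The clauses (a') and (b') as convergence of block laws *)

Section clauses.
Variables (R : realType) (d : nat -> measure_display).
Variables (Omega : forall n, measurableType (d n)).
Variables (P : forall n, probability (Omega n) R).
Variable X : forall n, nat -> {RV (P n) >-> R}.
Hypotheses (hX0 : nonzero_array X) (hXst : stationary_rows X).
Variable r : nat -> nat.
Hypotheses (hAN : cond_AN X) (hAC : cond_AC X r).
Hypothesis kcvg : (n %/ r n)%N @[n --> \oo] --> \oo.
Variable lambda : {measure set (Mp R) -> \bar R}.
Hypotheses (llam : locfin lambda) (lambda0 : lambda (hit (infpts R)) = 0%E).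
Implicit Types (x : R) (s : seq (set (E R) * nat)).

Definition Jset_limit x s : Prop := lim_to_m0 (m0 X r)
  (fun m => limn_esup (fun n =>
     `| n%:R%:E * (P n [set w | Jset s (Nmn X m w) /\ (x < Mmn X m w)%R]
                   - P n [set w | Jset s (Nmn X m.-1 w) /\ (x < Mmn X m.-1 w)%R])
        - lambda (Jset s `&` Mx x) |%E)) 0%E.

Definition Jset_block_cvg x s : Prop :=
  fine (block_law X r n (Jset ((outside x, 1%N) :: s))) @[n --> \oo] -->
  fine (lambda (Jset ((outside x, 1%N) :: s))).

(** This is [block_limit] for the list with [outside x] prepended, which encodes that the maximum
    exceeds [x]. The encoding holds for [m <= n], that is eventually, and upper limits do not see
    the other [n]. *)
Lemma Jset_limitP x s : 0 < x -> Jgood (Bxl lambda x) s ->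
  Jset_limit x s <-> Jset_block_cvg x s.
Proof.
move=> x0 gs; have [eta eta0 wf] := Jgood_outside_wf x0 gs.
have mJ : measurable (Jset s) by have [_ _ _ wfs] := wf; exact: measurable_Jset wfs.
have lJ : lambda (Jset s `&` Mx x) = lambda (Jset ((outside x, 1%N) :: s)).
  by rewrite lambda_Mx//= hit_atleast//; exact: rcborel_outside.
have lf : lambda (Jset ((outside x, 1%N) :: s)) \is a fin_num.
  rewrite ge0_fin_numE//; apply: le_lt_trans (llam (rcborel_outside x0)).
  apply: le_measure; rewrite ?inE.
  - exact: measurable_Jset wf.
  - by apply: measurable_hit; exact: rcborel_outside.
  - by move=> mu [h _]; rewrite hit_atleast//; exact: rcborel_outside.
have := @block_limit _ _ _ _ _ hX0 hXst r hAN hAC kcvg eta _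
  (fine (lambda (Jset ((outside x, 1%N) :: s)))) eta0 wf isT.
rewrite /Jset_block_cvg.
have -> : (fun n => fine (block_law X r n (Jset ((outside x, 1%N) :: s)))) =
    (fun n => (n %/ r n)%:R * block_prob X ((outside x, 1%N) :: s) n (r n)).
  by apply/funext => n; exact: fine_block_law wf.
move=> ->; rewrite /Jset_limit.
set f := fun m => limn_esup _; set g := fun m => limn_esup _.
suff -> : f = g by [].
apply/funext => m; apply: limn_esup_near; exists m => // n /= mn.
have mn' : (m.-1 <= n)%N by rewrite (leq_trans (leq_pred m)).
rewrite !Jset_Mmn// !(fin_block_prob _ _ _ eta0 wf) lJ -[lambda _]fineK//.
Qed.

(** Identifies clause (a') with the case of the empty list. *)
Lemma exceed_limitE x :
  lim_to_m0 (m0 X r)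
    (fun m => limn_esup (fun n =>
      `| n%:R%:E * (P n [set w | (x < Mmn X m w)%R] - P n [set w | (x < Mmn X m.-1 w)%R])
         - lambda (Mx x) |%E)) 0%E = Jset_limit x [::].
Proof.
have E n m : [set w : Omega n | Jset [::] (Nmn X m w) /\ (x < Mmn X m w)%R] =
    [set w | (x < Mmn X m w)%R].
  by apply/seteqP; split=> w // -[].
rewrite /Jset_limit; congr lim_to_m0; apply/funext => m; congr limn_esup.
by apply/funext => n; rewrite !E setTI.
Qed.

Context (d0 : measure_display) (Omega0 : measurableType d0)
  (P0 : probability Omega0 R) (N : {RV P0 >-> Mp R}).
Hypotheses (hlambda : canonical_measure N lambda) (hNR : on_real_line N).

Lemma laplace_Jset_cvg x s :
  (forall f, \int[block_law X r n]_mu (1 - vf f mu) @[n --> \oo] --> \int[lambda]_mu (1 - vf f mu)) ->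
  0 < x -> ~ fixed_atom_modulus N x -> Jgood (Bxl lambda x) s -> Jset_block_cvg x s.
Proof.
move=> h x0 nx gs; have [eta eta0 wf] := Jgood_outside_wf x0 gs.
apply: (@Jset_cvg _ (block_law X r) lambda _ llam h eta (outside x, 1%N) s eta0 wf).
  exact: block_law_locfin.
apply: Jset_null_boundary => //; exact: (canonical_sphere hlambda).
Qed.

Lemma Jset_laplace_cvg :
  (forall x s, 0 < x -> ~ fixed_atom_modulus N x -> Jgood (Bxl lambda x) s -> Jset_block_cvg x s) ->
  forall f, \int[block_law X r n]_mu (1 - vf f mu) @[n --> \oo] --> \int[lambda]_mu (1 - vf f mu).
Proof.
move=> h f; have [eta eta0 fo] := CK_outside f.
have e20 : 0 < eta / 2 by rewrite divr_gt0.
have e2 : eta / 2 < eta by rewrite ltr_pdivrMr// ltr_pMr// ltr1n.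
(* The radius must be below [eta], so that [f] is supported in [outside x], and outside [D'], so
   that the hypothesis applies. Taking it above [eta / 2] keeps it positive. *)
have [x /andP[x2 xe] nx] := not_fixed_atom_between N e20 e2.
have x0 : 0 < x := lt_trans e20 x2.
have fx := fo x x0 xe.
have [D cD hD] := level_sets_Bxl llam lambda0 x0 fx.
have [C hC] := block_law_moment hX0 hXst hAN kcvg x0.
apply: (@hit_laplace_cvg _ (block_law X r) lambda _ llam (outside x) (Bxl lambda x)
  (rcborel_outside x0) _ _ C hC f D fx cD hD).
- exact: block_law_locfin.
- by move=> B [].
- move=> s gs; have := h x s x0 nx gs.
  by rewrite /Jset_block_cvg /= hit_atleast//; exact: rcborel_outside.
Qed.

End clauses.

Theorem theorem2p5 (R : realType)
    (d : nat -> measure_display) (Omega : forall n, measurableType (d n))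
    (P : forall n, probability (Omega n) R)
    (X : forall n, nat -> {RV (P n) >-> R})
    (hX0 : nonzero_array X) (hXst : stationary_rows X)
    (r : nat -> nat) (hAN : cond_AN X) (hAD1 : cond_AD1 X r) (hAC : cond_AC X r)
    (d0 : measure_display) (Omega0 : measurableType d0)
    (P0 : probability Omega0 R) (N : {RV P0 >-> Mp R})
    (hNR : on_real_line N) (hNid : infinitely_divisible N)
    (lambda : {measure set (Mp R) -> \bar R})
    (hlambda : canonical_measure N lambda) :
  cvg_in_distribution P (fun n => Nmn X n (n := n)) P0 N
  <->
  [/\ lambda (M0c R) = 0%E,
      forall x : R, 0 < x -> ~ fixed_atom_modulus N x ->
        lim_to_m0 (m0 X r)
          (fun m => limn_esup (fun n =>
            `| n%:R%:E * (P n [set w | (x < Mmn X m w)%R]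
                          - P n [set w | (x < Mmn X m.-1 w)%R])
               - lambda (Mx x) |%E))
          0%E &
      forall x : R, 0 < x -> ~ fixed_atom_modulus N x ->
      forall M : set (Mp R), Jxl lambda x M ->
        lim_to_m0 (m0 X r)
          (fun m => limn_esup (fun n =>
            `| n%:R%:E * (P n [set w | M (Nmn X m w) /\ (x < Mmn X m w)%R]
                          - P n [set w | M (Nmn X m.-1 w)
                                         /\ (x < Mmn X m.-1 w)%R])
               - lambda (M `&` Mx x) |%E))
          0%E].
Proof.
have [_ _ kcvg _] := hAD1.
have llam := canonical_locfin hlambda.
have lambda0 := canonical_infpts hlambda hNR.
have jP x s x0 gs := @Jset_limitP _ _ _ _ _ hX0 hXst r hAN hAC kcvg _ llam lambda0 x s x0 gs.
rewrite (cvg_in_distributionP hAD1 hlambda); split=> [h|[_ ha hb]].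
  have hJ x s (x0 : 0 < x) (nx : ~ fixed_atom_modulus N x) (gs : Jgood (Bxl lambda x) s) :
      Jset_limit X r lambda x s.
    apply: (proj2 (jP x s x0 gs)).
    exact: (laplace_Jset_cvg llam lambda0 hlambda h x0 nx gs).
  split=> [|x x0 nx|x x0 nx M /Jxl_Jset[s gs ->]].
  - by rewrite M0cE.
  - by rewrite exceed_limitE; exact: hJ.
  - exact: (hJ x s x0 nx gs).
apply: (Jset_laplace_cvg hX0 hXst hAN kcvg llam lambda0 (N := N)) => x s x0 nx gs.
(* The empty list is clause (a'), a nonempty one clause (b'). *)
apply: (proj1 (jP x s x0 gs)); case: s gs => [|y s] gs.
  by rewrite -exceed_limitE; exact: ha.
exact: (hb x x0 nx _ (@Jset_Jxl _ _ x (y :: s) isT gs)).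
Qed.
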